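(* Let $\alpha,\beta,\gamma\in\mathbb{R}$ with $\gamma\neq 0$, let $X=\begin{pmatrix}\beta&\alpha\\ \gamma&-\beta\end{pmatrix}$, $\begin{pmatrix}a_t&b_t\\ c_t&d_t\end{pmatrix}=e^{tX}$ and $g_t(z)=\frac{a_tz+b_t}{c_tz+d_t}$ for $t\in\mathbb{R}$, $z\in\mathbb{C}_+$. Let $M_0$ be a Herglotz function, $M_t=g_t\circ M_0$, and let $t_1,t_2\in\mathbb{R}$ with $t_1<t_2$. Then the integrated Herglotz function $$M_{t_1,t_2}(z)=\int_{t_1}^{t_2}dt\,M_t(z),\qquad z\in\mathbb{C}_+,$$ admits the Herglotz representation $$M_{t_1,t_2}(z)=B_{t_1,t_2}+\int_{\mathbb{R}}d\mu_{t_1,t_2}(\lambda)\left(\frac{1}{\lambda-z}-\frac{\lambda}{1+\lambda^2}\right),\qquad z\in\mathbb{C}_+,$$ where $B_{t_1,t_2}\in\mathbb{R}$ and the Borel measure $\mu_{t_1,t_2}$ is absolutely continuous with respect to Lebesgue measure on $\mathbb{R}$, with bounded Radon--Nikodym derivative $\frac{d\mu_{t_1,t_2}}{d\lambda}=\xi_{t_1,t_2}\in L^\infty(\mathbb{R})$. In fact, for a.e. $\lambda\in\mathbb{R}$, $$\xi_{t_1,t_2}(\lambda)=\frac{1}{\gamma}\big(\xi_{t_2}(\lambda)-\xi_{t_1}(\lambda)\big),\qquad\text{where}\quad \xi_t(\lambda)=\lim_{\varepsilon\downarrow0}\frac1\pi\,\mathrm{Im}\,L_t\big(M_0(\lambda+i\varepsilon)\big),\quad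 t\in\mathbb{R},$$ and $L_t(w)$ is the continuous-in-$t$ logarithm of $c_tw+d_t$ defined in the context.
   Context: $\mathbb{C}_+$ is the open upper half-plane. A Herglotz function is an analytic map $M:\mathbb{C}_+\to\mathbb{C}_+$; it has a unique representation $M(z)=Az+B+\int_{\mathbb{R}}d\mu(\lambda)\left(\frac1{\lambda-z}-\frac{\lambda}{1+\lambda^2}\right)$ with $A\ge0$, $B\in\mathbb{R}$ and $\mu$ a Borel measure on $\mathbb{R}$ with $\int_{\mathbb{R}}\frac{d\mu(\lambda)}{1+\lambda^2}<\infty$. Each $g_t$ is an automorphism of $\mathbb{C}_+$, $g_0=\mathrm{id}$. For $w\in\mathbb{C}_+$ the path $t\mapsto c_tw+d_t$, $t\in\mathbb{R}$, is continuous, never zero, and equals $1$ at $t=0$; $t\mapsto L_t(w)$ denotes the unique continuous function on $\mathbb{R}$ with $e^{L_t(w)}=c_tw+d_t$ and $L_0(w)=0$ (i.e. the logarithm $\mathrm{Ln}$ on its infinitely sheeted Riemann surface evaluated at the lift of the path). *)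

(* Defs.v *)
From mathcomp Require Export all_boot all_order all_algebra complex.
From mathcomp Require Export all_classical all_reals all_analysis.
Export numFieldNormedType.Exports.
Import Order.TTheory GRing.Theory Num.Theory.

Set Implicit Arguments.
Unset Strict Implicit.
Unset Printing Implicit Defensive.

Local Open Scope classical_set_scope.
Local Open Scope complex_scope.
Local Open Scope ring_scope.

Definition expmx (R : realType) (n : nat) (X : 'M[R]_n.+1) : 'M[R]_n.+1 :=
  lim (series (fun k => (k`!%:R)^-1 *: X ^+ k) @ \oo).

Definition mx22 (R : realType) (a b c d : R) : 'M[R]_2 :=
  \matrix_(i, j) nth 0 (nth [::] [:: [:: a; b]; [:: c; d]] i) j.

Definition expC (R : realType) (z : R[i]) : R[i] :=
  (expR (complex.Re z) * cos (complex.Im z))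
    +i* (expR (complex.Re z) * sin (complex.Im z)).

Definition Cintegral d (T : measurableType d) (R : realType)
    (mu : {measure set T -> \bar R}) (D : set T) (f : T -> R[i]) : R[i] :=
  (\int[mu]_(x in D) complex.Re (f x)) +i* (\int[mu]_(x in D) complex.Im (f x)).

(* Only the values of [M] on the open upper half-plane matter.  Analyticity is
   complex differentiability: over the scalar field [R[i]], the directional
   derivative in direction 1 is the limit of (M (z + h) - M z) / h for complex
   h tending to 0. *)
Definition herglotz (R : realType) (M : R[i] -> R[i]) : Prop :=
  forall z : R[i], 0 < complex.Im z ->
    derivable (M : R[i]^o -> R[i]^o) z 1 /\ 0 < complex.Im (M z).

Definition herglotz_kernel (R : realType) (z : R[i]) (x : R) : R[i] :=
  (x%:C - z)^-1 - (x / (1 + x ^+ 2))%:C.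

Definition moebius_den (R : realType) (A : 'M[R]_2) (w : R[i]) : R[i] :=
  (A 1 0)%:C * w + (A 1 1)%:C.

Definition moebius (R : realType) (A : 'M[R]_2) (z : R[i]) : R[i] :=
  ((A 0 0)%:C * z + (A 0 1)%:C) / moebius_den A z.

Definition Mflow (R : realType) (X : 'M[R]_2) (M0 : R[i] -> R[i]) (t : R)
    (z : R[i]) : R[i] :=
  moebius (expmx (t *: X)) (M0 z).

Definition Mint (R : realType) (X : 'M[R]_2) (M0 : R[i] -> R[i]) (t1 t2 : R)
    (z : R[i]) : R[i] :=
  Cintegral lebesgue_measure `[t1, t2] (fun t : R => Mflow X M0 t z).

Definition is_path_log (R : realType) (p L : R -> R[i]) : Prop :=
  [/\ continuous (L : R -> R[i]^o), L 0 = 0 & forall t, expC (L t) = p t].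

(* The continuous logarithm of the path [p]; it exists and is unique when [p]
   is continuous, never zero and equal to 1 at 0 (otherwise, the default value
   of [xget] is irrelevant). *)
Definition path_log (R : realType) (p : R -> R[i]) : R -> R[i] :=
  xget (fun=> 0) [set L | is_path_log p L].

(* [logden X w t] is L_t(w), the logarithm of c_t w + d_t. *)
Definition logden (R : realType) (X : 'M[R]_2) (w : R[i]) : R -> R[i] :=
  path_log (fun t => moebius_den (expmx (t *: X)) w).

Definition xi_approx (R : realType) (X : 'M[R]_2) (M0 : R[i] -> R[i])
    (t x e : R) : R :=
  pi^-1 * complex.Im (logden X (M0 (x +i* e)) t).

Definition xi (R : realType) (X : 'M[R]_2) (M0 : R[i] -> R[i]) (t x : R) : R :=
  lim (xi_approx X M0 t x e @[e --> 0^'+]).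

(* Main.v *)
(* The boundary values come from two facts.  First, if [e^(tX)] has lower row
   [(c_t, d_t)], then [Im (g_t w) = Im w / |c_t w + d_t|^2], and the argument of
   the path [c_t w + d_t] has [t]-derivative [gamma Im (g_t w)].  Hence
   [Im M_(t1,t2) = (Im L_t2 (M0) - Im L_t1 (M0)) / gamma], which is bounded
   uniformly on the half-plane because the argument moves by at most [pi] on
   short time intervals.

   Second, a holomorphic [f] on the half-plane with [0 <= Im f <= K] is given by
   the density [u / pi], where [u] is the almost everywhere vertical limit of
   [Im f].  Cauchy's theorem, applied to a bounded truncation of [f], represents
   [f (z + ie)] by its imaginary part on the line at height [e].  The square
   integrals of [H = e^(if) / (z + i)] along horizontal lines decrease with the
   height, which makes [H (. + ie)] a Cauchy family in L^2; along a sequence of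
   heights [Im f] therefore converges almost everywhere to some [u], dominated
   convergence gives the representation of [f], and Fatou's theorem upgrades the
   convergence to vertical limits. *)
From HB Require Import structures.
Require Import Defs.
From mathcomp Require Import ring lra measurable_realfun.
Import Order.TTheory GRing.Theory Num.Theory.
Local Open Scope classical_set_scope.
Local Open Scope complex_scope.
Local Open Scope ring_scope.

Set Implicit Arguments.
Unset Strict Implicit.
Unset Printing Implicit Defensive.

(** Only [Im f] is controlled: [Re f] may be unbounded, and a single Cauchy kernel [1 / (t - z)] is
    not integrable against a bounded function. The truncation deals with the former. For the latter,
    all formulas use the difference of two kernels, with poles at [z] and at the conjugate of a
    second point [w]; it decays like [t^-2]. The choice [w = z] yields the Poisson formula, and
    [w = i] yields the Herglotz kernel with [B = Re f(i)] and no linear term. The modulus of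
    [e^(if)] is [e^(-Im f)], which lies between [e^(-K)] and 1, so a logarithm recovers [Im f] from
    its boundary values; division by [z + i] makes it square integrable on lines. The bound on the
    argument must be uniform in [w], as [M0] may approach the boundary of the half-plane; the
    admissible time step therefore depends on the group alone. The representation controls only
    increments of [Im L_t] in time. The limit [xi_t] itself exists by comparison with time 0, where
    the logarithm vanishes. For [gamma < 0] the argument decreases in time, but its increment
    divided by [gamma], and with it the density, stays nonnegative. *)

Notation cabs := ComplexField.Normc.normc.

(** * Complex modulus and complex differentiability *)

Section modulus.
Context {R : realType}.
Implicit Types z w : R[i].

Lemma cabsE z : `|z| = (cabs z)%:C. Proof. by []. Qed.

Lemma cabs_ge0 z : 0 <= cabs z.
Proof. by case: z => a b /=; rewrite sqrtr_ge0. Qed.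

Lemma cabsM z w : cabs (z * w) = cabs z * cabs w.
Proof. exact: ComplexField.Normc.normcM. Qed.

Lemma cabsV z : cabs z^-1 = (cabs z)^-1.
Proof. exact: ComplexField.Normc.normcV. Qed.

Lemma cabsD z w : cabs (z + w) <= cabs z + cabs w.
Proof. exact: le_normcD. Qed.

Lemma cabsN z : cabs (- z) = cabs z.
Proof. exact: normcN. Qed.

Lemma cabs0 : cabs (0 : R[i]) = 0.
Proof. exact: ComplexField.Normc.normc0. Qed.

Lemma cabs1 : cabs (1 : R[i]) = 1.
Proof. exact: ComplexField.Normc.normc1. Qed.

Lemma cabs_eq0 z : (cabs z == 0) = (z == 0).
Proof.
apply/eqP/eqP => [|->]; last exact: cabs0.
exact: ComplexField.Normc.eq0_normc.
Qed.

Lemma cabs_gt0 z : (0 < cabs z) = (z != 0).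
Proof. by rewrite lt_def cabs_ge0 andbT cabs_eq0. Qed.

Lemma cabs_sqr z : cabs z ^+ 2 = complex.Re z ^+ 2 + complex.Im z ^+ 2.
Proof. by case: z => a b /=; rewrite sqr_sqrtr// addr_ge0// sqr_ge0. Qed.

Lemma cabs_conj z : cabs (conjc z) = cabs z.
Proof. by case: z => a b /=; rewrite sqrrN. Qed.

Lemma cabs_real (x : R) : cabs x%:C = `|x|.
Proof. by rewrite /= expr0n addr0 sqrtr_sqr. Qed.

Lemma cabs_i : cabs ('i : R[i]) = 1.
Proof. by rewrite /= expr0n add0r expr1n sqrtr1. Qed.

Lemma Re_le_cabs z : `|complex.Re z| <= cabs z.
Proof.
rewrite -(@ler_pXn2r _ 2) ?nnegrE ?cabs_ge0//.
by rewrite cabs_sqr real_normK ?num_real// lerDl sqr_ge0.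
Qed.

Lemma Im_le_cabs z : `|complex.Im z| <= cabs z.
Proof.
rewrite -(@ler_pXn2r _ 2) ?nnegrE ?cabs_ge0//.
by rewrite cabs_sqr real_normK ?num_real// lerDr sqr_ge0.
Qed.

Lemma cabs_le_ReIm z : cabs z <= `|complex.Re z| + `|complex.Im z|.
Proof.
rewrite -(@ler_pXn2r _ 2) ?nnegrE ?cabs_ge0 ?addr_ge0//.
rewrite cabs_sqr sqrrD !real_normK ?num_real// addrAC lerDl.
by rewrite mulrn_wge0// mulr_ge0.
Qed.

Lemma Re_add z w : complex.Re (z + w) = complex.Re z + complex.Re w.
Proof. by case: z w => a b [c d]. Qed.
Lemma Im_add z w : complex.Im (z + w) = complex.Im z + complex.Im w.
Proof. by case: z w => a b [c d]. Qed.
Lemma Re_opp z : complex.Re (- z) = - complex.Re z.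
Proof. by case: z. Qed.
Lemma Im_opp z : complex.Im (- z) = - complex.Im z.
Proof. by case: z. Qed.
Lemma Re_sub z w : complex.Re (z - w) = complex.Re z - complex.Re w.
Proof. by rewrite Re_add Re_opp. Qed.
Lemma Im_sub z w : complex.Im (z - w) = complex.Im z - complex.Im w.
Proof. by rewrite Im_add Im_opp. Qed.
Lemma Re_mul z w : complex.Re (z * w) =
  complex.Re z * complex.Re w - complex.Im z * complex.Im w.
Proof. by case: z w => a b [c d]. Qed.
Lemma Im_mul z w : complex.Im (z * w) =
  complex.Re z * complex.Im w + complex.Im z * complex.Re w.
Proof. by case: z w => a b [c d]. Qed.
Lemma Re_inv z : complex.Re z^-1 =
  complex.Re z / (complex.Re z ^+ 2 + complex.Im z ^+ 2).
Proof. by case: z. Qed.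
Lemma Im_inv z : complex.Im z^-1 =
  - complex.Im z / (complex.Re z ^+ 2 + complex.Im z ^+ 2).
Proof. by case: z => a b /=; rewrite mulNr. Qed.

Lemma complex_ext z w : complex.Re z = complex.Re w ->
  complex.Im z = complex.Im w -> z = w.
Proof. by case: z w => a b [c d] /= -> ->. Qed.

Lemma cabsD_ge z w : cabs z - cabs w <= cabs (z + w).
Proof.
rewrite lerBlDr; apply: le_trans (_ : _ <= cabs (z + w) + cabs (- w)) _.
  by rewrite -{1}(addrK w z) cabsD.
by rewrite cabsN.
Qed.

End modulus.

Section derivability.
Context {R : realType}.
Implicit Types (f g : R[i] -> R[i]) (z w : R[i]).

(* An inductive wrapper, so that [done] does not try to unfold [derivable]. *)
Variant cdiff f z : Prop := Cdiff of derivable (f : R[i]^o -> R[i]^o) z 1.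

Definition ccont f z := forall e : R, 0 < e -> exists2 d : R, 0 < d &
  forall w, cabs (w - z) < d -> cabs (f w - f z) < e.

(** Multiplying out the difference quotient admits [w = z] and makes all radii and errors real;
    later estimates use this form. *)
Lemma cdiffP f z : cdiff f z <-> exists l : R[i], forall e : R, 0 < e ->
  exists2 d : R, 0 < d & forall w, cabs (w - z) < d ->
    cabs (f w - f z - l * (w - z)) <= e * cabs (w - z).
Proof.
split=> [fz|[l fl]].
  have [/cvg_ex[l /cvgrPdist_le fl]] := fz.
  exists l => e e0; have e0C : 0 < e%:C by rewrite ltcR.
  have /nbhs_ballP[d /= d0 dP] := fl _ e0C.
  (* Radii and norms over [R[i]] are elements of [R[i]]; a positive one has zero imaginary part and
     so is a real number. *)
  have d0R : d = (complex.Re d)%:C.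
    by move: d0; case: d {dP} => a b; rewrite ltcE /= => /andP[/eqP -> _].
  exists (complex.Re d); first by move: d0; rewrite d0R ltcR.
  move=> w wz; have [->|wz0] := eqVneq w z.
    by rewrite !subrr mulr0 subrr cabs0 mulr0.
  have wz0' : w - z != 0 by rewrite subr_eq0.
  have /= := dP (w - z) _ wz0'.
  rewrite -ball_normE /= sub0r normrN cabsE d0R ltcR => /(_ wz).
  rewrite cabsE lecR [_ *: 1]mulr1 subrK => H.
  have -> : f w - f z - l * (w - z) =
            - ((l - (w - z)^-1 *: (f w - f z)) * (w - z)).
    rewrite mulrBl opprB; congr (_ - _).
    by rewrite [_ *: _]mulrC divfK.
  by rewrite cabsN cabsM ler_wpM2r// cabs_ge0.
split; apply/cvg_ex; exists l; apply/cvgrPdist_le => e e0.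
have e0R : e = (complex.Re e)%:C.
  by move: e0; case: e => a b; rewrite ltcE /= => /andP[/eqP -> _].
have e0' : 0 < complex.Re e by move: e0; rewrite e0R ltcR.
have [d d0 dP] := fl _ e0'.
apply/nbhs_ballP; exists d%:C => /=; first by rewrite ltcR.
move=> h; rewrite -ball_normE /= sub0r normrN cabsE ltcR => hd h0.
have := dP (h + z); rewrite addrK => /(_ hd).
rewrite e0R lecR [_ *: 1]mulr1 => H.
have hp : 0 < cabs h by rewrite cabs_gt0.
rewrite -(ler_pM2r hp) -cabsM -cabsN mulrBl opprB.
by rewrite [_ *: _]mulrC divfK.
Qed.

Lemma cdiff_ccont f z : cdiff f z -> ccont f z.
Proof.
move=> /cdiffP[l fl] e e0; have [d d0 dP] := fl _ ltr01.
have L0 : 0 < 1 + cabs l by rewrite ltr_pwDl// cabs_ge0.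
exists (Num.min d (e / (1 + cabs l))).
  by rewrite lt_min d0 divr_gt0.
move=> w; rewrite lt_min => /andP[wd we]; have {}dP := dP _ wd.
rewrite -(subrK (l * (w - z)) (f w - f z)).
apply: le_lt_trans (cabsD _ _) _; rewrite cabsM.
apply: le_lt_trans (lerD dP (lexx _)) _.
by rewrite -mulrDl mulrC -ltr_pdivlMr.
Qed.

Lemma cdiff_cst (k : R[i]) z : cdiff (fun=> k) z.
Proof. by split; exact: derivable_cst. Qed.

Lemma cdiff_id z : cdiff id z.
Proof. by split; exact: derivable_id. Qed.

Lemma cdiffD f g z : cdiff f z -> cdiff g z -> cdiff (fun w => f w + g w) z.
Proof. by move=> [fz] [gz]; split; exact: (@derivableD _ _ R[i]^o _ _ _ _ fz gz). Qed.

Lemma cdiffB f g z : cdiff f z -> cdiff g z -> cdiff (fun w => f w - g w) z.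
Proof. by move=> [fz] [gz]; split; exact: (@derivableB _ _ R[i]^o _ _ _ _ fz gz). Qed.

Lemma cdiffM f g z : cdiff f z -> cdiff g z -> cdiff (fun w => f w * g w) z.
Proof. by move=> [fz] [gz]; split; exact: (@derivableM _ R[i]^o _ _ _ _ fz gz). Qed.

Lemma cdiffV f z : f z != 0 -> cdiff f z -> cdiff (fun w => (f w)^-1) z.
Proof. by move=> f0 [fz]; split; exact: (@derivableV _ R[i]^o _ _ _ f0 fz). Qed.

Let ltr02 : 0 < (2 : R). Proof. exact: ltr0n. Qed.

Lemma cdiff_comp f g z : cdiff f z -> cdiff g (f z) -> cdiff (g \o f) z.
Proof.
move=> /[dup] /cdiff_ccont fc /cdiffP[l fl] /cdiffP[m gm].
apply/cdiffP; exists (m * l) => e e0.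
have l0 : 0 < 1 + cabs l by rewrite ltr_pwDl// cabs_ge0.
have m0 : 0 < 1 + cabs m by rewrite ltr_pwDl// cabs_ge0.
have [d1 d10 d1P] := gm (e / 2 / (1 + cabs l)) (divr_gt0 (divr_gt0 e0 ltr02) l0).
have [d2 d20 d2P] := fc _ d10.
have [d3 d30 d3P] := fl (e / 2 / (1 + cabs m)) (divr_gt0 (divr_gt0 e0 ltr02) m0).
have [d4 d40 d4P] := fl _ ltr01.
exists (Num.min d2 (Num.min d3 d4)); first by rewrite !lt_min d20 d30.
move=> w; rewrite !lt_min => /and3P[wd2 wd3 wd4] /=.
have -> : g (f w) - g (f z) - m * l * (w - z) =
    (g (f w) - g (f z) - m * (f w - f z)) + m * (f w - f z - l * (w - z)).
  by ring.
apply: le_trans (cabsD _ _) _; rewrite cabsM (splitr e) mulrDl lerD//.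
  apply: le_trans (d1P _ (d2P _ wd2)) _.
  have H : cabs (f w - f z) <= (1 + cabs l) * cabs (w - z).
    rewrite mulrDl mul1r -cabsM -[X in cabs X <= _](subrK (l * (w - z))).
    by apply: le_trans (cabsD _ _) _; rewrite lerD2r -[leRHS]mul1r d4P.
  have el : 0 <= e / 2 / (1 + cabs l) by rewrite !divr_ge0 ?ltW.
  apply: le_trans (ler_wpM2l el H) _.
  by rewrite mulrA divfK ?gt_eqF.
apply: le_trans (ler_wpM2l (cabs_ge0 _) (d3P _ wd3)) _.
rewrite mulrA ler_wpM2r ?cabs_ge0// mulrA ler_pdivrMr// mulrC.
by rewrite ler_wpM2l ?divr_ge0 ?ltW// ltrDr.
Qed.

(** Reflection in the real axis conjugates the derivative. It makes
    [H (z + im) * conjc (H (conjc z + im))] holomorphic although this is a squared modulus on the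
    real line. *)
Lemma cdiff_conj f z : cdiff f (conjc z) -> cdiff (fun w => conjc (f (conjc w))) z.
Proof.
move=> /cdiffP[l fl]; apply/cdiffP; exists (conjc l) => e e0.
have [d d0 dP] := fl _ e0; exists d => // w wz.
have -> : conjc (f (conjc w)) - conjc (f (conjc z)) - conjc l * (w - z) =
    conjc (f (conjc w) - f (conjc z) - l * (conjc w - conjc z)).
  by rewrite !rmorphB rmorphM rmorphB /= !conjcK.
by rewrite cabs_conj -[cabs (w - z)]cabs_conj rmorphB dP// -rmorphB cabs_conj.
Qed.

End derivability.

(** * Complex-valued integrals *)

Section rintegral_extra.
Context d (T : measurableType d) (R : realType).
Variable mu : {measure set T -> \bar R}.
Implicit Types (D : set T) (f g : T -> R).

Lemma integrable_dominated D f g : measurable D -> measurable_fun D f ->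
  mu.-integrable D (EFin \o g) -> (forall x, D x -> `|f x| <= g x) ->
  mu.-integrable D (EFin \o f).
Proof.
move=> mD mf ig fg; apply: le_integrable ig => //.
  exact/measurable_EFinP.
by move=> x Dx /=; rewrite lee_fin (le_trans (fg _ Dx))// ler_norm.
Qed.

Lemma Rintegral_dominated_cvg D (f_ : nat -> T -> R) f g : measurable D ->
  (forall n, measurable_fun D (f_ n)) -> measurable_fun D f ->
  {ae mu, forall x, D x -> f_ n x @[n --> \oo] --> f x} ->
  mu.-integrable D (EFin \o g) -> (forall n x, D x -> `|f_ n x| <= g x) ->
  mu.-integrable D (EFin \o f) /\
  \int[mu]_(x in D) f_ n x @[n --> \oo] --> \int[mu]_(x in D) f x.
Proof.
move=> mD mf_ mf f_f ig fg.
have [] := @dominated_convergence _ _ _ mu D mD (fun n => EFin \o f_ n)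
  (EFin \o f) (EFin \o g).
- by move=> n; exact/measurable_EFinP.
- exact/measurable_EFinP.
- apply: filterS f_f => x + Dx => /(_ Dx) H.
  exact: cvg_comp H _.
- by [].
- by apply: aeW => x n Dx /=; rewrite lee_fin fg.
move=> intf _ H; split => //.
apply: (@fine_cvg _ _ _ _ (fun n => \int[mu]_(x in D) (EFin \o f_ n) x)%E).
by rewrite fineK//; exact: integrable_fin_num.
Qed.

End rintegral_extra.

Section cintegral.
Context d (T : measurableType d) (R : realType).
Variable mu : {measure set T -> \bar R}.
Implicit Types (D : set T) (f g : T -> R[i]).

Definition cmeasurable D f := measurable_fun D (@complex.Re R \o f) /\
  measurable_fun D (@complex.Im R \o f).

Definition cintegrable D f := mu.-integrable D (EFin \o (@complex.Re R \o f)) /\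
  mu.-integrable D (EFin \o (@complex.Im R \o f)).

(** Stated by components to match the componentwise definition of [Cintegral]; [ctendsP] gives the
    form with the modulus. *)
Definition ctends (u : nat -> R[i]) (l : R[i]) :=
  complex.Re (u n) @[n --> \oo] --> complex.Re l /\
  complex.Im (u n) @[n --> \oo] --> complex.Im l.

Lemma cintegrable_dominated D f (g : T -> R) : measurable D -> cmeasurable D f ->
  mu.-integrable D (EFin \o g) -> (forall x, D x -> cabs (f x) <= g x) ->
  cintegrable D f.
Proof.
move=> mD [mf1 mf2] ig fg; split.
  apply: (integrable_dominated mD mf1 ig) => x Dx /=.
  exact: le_trans (Re_le_cabs _) (fg _ Dx).
apply: (integrable_dominated mD mf2 ig) => x Dx /=.
exact: le_trans (Im_le_cabs _) (fg _ Dx).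
Qed.

Lemma eq_Cintegral D f g : (forall x, D x -> f x = g x) ->
  Cintegral mu D f = Cintegral mu D g.
Proof.
move=> fg; rewrite /Cintegral; congr (_ +i* _);
  by apply: eq_Rintegral => x /set_mem Dx; rewrite fg.
Qed.

Lemma CintegralD D f g : measurable D -> cintegrable D f -> cintegrable D g ->
  Cintegral mu D (fun x => f x + g x) = Cintegral mu D f + Cintegral mu D g.
Proof.
move=> mD [f1 f2] [g1 g2]; apply: complex_ext.
  rewrite Re_add /= -RintegralD//.
  by apply: eq_Rintegral => x _; rewrite Re_add.
rewrite Im_add /= -RintegralD//.
by apply: eq_Rintegral => x _; rewrite Im_add.
Qed.

Lemma CintegralZ D f (k : R[i]) : measurable D -> cintegrable D f ->
  Cintegral mu D (fun x => k * f x) = k * Cintegral mu D f.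
Proof.
move=> mD [f1 f2].
have Z (r : R) (g : T -> R) : mu.-integrable D (EFin \o g) ->
    mu.-integrable D (EFin \o (fun x => r * g x)).
  by move=> ig; exact: (integrableZl mD r ig).
apply: complex_ext.
  rewrite Re_mul /= -!RintegralZl// -RintegralB//; [|exact: Z..].
  by apply: eq_Rintegral => x _; rewrite Re_mul.
rewrite Im_mul /= -!RintegralZl// -RintegralD//; [|exact: Z..].
by apply: eq_Rintegral => x _; rewrite Im_mul.
Qed.

Lemma cintegrableZ D f (k : R[i]) : measurable D -> cintegrable D f ->
  cintegrable D (fun x => k * f x).
Proof.
move=> mD [f1 f2].
have Z (r : R) (g : T -> R) : mu.-integrable D (EFin \o g) ->
    mu.-integrable D (EFin \o (fun x => r * g x)).
  by move=> ig; exact: (integrableZl mD r ig).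
split.
  apply: eq_integrable (integrableB mD (Z (complex.Re k) _ f1)
    (Z (complex.Im k) _ f2)) => // x _ /=; by rewrite Re_mul.
apply: eq_integrable (integrableD mD (Z (complex.Re k) _ f2)
    (Z (complex.Im k) _ f1)) => // x _ /=; by rewrite Im_mul.
Qed.

Lemma cintegrableD D f g : measurable D -> cintegrable D f ->
  cintegrable D g -> cintegrable D (fun x => f x + g x).
Proof.
move=> mD [f1 f2] [g1 g2]; split.
  by apply: eq_integrable (integrableD mD f1 g1) => // x _ /=; rewrite Re_add.
by apply: eq_integrable (integrableD mD f2 g2) => // x _ /=; rewrite Im_add.
Qed.

Lemma cintegrableB D f g : measurable D -> cintegrable D f ->
  cintegrable D g -> cintegrable D (fun x => f x - g x).
Proof.
move=> mD [f1 f2] [g1 g2]; split.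
  by apply: eq_integrable (integrableB mD f1 g1) => // x _ /=; rewrite Re_sub.
by apply: eq_integrable (integrableB mD f2 g2) => // x _ /=; rewrite Im_sub.
Qed.

Lemma CintegralB D f g : measurable D -> cintegrable D f -> cintegrable D g ->
  Cintegral mu D (fun x => f x - g x) = Cintegral mu D f - Cintegral mu D g.
Proof.
move=> mD [f1 f2] [g1 g2]; apply: complex_ext.
  rewrite Re_sub /= -RintegralB//.
  by apply: eq_Rintegral => x _; rewrite Re_sub.
rewrite Im_sub /= -RintegralB//.
by apply: eq_Rintegral => x _; rewrite Im_sub.
Qed.

(** Real and imaginary parts are bounded separately, whence the factor 2. It is harmless, since the
    bound only enters estimates of quantities that tend to zero. *)
Lemma cabs_Cintegral_le D f (g : T -> R) : measurable D -> cintegrable D f ->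
  mu.-integrable D (EFin \o g) -> (forall x, D x -> cabs (f x) <= g x) ->
  cabs (Cintegral mu D f) <= 2 * \int[mu]_(x in D) g x.
Proof.
move=> mD [f1 f2] ig fg; apply: le_trans (cabs_le_ReIm _) _.
rewrite mulr2n mulrDl !mul1r /=; apply: lerD.
  apply: le_trans (le_normr_Rintegral mD f1) _.
  apply: le_Rintegral => //; first exact: integrable_norm f1.
  by move=> x Dx; apply: le_trans (Re_le_cabs _) (fg _ Dx).
apply: le_trans (le_normr_Rintegral mD f2) _.
apply: le_Rintegral => //; first exact: integrable_norm f2.
by move=> x Dx; apply: le_trans (Im_le_cabs _) (fg _ Dx).
Qed.

Lemma Cintegral_dominated_cvg D (f_ : nat -> T -> R[i]) f (g : T -> R) :
  measurable D -> (forall n, cmeasurable D (f_ n)) -> cmeasurable D f ->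
  {ae mu, forall x, D x -> ctends (f_ ^~ x) (f x)} ->
  mu.-integrable D (EFin \o g) -> (forall n x, D x -> cabs (f_ n x) <= g x) ->
  cintegrable D f /\
  ctends (fun n => Cintegral mu D (f_ n)) (Cintegral mu D f).
Proof.
move=> mD mf_ [mf1 mf2] f_f ig fg.
have [] := @Rintegral_dominated_cvg _ _ _ mu D
  (fun n => @complex.Re R \o f_ n) (@complex.Re R \o f) g mD.
- by move=> n; have [] := mf_ n.
- exact: mf1.
- by apply: filterS f_f => x + Dx => /(_ Dx)[].
- exact: ig.
- by move=> n x Dx; exact: le_trans (Re_le_cabs _) (fg _ _ Dx).
move=> i1 c1.
have [] := @Rintegral_dominated_cvg _ _ _ mu D
  (fun n => @complex.Im R \o f_ n) (@complex.Im R \o f) g mD.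
- by move=> n; have [] := mf_ n.
- exact: mf2.
- by apply: filterS f_f => x + Dx => /(_ Dx)[].
- exact: ig.
- by move=> n x Dx; exact: le_trans (Im_le_cabs _) (fg _ _ Dx).
by move=> i2 c2.
Qed.

Lemma ctends_unique u (l l' : R[i]) : ctends u l -> ctends u l' -> l = l'.
Proof.
move=> [a b] [a' b']; apply: complex_ext.
  by apply: cvg_unique a a'.
by apply: cvg_unique b b'.
Qed.

Lemma ctends_cst (k : R[i]) : ctends (fun=> k) k.
Proof. by split; exact: cvg_cst. Qed.

Lemma cmeasurableM D f g : cmeasurable D f -> cmeasurable D g ->
  cmeasurable D (fun x => f x * g x).
Proof.
move=> [f1 f2] [g1 g2]; split.
  apply: eq_measurable_fun (measurable_funB (measurable_funM f1 g1)
    (measurable_funM f2 g2)) => x _ /=; by rewrite Re_mul.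
apply: eq_measurable_fun (measurable_funD (measurable_funM f1 g2)
    (measurable_funM f2 g1)) => x _ /=; by rewrite Im_mul.
Qed.

Lemma ctendsP u (l : R[i]) : ctends u l <-> forall e : R, 0 < e ->
  \forall n \near \oo, cabs (u n - l) < e.
Proof.
split=> [[/cvgrPdist_lt a /cvgrPdist_lt b] e e0|H].
  have e2 : 0 < e / 2 by rewrite divr_gt0.
  have := a _ e2; have := b _ e2; apply: filterS2 => n bn an.
  apply: le_lt_trans (cabs_le_ReIm _) _.
  by rewrite Re_sub Im_sub (splitr e) ltrD// distrC.
split; apply/cvgrPdist_lt => e e0; have := H _ e0; apply: filterS => n.
  by apply: le_lt_trans; rewrite distrC -Re_sub Re_le_cabs.
by apply: le_lt_trans; rewrite distrC -Im_sub Im_le_cabs.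
Qed.

End cintegral.

Section lines.
Context {R : realType}.
Implicit Types (f : R[i] -> R[i]).

Lemma ccont_ctends f u (z : R[i]) : ccont f z -> ctends u z ->
  ctends (f \o u) (f z).
Proof.
move=> fz /ctendsP uz; apply/ctendsP => e e0.
have [d d0 dP] := fz _ e0; have := uz _ d0; apply: filterS => n.
exact: dP.
Qed.

Lemma ccont_lipschitz_path f (p : R -> R[i]) t :
  (forall s, cabs (p s - p t) <= `|s - t|) -> ccont f (p t) ->
  {for t, continuous (fun s => complex.Re (f (p s)))} /\
  {for t, continuous (fun s => complex.Im (f (p s)))}.
Proof.
move=> pL fp; split; apply/cvgrPdist_lt => e e0;
  have [d d0 dP] := fp _ e0; near=> s;
  (have /dP : cabs (p s - p t) < d by
    apply: le_lt_trans (pL _) _; rewrite distrC; near: s;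
    exact: cvgr_dist_lt (cvg_id) d d0);
  apply: le_lt_trans; rewrite distrC -?Re_sub -?Im_sub ?Re_le_cabs ?Im_le_cabs//.
Unshelve. all: by end_near. Qed.

Lemma horizontal_lipschitz (y s t : R) : cabs ((s +i* y) - (t +i* y)) <= `|s - t|.
Proof. by rewrite /= subrr expr0n addr0 sqrtr_sqr. Qed.

Lemma vertical_lipschitz (x s t : R) : cabs ((x +i* s) - (x +i* t)) <= `|s - t|.
Proof. by rewrite /= subrr expr0n add0r sqrtr_sqr. Qed.

Lemma continuous_cmeasurable (f : R -> R[i]) :
  (forall t, {for t, continuous (fun s => complex.Re (f s))} /\
             {for t, continuous (fun s => complex.Im (f s))}) ->
  @cmeasurable _ (measurableTypeR R) _ setT f.
Proof.
move=> fc; split; apply: continuous_measurable_fun => t;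
 by have [] := fc t.
Qed.

Lemma continuous_cintegrable (f : R -> R[i]) (a b : R) :
  (forall t, a <= t <= b -> {for t, continuous (fun s => complex.Re (f s))} /\
             {for t, continuous (fun s => complex.Im (f s))}) ->
  cintegrable (@lebesgue_measure R) `[a, b] f.
Proof.
move=> fc; split; apply: continuous_compact_integrable;
  try exact: segment_compact.
  apply: continuous_in_subspaceT => t /set_mem /=; rewrite in_itv /= => tab.
  exact: (fc _ tab).1.
apply: continuous_in_subspaceT => t /set_mem /=; rewrite in_itv /= => tab.
exact: (fc _ tab).2.
Qed.

End lines.

(** * Goursat's theorem for rectangles *)

Section bisection.
Context {R : realType}.

(** Left ends increase and right ends decrease, so every left end lies below every right end; the
    point is the supremum of the left ends. *)
Lemma nested_halving (u : nat -> R) (L : R) :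
  (forall n, u n <= u n.+1 /\ u n.+1 + L / 2 ^+ n.+1 <= u n + L / 2 ^+ n) ->
  0 <= L -> exists x, forall n, u n <= x <= u n + L / 2 ^+ n.
Proof.
move=> uS L0.
have L2 n : 0 <= L / 2 ^+ n by rewrite divr_ge0// exprn_ge0.
have mono m n : (m <= n)%N -> u m <= u n.
  by move=> /subnK <-; elim: (n - m)%N => // k /le_trans; apply; exact: (uS _).1.
have anti m n : (m <= n)%N -> u n + L / 2 ^+ n <= u m + L / 2 ^+ m.
  move=> /subnK <-; elim: (n - m)%N => // k; apply: le_trans; exact: (uS _).2.
have ub n m : u m <= u n + L / 2 ^+ n.
  have [mn|/ltnW nm] := leqP m n.
    by apply: le_trans (mono _ _ mn) _; rewrite lerDl.
  by apply: le_trans (anti _ _ nm); rewrite lerDl.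
have hs : has_sup (range u).
  split; first by exists (u 0%N), 0%N.
  by exists (u 0%N + L / 2 ^+ 0) => _ [m _ <-].
exists (sup (range u)) => n; apply/andP; split.
  by apply: ub_le_sup; [exact: hs.2 | exists n].
by apply: ge_sup; [exact: hs.1 | move=> _ [m _ <-]].
Qed.

Variables (a b l h : R) (P : R -> R -> nat -> Prop).

Definition subrect n (x y : R) := [/\ a <= x, x + l / 2 ^+ n <= a + l,
  b <= y & y + h / 2 ^+ n <= b + h].

(* [P x y n] is a property of the sub-rectangle with lower left corner [x, y]
   and sides [l / 2 ^ n] and [h / 2 ^ n]; if it passes from the four quarters to
   the whole and holds for all small rectangles around each point, it holds for
   the initial rectangle. *)
Lemma rectangle_bisection : 0 <= l -> 0 <= h ->
  (forall x y n, subrect n x y ->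
     P x y n.+1 -> P (x + l / 2 ^+ n.+1) y n.+1 ->
     P x (y + h / 2 ^+ n.+1) n.+1 ->
     P (x + l / 2 ^+ n.+1) (y + h / 2 ^+ n.+1) n.+1 -> P x y n) ->
  (forall p q, a <= p <= a + l -> b <= q <= b + h ->
     exists2 d : R, 0 < d & forall x y n, subrect n x y ->
       x <= p <= x + l / 2 ^+ n -> y <= q <= y + h / 2 ^+ n ->
       (l + h) / 2 ^+ n < d -> P x y n) ->
  P a b 0%N.
Proof.
move=> l0 h0 Padd Ploc; apply: contrapT => nP.
(* The first quarter on which [P] fails; the fourth is taken untested, since [Padd] excludes that
   [P] holds on all four. *)
pose step n (c : R * R) : R * R :=
  let x' := c.1 + l / 2 ^+ n.+1 in let y' := c.2 + h / 2 ^+ n.+1 in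
  if ~~ `[< P c.1 c.2 n.+1 >] then c
  else if ~~ `[< P x' c.2 n.+1 >] then (x', c.2)
  else if ~~ `[< P c.1 y' n.+1 >] then (c.1, y') else (x', y').
pose fix s n := if n is m.+1 then step m (s m) else (a, b).
have half (k : R) n : k / 2 ^+ n = k / 2 ^+ n.+1 + k / 2 ^+ n.+1.
  by rewrite exprS; field; rewrite expf_neq0.
have ge0 (k : R) n : 0 <= k -> 0 <= k / 2 ^+ n.
  by move=> k0; rewrite divr_ge0// exprn_ge0.
have stepP n c : [/\ c.1 <= (step n c).1,
    (step n c).1 + l / 2 ^+ n.+1 <= c.1 + l / 2 ^+ n,
    c.2 <= (step n c).2 &
    (step n c).2 + h / 2 ^+ n.+1 <= c.2 + h / 2 ^+ n].
  have := ge0 _ n.+1 l0; have := ge0 _ n.+1 h0.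
  rewrite /step !(half _ n) => H1 H2.
  by do ! case: ifP => _; split => /=; rewrite ?addrA ?lexx ?lerDl// lerD2r lerDl.
have sR n : subrect n (s n).1 (s n).2.
  elim: n => [|n [H1 H2 H3 H4]] /=; first by split; rewrite /= ?expr0 ?divr1.
  have [K1 K2 K3 K4] := stepP n (s n).
  by split; [exact: le_trans K1|exact: le_trans H2|exact: le_trans K3|exact: le_trans H4].
have sN n : ~ P (s n).1 (s n).2 n.
  elim: n => [//|n IH] /=; rewrite /step.
  case: ifPn => [/asboolPn //|/negbNE/asboolP p1].
  case: ifPn => [/asboolPn //|/negbNE/asboolP p2].
  case: ifPn => [/asboolPn //|/negbNE/asboolP p3] p4.
  by apply: IH; apply: Padd => //; exact: sR.
have [p pP] := @nested_halving (fun n => (s n).1) l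
  (fun n => conj (let: And4 x _ _ _ := stepP n (s n) in x)
                 (let: And4 _ x _ _ := stepP n (s n) in x)) l0.
have [q qP] := @nested_halving (fun n => (s n).2) h
  (fun n => conj (let: And4 _ _ x _ := stepP n (s n) in x)
                 (let: And4 _ _ _ x := stepP n (s n) in x)) h0.
have [||d d0 dP] := Ploc p q.
- by have := pP 0%N; rewrite expr0 divr1.
- by have := qP 0%N; rewrite expr0 divr1.
have [n nd] : exists n, (l + h) / 2 ^+ n < d.
  have : (l + h) * 2^-1 ^+ n @[n --> \oo] --> (l + h) * 0.
    by apply: cvgMr; apply: cvg_expr; rewrite ger0_norm ?invr_ge0// invf_lt1 ?ltr1n.
  rewrite mulr0 => /cvgrPdist_lt /(_ _ d0)[N _ /(_ N (leqnn _))] /=.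
  rewrite sub0r normrN => H; exists N; rewrite -exprVn.
  by apply: le_lt_trans H; exact: ler_norm.
by apply: (sN n); apply: dP.
Qed.

End bisection.

Section goursat.
Context {R : realType}.
Notation leb := (@lebesgue_measure R).
Implicit Types G : R[i] -> R[i].

Lemma Rintegral_itv_cat (f : R -> R) (a c b : R) : a <= c -> c <= b ->
  leb.-integrable `[a, b] (EFin \o f) ->
  (\int[leb]_(t in `[a, b]) f t = \int[leb]_(t in `[a, c]) f t +
    \int[leb]_(t in `[c, b]) f t).
Proof.
move=> ac cb fi.
rewrite -(@Rintegral_itv_obnd_cbnd _ c); last first.
  by apply: integrableS fi => //; apply: subset_itvr; rewrite bnd_simp.
by rewrite -(@Rintegral_itvB _ f (BLeft a))// addrC subrK.
Qed.

Lemma Cintegral_itv_cat (f : R -> R[i]) (a c b : R) : a <= c -> c <= b ->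
  cintegrable leb `[a, b] f ->
  Cintegral leb `[a, b] f = Cintegral leb `[a, c] f + Cintegral leb `[c, b] f.
Proof.
move=> ac cb [f1 f2]; apply: complex_ext.
  by rewrite Re_add /=; exact: Rintegral_itv_cat.
by rewrite Im_add /=; exact: Rintegral_itv_cat.
Qed.

Lemma lebesgue_itvcc (a l : R) : 0 <= l -> fine (leb `[a, a + l]) = l.
Proof.
rewrite lebesgue_measure_itv /= lte_fin ltrDl le_eqVlt.
move=> /predU1P[<-|l0]; first by rewrite ltxx.
by rewrite l0 /= addrAC subrr add0r.
Qed.

Lemma Cintegral_cst (a l : R) (k : R[i]) : 0 <= l ->
  Cintegral leb `[a, a + l] (fun=> k) = l%:C * k.
Proof.
move=> l0; rewrite /Cintegral !Rintegral_cst// lebesgue_itvcc//.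
by apply: complex_ext; rewrite ?Re_mul ?Im_mul /= mul0r ?subr0 ?addr0 mulrC.
Qed.

Lemma cintegrable_cst (a l : R) (k : R[i]) : cintegrable leb `[a, a + l] (fun=> k).
Proof. by apply: continuous_cintegrable => t _; split; exact: cvg_cst. Qed.

(** The counterclockwise contour integral, with opposite sides paired so that affine functions
    contribute constants. *)
Definition rectint G (a b l h : R) : R[i] :=
  Cintegral leb `[a, a + l] (fun t => G (t +i* b) - G (t +i* (b + h))) +
  'i * Cintegral leb `[b, b + h] (fun s => G ((a + l) +i* s) - G (a +i* s)).

Definition rect (a b l h : R) : set R[i] :=
  [set z | a <= complex.Re z <= a + l /\ b <= complex.Im z <= b + h].

Lemma cintegrable_horizontal G (a b y : R) :
  (forall t, a <= t <= b -> ccont G (t +i* y)) ->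
  cintegrable leb `[a, b] (fun t => G (t +i* y)).
Proof.
move=> Gc; apply: continuous_cintegrable => t tab.
apply: (@ccont_lipschitz_path _ G (fun t => t +i* y)); last exact: Gc.
by move=> s; exact: horizontal_lipschitz.
Qed.

Lemma cintegrable_vertical G (a b x : R) :
  (forall t, a <= t <= b -> ccont G (x +i* t)) ->
  cintegrable leb `[a, b] (fun t => G (x +i* t)).
Proof.
move=> Gc; apply: continuous_cintegrable => t tab.
apply: (@ccont_lipschitz_path _ G (fun t => x +i* t)); last exact: Gc.
by move=> s; exact: vertical_lipschitz.
Qed.

Lemma rectint_split_horizontal G a b l1 l2 h : 0 <= l1 -> 0 <= l2 -> 0 <= h ->
  (forall z, rect a b (l1 + l2) h z -> ccont G z) ->
  rectint G a b (l1 + l2) h = rectint G a b l1 h + rectint G (a + l1) b l2 h.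
Proof.
move=> l10 l20 h0 Gc; rewrite /rectint.
have mI (x y : R) : measurable (`[x, y]%classic : set (measurableTypeR R)) by [].
have iv x : a <= x <= a + (l1 + l2) ->
    cintegrable leb `[b, b + h] (fun t => G (x +i* t)).
  by move=> ax; apply: cintegrable_vertical => t tb; exact: Gc.
have ih x1 x2 y : a <= x1 -> x2 <= a + (l1 + l2) -> b <= y <= b + h ->
    cintegrable leb `[x1, x2] (fun t => G (t +i* y)).
  move=> ax1 ax2 yb; apply: cintegrable_horizontal => t /andP[tx1 tx2].
  by apply: Gc; split => //=; rewrite (le_trans ax1)// (le_trans tx2).
rewrite (@Cintegral_itv_cat _ a (a + l1)) ?lerD2l ?lerDl//; last first.
  by apply: cintegrableB => //; apply: ih; lra.
rewrite addrA !CintegralB//; try (by apply: iv; lra); try (by apply: ih; lra).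
by ring.
Qed.

Lemma rectint_split_vertical G a b l h1 h2 : 0 <= l -> 0 <= h1 -> 0 <= h2 ->
  (forall z, rect a b l (h1 + h2) z -> ccont G z) ->
  rectint G a b l (h1 + h2) = rectint G a b l h1 + rectint G a (b + h1) l h2.
Proof.
move=> l0 h10 h20 Gc; rewrite /rectint.
have mI (x y : R) : measurable (`[x, y]%classic : set (measurableTypeR R)) by [].
have iv y1 y2 x : b <= y1 -> y2 <= b + (h1 + h2) -> a <= x <= a + l ->
    cintegrable leb `[y1, y2] (fun t => G (x +i* t)).
  move=> by1 by2 xa; apply: cintegrable_vertical => t /andP[ty1 ty2].
  by apply: Gc; split => //=; rewrite (le_trans by1)// (le_trans ty2).
have ih y : b <= y <= b + (h1 + h2) ->
    cintegrable leb `[a, a + l] (fun t => G (t +i* y)).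
  by move=> ax; apply: cintegrable_horizontal => t tb; exact: Gc.
rewrite [X in 'i * X](@Cintegral_itv_cat _ b (b + h1)) ?lerD2l ?lerDl//; last first.
  by apply: cintegrableB => //; apply: iv; lra.
rewrite addrA !CintegralB//; try (by apply: ih; lra); try (by apply: iv; lra).
by ring.
Qed.

Lemma rectint_small G a b l h (z L : R[i]) (e : R) : 0 <= l -> 0 <= h -> 0 <= e ->
  (forall w, rect a b l h w -> ccont G w) ->
  (forall w, rect a b l h w -> cabs (G w - G z - L * (w - z)) <= e) ->
  cabs (rectint G a b l h) <= 4 * e * (l + h).
Proof.
move=> l0 h0 e0 Gc GL.
have mI (x y : R) : measurable (`[x, y]%classic : set (measurableTypeR R)) by [].
have iv x : a <= x <= a + l ->
    cintegrable leb `[b, b + h] (fun t => G (x +i* t)).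
  by move=> ax; apply: cintegrable_vertical => t tb; exact: Gc.
have ih y : b <= y <= b + h ->
    cintegrable leb `[a, a + l] (fun t => G (t +i* y)).
  by move=> ax; apply: cintegrable_horizontal => t tb; exact: Gc.
(* Corrections for the affine part of [G] on opposite sides. Their total contribution
   [l k1 + i h k2] vanishes, and after adding them each integrand is bounded by [2 e]. *)
pose k1 := L * 'i * h%:C; pose k2 := - L * l%:C.
have -> : rectint G a b l h =
   Cintegral leb `[a, a + l] (fun t => G (t +i* b) - G (t +i* (b + h)) + k1) +
  'i * Cintegral leb `[b, b + h] (fun s => G ((a + l) +i* s) - G (a +i* s) + k2).
  rewrite CintegralD//; last first.
  - exact: cintegrable_cst.
  - by apply: cintegrableB => //; apply: ih; lra.
  rewrite [X in 'i * X]CintegralD//; last first.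
  - exact: cintegrable_cst.
  - by apply: cintegrableB => //; apply: iv; lra.
  rewrite !Cintegral_cst// mulrDr addrACA /rectint -[LHS]addr0; congr (_ + _).
  by rewrite /k1 /k2; ring.
have bnd w1 w2 k : rect a b l h w1 -> rect a b l h w2 -> k = - (L * (w1 - w2)) ->
    cabs (G w1 - G w2 + k) <= 2 * e.
  move=> r1 r2 ->.
  have -> : G w1 - G w2 - L * (w1 - w2) =
    (G w1 - G z - L * (w1 - z)) - (G w2 - G z - L * (w2 - z)) by ring.
  apply: le_trans (cabsD _ _) _; rewrite cabsN mulr2n mulrDl !mul1r.
  by apply: lerD; exact: GL.
have ic (x m : R) : leb.-integrable `[x, x + m] (EFin \o (fun=> 2 * e : R)).
  by apply: continuous_compact_integrable; [exact: segment_compact|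
    apply: continuous_subspaceT => ?; exact: cvg_cst].
apply: le_trans (cabsD _ _) _; rewrite cabsM cabs_i mul1r.
apply: le_trans (lerD
  (@cabs_Cintegral_le _ _ _ leb _ _ (fun=> 2 * e) (mI _ _) _ (ic _ _) _)
  (@cabs_Cintegral_le _ _ _ leb _ _ (fun=> 2 * e) (mI _ _) _ (ic _ _) _)) _.
- apply: cintegrableD => //; last exact: cintegrable_cst.
  by apply: cintegrableB => //; apply: ih; lra.
- move=> t /=; rewrite in_itv /= => tab; apply: bnd.
  + by split => //=; lra.
  + by split => //=; lra.
  + rewrite /k1; apply: complex_ext; rewrite !(Re_mul, Im_mul, Re_opp, Im_opp) /=; ring.
- apply: cintegrableD => //; last exact: cintegrable_cst.
  by apply: cintegrableB => //; apply: iv; lra.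
- move=> t /=; rewrite in_itv /= => tab; apply: bnd.
  + by split => //=; lra.
  + by split => //=; lra.
  + rewrite /k2; apply: complex_ext; rewrite !(Re_mul, Im_mul, Re_opp, Im_opp) /=; ring.
rewrite !Rintegral_cst// !lebesgue_itvcc//.
rewrite le_eqVlt; apply/orP; left; apply/eqP; ring.
Qed.

Lemma goursat G a b l h : 0 <= l -> 0 <= h ->
  (forall z, rect a b l h z -> cdiff G z) -> rectint G a b l h = 0.
Proof.
move=> l0 h0 Gd.
have Gc z : rect a b l h z -> ccont G z by move=> /Gd; exact: cdiff_ccont.
suff H e : 0 < e -> cabs (rectint G a b l h) <= e.
  apply/eqP; rewrite -cabs_eq0 eq_le cabs_ge0 andbT.
  by apply/ler_addgt0Pr => e e0; rewrite add0r H.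
move=> e0.
(* The tolerance is proportional to the area, so four quarters within their tolerance make the whole
   rectangle within its own. *)
pose P x y n := cabs (rectint G x y (l / 2 ^+ n) (h / 2 ^+ n)) <= e / 4 ^+ n.
suff : P a b 0%N by rewrite /P !expr0 !divr1.
have half (k : R) n : k / 2 ^+ n = k / 2 ^+ n.+1 + k / 2 ^+ n.+1.
  by rewrite exprS; field; rewrite expf_neq0.
have ge0 (k : R) n : 0 <= k -> 0 <= k / 2 ^+ n.
  by move=> k0; rewrite divr_ge0// exprn_ge0.
apply: (@rectangle_bisection _ a b l h P) => //.
  move=> x y n [H1 H2 H3 H4] P1 P2 P3 P4; rewrite /P (half l) (half h).
  have Gc' z : rect x y (l / 2 ^+ n) (h / 2 ^+ n) z -> ccont G z.
    by move=> [K1 K2]; apply: Gc; split; lra.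
  move: H2 H4 Gc' (ge0 _ n.+1 l0) (ge0 _ n.+1 h0).
  rewrite (half l) (half h).
  have -> : e / 4 ^+ n = e / 4 ^+ n.+1 + e / 4 ^+ n.+1 + (e / 4 ^+ n.+1 + e / 4 ^+ n.+1).
    by rewrite exprS; field; rewrite expf_neq0.
  move: P1 P2 P3 P4; rewrite /P.
  set l' := l / _; set h' := h / _; set e' := e / _.
  move=> P1 P2 P3 P4 H2 H4 Gc' l'0 h'0.
  rewrite rectint_split_horizontal ?addr_ge0// !rectint_split_vertical//.
  - apply: le_trans (cabsD _ _) _.
    apply: le_trans (lerD (cabsD _ _) (cabsD _ _)) _.
    exact: (lerD (lerD P1 P3) (lerD P2 P4)).
  - by move=> z [K1 K2]; apply: Gc'; split => //; clear -K1 l'0; lra.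
  - by move=> z [K1 K2]; apply: Gc'; split => //; clear -K1 l'0; lra.
move=> p q pab qab.
have rpq : rect a b l h (p +i* q) by split.
have /cdiffP[L HL] := Gd _ rpq.
(* The linear approximation with error [e'] gives the bound [4 e' ((l + h) / 2 ^ n) ^ 2], at most
   [e / 4 ^ n]; the summand 1 covers degenerate rectangles. *)
pose e' := e / (4 * (1 + (l + h)) ^+ 2).
have lh1 : 0 < 1 + (l + h) by rewrite ltr_pwDl ?addr_ge0.
have e'0 : 0 < e' by rewrite divr_gt0// mulr_gt0// exprn_gt0.
have [d d0 dP] := HL _ e'0.
exists d => // x y n [H1 H2 H3 H4] xp yq lhd.
have lhn : 0 <= (l + h) / 2 ^+ n by apply: ge0; exact: addr_ge0.
have wz w : rect x y (l / 2 ^+ n) (h / 2 ^+ n) w -> cabs (w - (p +i* q)) <= (l + h) / 2 ^+ n.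
  move=> [K1 K2]; apply: le_trans (cabs_le_ReIm _) _.
  by rewrite mulrDl lerD// ler_norml ?Re_sub ?Im_sub /=; lra.
rewrite /P; apply: le_trans (@rectint_small G x y _ _ (p +i* q) L (e' * ((l + h) / 2 ^+ n)) _ _ _ _ _) _.
- exact: ge0.
- exact: ge0.
- by rewrite mulr_ge0// ltW.
- by move=> w [K1 K2]; apply: Gc; split; lra.
- move=> w rw; apply: le_trans (dP _ (le_lt_trans (wz _ rw) lhd)) _.
  by rewrite ler_wpM2l ?wz// ltW.
rewrite -mulrDl.
have -> : 4 * (e' * ((l + h) / 2 ^+ n)) * ((l + h) / 2 ^+ n) =
  e * ((l + h) / (1 + (l + h))) ^+ 2 / 4 ^+ n.
  have -> : (4 : R) = 2 ^+ 2 by rewrite expr2 -natrM.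
  rewrite -exprM mulnC exprM /e'.
  by field; rewrite expf_neq0//= gt_eqF.
rewrite ler_wpM2r ?invr_ge0 ?exprn_ge0// ler_piMr ?(ltW e0)//.
rewrite exprn_ile1//; first by rewrite divr_ge0 ?addr_ge0 ?(ltW lh1).
by rewrite ler_pdivrMr// mul1r lerDr.
Qed.

End goursat.

(** * The Poisson kernel *)

Section poisson_kernel.
Context {R : realType}.
Notation leb := (@lebesgue_measure R).

Definition poisson_kernel (x y t : R) : R := y / ((t - x) ^+ 2 + y ^+ 2).

Lemma oneDsqr_gt0 (t : R) : 0 < 1 + t ^+ 2.
Proof. by rewrite ltr_pwDl// sqr_ge0. Qed.

Lemma continuous_inv_oneDsqr : continuous (fun t : R => (1 + t ^+ 2)^-1).
Proof. exact: continuous_oneDsqrV. Qed.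

Lemma integral_inv_oneDsqr :
  (\int[leb]_t ((1 + t ^+ 2)^-1)%:E = pi%:E)%E.
Proof.
rewrite ge0_symfun_integralT.
- have -> : [set x : R | 0 <= x] = `[0, +oo[%classic.
    by apply/seteqP; split => x /=; rewrite in_itv /= andbT.
  rewrite integral0y_oneDsqr -EFinM; congr EFin.
  by field.
- by move=> x; rewrite invr_ge0 ltW// oneDsqr_gt0.
- exact: continuous_inv_oneDsqr.
- by move=> x /=; rewrite sqrrN.
Qed.

Lemma poisson_kernel_gt0 x y t : 0 < y -> 0 < poisson_kernel x y t.
Proof.
by move=> y0; rewrite divr_gt0// ltr_wpDl ?sqr_ge0// exprn_gt0.
Qed.

Lemma poisson_kernelE x y t : 0 < y ->
  poisson_kernel x y t = (1 + ((t - x) / y) ^+ 2)^-1 * y^-1.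
Proof.
move=> y0; rewrite /poisson_kernel.
have := oneDsqr_gt0 ((t - x) / y).
have : 0 < (t - x) ^+ 2 + y ^+ 2 by rewrite ltr_wpDl ?sqr_ge0// exprn_gt0.
move=> H1 H2; field; rewrite !gt_eqF//=.
by rewrite addrC.
Qed.

Lemma integral_poisson_kernel x y : 0 < y ->
  (\int[leb]_t (poisson_kernel x y t)%:E = pi%:E)%E.
Proof.
move=> y0; pose F t := (t - x) / y : R.
have dF (t : R) : is_derive t (1 : R) F y^-1.
  rewrite /F; apply: is_derive_eq.
  by rewrite /GRing.scale /= mulr0 add0r subr0 mulr1.
have F' : derive1 F = cst y^-1.
  by apply/funext => t; rewrite derive1E; exact: derive_val.
rewrite -integral_inv_oneDsqr.
rewrite (@increasing_ge0_integration_by_substitutionT _ F (fun t => (1 + t ^+ 2)^-1)).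
- apply: eq_integral => t _; congr EFin.
  by rewrite poisson_kernelE// [in RHS]/GRing.mul /= F'.
- by move=> s t st; rewrite /F ltr_pM2r ?invr_gt0// ltrD2r.
- by rewrite F'; exact: cst_continuous.
- by rewrite F'; exact: is_cvg_cst.
- by rewrite F'; exact: is_cvg_cst.
- by move=> t; exact: ex_derive.
- apply/cvgrNyPle => A; near=> t; rewrite /F ler_pdivrMr// lerBlDr.
  by near: t; apply: nbhs_ninfty_le; exact: num_real.
- apply/cvgryPge => A; near=> t; rewrite /F ler_pdivlMr// lerBrDr.
  by near: t; apply: nbhs_pinfty_ge; exact: num_real.
- exact: continuous_inv_oneDsqr.
- by move=> t; rewrite invr_ge0 ltW// oneDsqr_gt0.
Unshelve. all: by end_near. Qed.

Lemma measurable_poisson_kernel x y : 0 < y ->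
  measurable_fun setT (poisson_kernel x y : measurableTypeR R -> R).
Proof.
move=> y0; rewrite (_ : poisson_kernel x y = fun t => (1 + ((t - x) / y) ^+ 2)^-1 * y^-1).
  apply: measurable_funM => //.
  apply: (@measurableT_comp _ _ _ _ _ _ (fun t : R => (1 + t ^+ 2)^-1)).
    exact: continuous_measurable_fun continuous_inv_oneDsqr.
  by apply: measurable_funM => //; exact: measurable_funB.
by apply/funext => t; rewrite poisson_kernelE.
Qed.

Lemma integrable_poisson_kernel x y : 0 < y ->
  leb.-integrable setT (EFin \o poisson_kernel x y).
Proof.
move=> y0; apply/integrableP; split.
  by apply/measurable_EFinP; exact: measurable_poisson_kernel.
under eq_integral => t _.
  rewrite /= ger0_norm; last by rewrite ltW// poisson_kernel_gt0.
  over.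
by rewrite integral_poisson_kernel// ltry.
Qed.

Lemma integrable_inv_oneDsqr (C : R) :
  leb.-integrable setT (EFin \o (fun t => C / (1 + t ^+ 2))).
Proof.
have := @integrable_poisson_kernel 0 1 ltr01.
move=> /(@integrableZl _ _ _ _ _ measurableT C).
apply: eq_integrable => //= t _.
by rewrite /poisson_kernel subr0 expr1n mul1r addrC.
Qed.

End poisson_kernel.

(** * Cauchy and Poisson formulas in the half-plane *)

Section contour_shift.
Context {R : realType}.
Notation leb := (@lebesgue_measure R).
Implicit Types G : R[i] -> R[i].

Lemma cmeasurable_horizontal G (y : R) : (forall t, ccont G (t +i* y)) ->
  @cmeasurable _ (measurableTypeR R) _ setT (fun t => G (t +i* y)).
Proof.
move=> Gc; apply: continuous_cmeasurable => t.
apply: (@ccont_lipschitz_path _ G (fun t => t +i* y)); last exact: Gc.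
by move=> s; exact: horizontal_lipschitz.
Qed.

Lemma Cintegral_mkcond (D : set (measurableTypeR R)) (f : R -> R[i]) :
  Cintegral leb D f = Cintegral leb setT (fun t => if t \in D then f t else 0).
Proof.
rewrite /Cintegral; congr (_ +i* _); rewrite [LHS]Rintegral_mkcond;
 by apply: eq_Rintegral => t _; rewrite patchE; case: ifP.
Qed.

Lemma Cintegral_exhaust (f : R -> R[i]) (g : R -> R) :
  @cmeasurable _ (measurableTypeR R) _ setT f ->
  leb.-integrable setT (EFin \o g) -> (forall t, cabs (f t) <= g t) ->
  ctends (fun n => Cintegral leb `[(- n%:R)%R, n%:R] f) (Cintegral leb setT f).
Proof.
move=> mf ig fg.
pose f_ n (t : measurableTypeR R) := if t \in `[(- n%:R)%R, n%:R : R]%classic then f t else 0.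
have [|||//|||_] := @Cintegral_dominated_cvg _ _ _ leb setT f_ f g.
- exact: measurableT.
- move=> n; have [mf1 mf2] := mf; split.
    rewrite (_ : _ \o _ = (@complex.Re R \o f) \_ `[(- n%:R)%R, n%:R]).
      apply/(measurable_restrictT _ _).1 => //.
      exact: measurable_funS mf1.
    by apply/funext => t; rewrite /f_ patchE /=; case: ifP.
  rewrite (_ : _ \o _ = (@complex.Im R \o f) \_ `[(- n%:R)%R, n%:R]).
    apply/(measurable_restrictT _ _).1 => //.
    exact: measurable_funS mf2.
  by apply/funext => t; rewrite /f_ patchE /=; case: ifP.
- exact: mf.
- apply: aeW => t _; apply/ctendsP => e e0.
  exists (Num.truncn `|t|).+1 => // n /= tn.
  rewrite /f_ mem_set ?subrr ?cabs0// /= in_itv /= -ler_norml.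
  apply: le_trans (_ : _ <= (Num.truncn `|t|).+1%:R) _; last by rewrite ler_nat.
  by apply/ltW; rewrite truncnS_gt.
- exact: ig.
- move=> n t _; rewrite /f_; case: ifP => // _.
  by rewrite cabs0 (le_trans _ (fg t))// cabs_ge0.
have -> // : (fun n => Cintegral leb setT (f_ n)) =
   fun n => Cintegral leb `[(- n%:R)%R, n%:R] f.
by apply/funext => n; rewrite [RHS]Cintegral_mkcond.
Qed.

Lemma cintegrable_horizontal_decay G (C y : R) : (forall t, ccont G (t +i* y)) ->
  (forall t, cabs (G (t +i* y)) <= C / (1 + t ^+ 2)) ->
  cintegrable leb setT (fun t => G (t +i* y)).
Proof.
move=> Gc GC.
apply: (@cintegrable_dominated _ (measurableTypeR R) _ leb _ _ _ _ _
  (integrable_inv_oneDsqr C)) => //.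
exact: cmeasurable_horizontal.
Qed.

Lemma ctends0_harmonic (K : R) (u : nat -> R[i]) :
  (forall n, cabs (u n) <= K * harmonic n) -> ctends u 0.
Proof.
move=> uK; apply/ctendsP => e e0.
have : K * @harmonic R n @[n --> \oo] --> K * 0.
  by apply: cvgMr; exact: cvg_harmonic.
rewrite mulr0 => /cvgrPdist_lt /(_ _ e0); apply: filterS => n.
rewrite sub0r normrN subr0 => H.
by apply: le_lt_trans (uK n) _; apply: le_lt_trans H; exact: ler_norm.
Qed.

Lemma cabs_Cintegral_itv_le (f : R -> R[i]) (a b M : R) : a <= b ->
  cintegrable leb `[a, b] f ->
  (forall t, a <= t <= b -> cabs (f t) <= M) ->
  cabs (Cintegral leb `[a, b] f) <= 2 * M * (b - a).
Proof.
move=> ab fi fM.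
apply: le_trans (@cabs_Cintegral_le _ _ _ leb _ f (cst M) _ fi _ _) _ => //.
  by apply: continuous_compact_integrable; [exact: segment_compact|
    apply: continuous_subspaceT => ?; exact: cvg_cst].
rewrite Rintegral_cst//; have -> : b = a + (b - a) by rewrite addrC subrK.
by rewrite lebesgue_itvcc ?subr_ge0// addrAC subrr add0r mulrA.
Qed.

(** Goursat's theorem on the rectangle between the abscissas [-n] and [n]: the vertical sides are of
    order [C (s2 - s1) / (1 + n^2)] and vanish in the limit, while the horizontal ones exhaust the
    lines by dominated convergence. *)
Lemma contour_shift G (C s1 s2 : R) : s1 <= s2 ->
  (forall z, s1 <= complex.Im z <= s2 -> cdiff G z) ->
  (forall t s, s1 <= s <= s2 -> cabs (G (t +i* s)) <= C / (1 + t ^+ 2)) ->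
  Cintegral leb setT (fun t => G (t +i* s1)) =
  Cintegral leb setT (fun t => G (t +i* s2)).
Proof.
move=> s12 Gd GC.
have Gc z : s1 <= complex.Im z <= s2 -> ccont G z by move=> /Gd; exact: cdiff_ccont.
have s1s : s1 <= s1 <= s2 by rewrite lexx.
have s2s : s1 <= s2 <= s2 by rewrite lexx s12.
have i1 : cintegrable leb setT (fun t => G (t +i* s1)).
  by apply: (@cintegrable_horizontal_decay _ C) => t; [exact: Gc | exact: GC].
have i2 : cintegrable leb setT (fun t => G (t +i* s2)).
  by apply: (@cintegrable_horizontal_decay _ C) => t; [exact: Gc | exact: GC].
apply/eqP; rewrite -subr_eq0; apply/eqP.
rewrite -CintegralB//.
apply: (@ctends_unique _ (fun n => Cintegral leb `[(- n%:R)%R, n%:R]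
  (fun t => G (t +i* s1) - G (t +i* s2)))).
  apply: (@Cintegral_exhaust _ (fun t => (2 * C) / (1 + t ^+ 2))).
  - have [a b] := @cmeasurable_horizontal G s1 (fun t => Gc (t +i* s1) s1s).
    have [a' b'] := @cmeasurable_horizontal G s2 (fun t => Gc (t +i* s2) s2s).
    split.
      by apply: eq_measurable_fun (measurable_funB a a') => t _ /=; rewrite Re_sub.
    by apply: eq_measurable_fun (measurable_funB b b') => t _ /=; rewrite Im_sub.
  - exact: integrable_inv_oneDsqr.
  - move=> t; apply: le_trans (cabsD _ _) _; rewrite cabsN.
    by rewrite -mulrA mulr2n mulrDl mul1r lerD// GC.
have C0 : 0 <= C.
  by have := GC 0 s1 s1s; rewrite expr0n addr0 divr1; apply: le_trans; exact: cabs_ge0.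
apply: (@ctends0_harmonic (4 * C * (s2 - s1))) => n.
have n0 : - n%:R <= n%:R :> R by rewrite ge0_cp// ler0n.
have := @goursat _ G (- n%:R) s1 (n%:R + n%:R) (s2 - s1).
rewrite /rectint addrA addNr add0r (addrC s1) subrK subr_ge0 => H.
have /eqP : Cintegral leb `[(- n%:R)%R, n%:R] (fun t => G (t +i* s1) - G (t +i* s2)) +
    'i * Cintegral leb `[s1, s2] (fun s => G (n%:R +i* s) - G ((- n%:R) +i* s)) = 0.
  apply: H => //.
  by move=> z [_]; rewrite addrC subrK; exact: Gd.
rewrite addr_eq0 => /eqP ->; rewrite cabsN cabsM cabs_i mul1r.
have iv x : cintegrable leb `[s1, s2] (fun s => G (x +i* s)).
  by apply: cintegrable_vertical => s ss; exact: Gc.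
have M0 : 0 <= C / (1 + n%:R ^+ 2) by rewrite divr_ge0// ltW// oneDsqr_gt0.
apply: le_trans (@cabs_Cintegral_itv_le _ _ _ (2 * (C / (1 + n%:R ^+ 2))) s12 _ _) _.
- exact: cintegrableB.
- move=> s ss; apply: le_trans (cabsD _ _) _; rewrite cabsN.
  rewrite mulr2n mulrDl mul1r lerD ?GC//.
  by apply: le_trans (GC _ _ ss) _; rewrite sqrrN.
have -> : 2 * (2 * (C / (1 + n%:R ^+ 2))) * (s2 - s1) =
  4 * C * (s2 - s1) * (1 + n%:R ^+ 2)^-1 by ring.
rewrite ler_wpM2l ?mulr_ge0 ?subr_ge0// /harmonic.
rewrite lef_pV2 ?posrE ?oneDsqr_gt0 ?ltr0n// -natrX -(natrD _ 1%N) ler_nat add1n ltnS.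
by case: n {H n0 M0} => // n; rewrite -mulnn leq_pmulr.
Qed.

End contour_shift.

Section halfplane.
Context {R : realType}.
Notation leb := (@lebesgue_measure R).
Implicit Types G F : R[i] -> R[i].

Lemma ctendsB (u v : nat -> R[i]) l m : ctends u l -> ctends v m ->
  ctends (fun n => u n - v n) (l - m).
Proof.
move=> [u1 u2] [v1 v2]; split.
  by under eq_fun do rewrite Re_sub; rewrite Re_sub; exact: cvgB.
by under eq_fun do rewrite Im_sub; rewrite Im_sub; exact: cvgB.
Qed.

Lemma decay_ge0 G (C s0 : R) :
  (forall t s, s0 <= s -> cabs (G (t +i* s)) <= C / (1 + t ^+ 2 + s ^+ 2)) ->
  0 <= C.
Proof.
move=> GC; have := GC 0 s0 (lexx _); rewrite expr0n addr0 => H.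
have := le_trans (cabs_ge0 _) H; rewrite pmulr_lge0// invr_gt0.
exact: oneDsqr_gt0.
Qed.

(** The line can be moved up to height [s0 + n] without changing the integral; the term [s ^ 2] in
    the decay makes the integrand tend to zero there, under an integrable majorant. *)
Lemma halfplane_integral0 G (C s0 : R) : 0 <= s0 ->
  (forall z, s0 <= complex.Im z -> cdiff G z) ->
  (forall t s, s0 <= s -> cabs (G (t +i* s)) <= C / (1 + t ^+ 2 + s ^+ 2)) ->
  Cintegral leb setT (fun t => G (t +i* s0)) = 0.
Proof.
move=> s00 Gd GC; have C0 := decay_ge0 GC.
have GC1 t s : s0 <= s -> cabs (G (t +i* s)) <= C / (1 + t ^+ 2).
  move=> ss; apply: le_trans (GC _ _ ss) _; rewrite ler_wpM2l//.
  rewrite lef_pV2 ?posrE ?oneDsqr_gt0// ?lerDl ?sqr_ge0//.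
  by rewrite ltr_pwDl ?oneDsqr_gt0 ?sqr_ge0.
have s0n n : s0 <= s0 + n%:R :> R by rewrite lerDl.
apply: (@ctends_unique _ (fun n => Cintegral leb setT (fun t => G (t +i* (s0 + n%:R))))).
  rewrite (_ : (fun n => _) = fun=> Cintegral leb setT (fun t => G (t +i* s0))).
    exact: ctends_cst.
  apply/funext => n; apply/esym; apply: (@contour_shift _ _ C) => //.
    by move=> z /andP[z1 _]; exact: Gd.
  by move=> t s /andP[ss _]; exact: GC1.
have -> : 0 = Cintegral leb setT (fun=> 0 : R[i]).
  by rewrite /Cintegral Rintegral_cst//= mul0r.
have [||||||_] := @Cintegral_dominated_cvg _ _ _ leb setT
  (fun n t => G (t +i* (s0 + n%:R))) (fun=> 0) (fun t => C / (1 + t ^+ 2)) => //.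
- move=> n; apply: cmeasurable_horizontal => t.
  by apply: cdiff_ccont; apply: Gd; exact: s0n.
- by split; exact: (@measurable_cst _ _ _ _ setT (0 : R)).
- apply: aeW => t _; apply: (@ctends0_harmonic _ C) => n.
  apply: le_trans (GC _ _ (s0n n)) _; rewrite ler_wpM2l// /harmonic.
  rewrite lef_pV2 ?posrE ?ltr0n//; last first.
    by rewrite ltr_pwDl ?oneDsqr_gt0 ?sqr_ge0.
  apply: le_trans (_ : _ <= 1 + n%:R ^+ 2) _.
    rewrite -natrX -(natrD _ 1%N) ler_nat add1n ltnS.
    by case: n => // n; rewrite -mulnn leq_pmulr.
  rewrite -addrA lerD2l ler_wpDl ?sqr_ge0// ler_pXn2r ?nnegrE ?addr_ge0//.
  by rewrite lerDr.
- exact: integrable_inv_oneDsqr.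
- by move=> n t _; exact: GC1.
Qed.

(** [|w - a|] is at least [- Im a], so the constant [1 + |a|] is at most [(1 + |a|) / (- Im a)]
    times [|w - a|]; the rest is the triangle inequality. Two such factors give quadratic decay. *)
Lemma halfplane_dist (a w : R[i]) : complex.Im a < 0 -> 0 <= complex.Im w ->
  1 + cabs w <= (1 + (1 + cabs a) / (- complex.Im a)) * cabs (w - a).
Proof.
move=> a0 w0; have Na0 : 0 < - complex.Im a by rewrite oppr_gt0.
have H1 : - complex.Im a <= cabs (w - a).
  apply: le_trans (Im_le_cabs _); rewrite Im_sub.
  by apply: le_trans (ler_norm _); rewrite lerDr.
have H2 : cabs w <= cabs (w - a) + cabs a.
  by rewrite -{1}(subrK a w) cabsD.
have H3 : (1 + cabs a) <= (1 + cabs a) / (- complex.Im a) * cabs (w - a).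
  rewrite mulrAC ler_pdivlMr// ler_wpM2l// addr_ge0// cabs_ge0//.
by rewrite mulrDl mul1r; lra.
Qed.

Lemma sqr_1Dcabs (t s : R) : 1 + t ^+ 2 + s ^+ 2 <= (1 + cabs (t +i* s)) ^+ 2.
Proof.
have := cabs_sqr (t +i* s); have := cabs_ge0 (t +i* s).
move: (cabs _) => c c0 /= cE; rewrite sqrrD cE expr1n mul1r; lra.
Qed.

Lemma decay_prod (a b w : R[i]) : complex.Im a < 0 -> complex.Im b < 0 ->
  0 <= complex.Im w ->
  (cabs (w - a) * cabs (w - b))^-1 <=
  (1 + (1 + cabs a) / (- complex.Im a)) * (1 + (1 + cabs b) / (- complex.Im b))
   / (1 + complex.Re w ^+ 2 + complex.Im w ^+ 2).
Proof.
move=> a0 b0 w0.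
have Ha := halfplane_dist a0 w0; have Hb := halfplane_dist b0 w0.
have pos (c : R[i]) : complex.Im c < 0 -> 0 < cabs (w - c).
  move=> c0; rewrite cabs_gt0 subr_eq0; apply/eqP => wc.
  by move: w0; rewrite wc leNgt c0.
have d0 : 0 < 1 + complex.Re w ^+ 2 + complex.Im w ^+ 2.
  by rewrite ltr_pwDl ?oneDsqr_gt0 ?sqr_ge0.
rewrite ler_pdivlMr// ler_pdivrMl ?mulr_gt0 ?pos//.
apply: le_trans (_ : (1 + cabs w) ^+ 2 <= _).
  by case: (w) => t s; exact: sqr_1Dcabs.
rewrite [leRHS]mulrC mulrACA expr2.
by apply: ler_pM => //; rewrite addr_ge0 ?cabs_ge0.
Qed.

(** The difference of two simple poles is [(a - b)] over their product, which decays quadratically;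
    both poles lie below the half-plane of holomorphy. *)
Lemma cauchy_lower F (B : R) (a b : R[i]) :
  (forall z, 0 <= complex.Im z -> cdiff F z) ->
  (forall z, 0 <= complex.Im z -> cabs (F z) <= B) ->
  complex.Im a < 0 -> complex.Im b < 0 ->
  Cintegral leb setT (fun t : R => F t%:C * ((t%:C - a)^-1 - (t%:C - b)^-1)) = 0.
Proof.
move=> Fd FB a0 b0.
have neq (c w : R[i]) : complex.Im c < 0 -> 0 <= complex.Im w -> w - c != 0.
  by move=> c0 w0; rewrite subr_eq0; apply: contraTneq w0 => ->; rewrite -ltNge.
pose K := (1 + (1 + cabs a) / (- complex.Im a)) * (1 + (1 + cabs b) / (- complex.Im b)).
pose G w := F w * ((w - a)^-1 - (w - b)^-1).
suff H : Cintegral leb setT (fun t : R => G (t +i* 0)) = 0.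
  by rewrite -[RHS]H; apply: eq_Cintegral.
apply: (@halfplane_integral0 G (B * cabs (a - b) * K) 0 (lexx 0)).
  move=> z z0; apply: cdiffM; first exact: Fd.
  apply: cdiffB; apply: cdiffV; try exact: neq;
    by apply: cdiffB; [exact: cdiff_id | exact: cdiff_cst].
move=> t s s0; rewrite /G.
have -> : ((t +i* s) - a)^-1 - ((t +i* s) - b)^-1 =
   (a - b) * (((t +i* s) - a) * ((t +i* s) - b))^-1.
  have := neq a (t +i* s) a0 s0; have := neq b (t +i* s) b0 s0.
  move: (t +i* s) => w ? ?; field; apply/andP; split => //.
rewrite !cabsM cabsV cabsM -!mulrA; apply: ler_pM; rewrite ?cabs_ge0//.
- by rewrite mulr_ge0 ?invr_ge0 ?mulr_ge0 ?cabs_ge0.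
- exact: FB.
- rewrite ler_wpM2l ?cabs_ge0//.
  by rewrite [leRHS]mulrA; exact: (@decay_prod a b (t +i* s) a0 b0 s0).
Qed.

(** Within distance [d] of [z] the quotient is at most [1 + |L|] by differentiability; further away
    it is at most [2 B / |w - z|]. The constant [C] adds what the two regions need. *)
Lemma difference_quotient_bound F (B : R) (z : R[i]) :
  cdiff F z -> (forall w, 0 <= complex.Im w -> cabs (F w) <= B) ->
  0 <= complex.Im z ->
  exists2 C, 0 <= C & forall w, 0 <= complex.Im w -> w != z ->
    cabs (F w - F z) / cabs (w - z) <= C / (1 + cabs (w - z)).
Proof.
move=> /cdiffP[L FL] FB z0.
have [d d0 dP] := FL _ ltr01.
have B0 : 0 <= B by apply: le_trans (FB _ z0); exact: cabs_ge0.
have L0 := cabs_ge0 L.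
exists ((1 + cabs L) * (1 + d) + 2 * B * (1 + d) / d).
  by rewrite addr_ge0// ?mulr_ge0 ?addr_ge0 ?invr_ge0 // ltW.
move=> w w0 wz; have wz0 : 0 < cabs (w - z) by rewrite cabs_gt0 subr_eq0.
have k0 : 0 < 1 + cabs (w - z) by rewrite ltr_pwDl ?cabs_ge0.
rewrite ler_pdivlMr// mulrAC ler_pdivrMr//.
have [wd|wd] := ltP (cabs (w - z)) d.
  have H : cabs (F w - F z) <= (1 + cabs L) * cabs (w - z).
    rewrite -[X in cabs X](subrK (L * (w - z))) mulrDl mul1r.
    apply: le_trans (cabsD _ _) _; rewrite cabsM lerD2r.
    by have := dP _ wd; rewrite mul1r.
  apply: le_trans (_ : (1 + cabs L) * (1 + d) * cabs (w - z) <= _).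
    rewrite mulrAC; apply: ler_pM => //; first exact: cabs_ge0.
      exact: ltW.
    by rewrite lerD2l ltW.
  rewrite ler_wpM2r ?cabs_ge0// lerDl.
  by rewrite ?mulr_ge0 ?addr_ge0 ?invr_ge0 // ltW.
have H : cabs (F w - F z) <= 2 * B.
  apply: le_trans (cabsD _ _) _; rewrite cabsN mulr2n mulrDl !mul1r.
  by rewrite lerD ?FB.
apply: le_trans (_ : 2 * B * (1 + d) / d * cabs (w - z) <= _).
  apply: le_trans (ler_wpM2r (ltW k0) H) _.
  rewrite -!mulrA ler_wpM2l// ler_wpM2l// mulrA mulrAC.
  rewrite ler_pdivlMr// mulrDl mulrDl !mul1r mulrC lerD2r //.
rewrite ler_wpM2r ?cabs_ge0// lerDr mulr_ge0// addr_ge0// ltW//.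
Qed.

Lemma singular_decay F (B : R) (z : R[i]) : 0 < complex.Im z -> cdiff F z ->
  (forall w, 0 <= complex.Im w -> cabs (F w) <= B) ->
  exists C, forall w, 0 <= complex.Im w ->
    cabs ((F w - F z) / (w - z) / (w - conjc z)) <=
    C / (1 + complex.Re w ^+ 2 + complex.Im w ^+ 2).
Proof.
move=> z0 Fz FB; have [C C0 HC] := difference_quotient_bound Fz FB (ltW z0).
pose a := conjc z; have a0 : complex.Im a < 0.
  by rewrite /a; case: (z) z0 => p q /=; rewrite oppr_lt0.
pose Ka := 1 + (1 + cabs a) / (- complex.Im a).
have Ka0 : 0 <= Ka.
  by rewrite addr_ge0// divr_ge0 ?addr_ge0 ?cabs_ge0// oppr_ge0 ltW.
exists (C * (1 + cabs z) * Ka) => w w0.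
have d0 : 0 < 1 + complex.Re w ^+ 2 + complex.Im w ^+ 2.
  by rewrite ltr_pwDl ?oneDsqr_gt0 ?sqr_ge0.
(* At [w = z] the quotient is zero, by the convention that the inverse of zero is zero. *)
have [->|wz] := eqVneq w z.
  rewrite subrr !mul0r cabs0 divr_ge0//.
    by rewrite !mulr_ge0// addr_ge0// cabs_ge0.
  by rewrite !addr_ge0// sqr_ge0.
have wa : 0 < cabs (w - a).
  rewrite cabs_gt0 subr_eq0; apply/eqP => wa.
  by move: w0; rewrite wa leNgt a0.
have w1 : 0 < 1 + cabs w by rewrite ltr_pwDl ?cabs_ge0.
have wz1 : 0 < 1 + cabs (w - z) by rewrite ltr_pwDl ?cabs_ge0.
have H1 : cabs ((F w - F z) / (w - z)) <= C * (1 + cabs z) / (1 + cabs w).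
  rewrite cabsM cabsV; apply: le_trans (HC _ w0 wz) _.
  rewrite -mulrA ler_wpM2l// ler_pdivlMr// mulrC ler_pdivrMr//.
  have : cabs w <= cabs (w - z) + cabs z by rewrite -{1}(subrK z w) cabsD.
  have := mulr_ge0 (cabs_ge0 z) (cabs_ge0 (w - z)); lra.
have H2 : (cabs (w - a))^-1 <= Ka / (1 + cabs w).
  by rewrite ler_pdivlMr// mulrC ler_pdivrMr// halfplane_dist.
rewrite cabsM cabsV; apply: le_trans (_ : C * (1 + cabs z) * Ka / (1 + cabs w) ^+ 2 <= _).
  apply: le_trans (ler_pM (cabs_ge0 _) _ H1 H2) _; first by rewrite invr_ge0 ltW.
  by rewrite mulrACA expr2 invfM.
apply: ler_wpM2l; first by rewrite !mulr_ge0// addr_ge0// cabs_ge0.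
rewrite lef_pV2 ?posrE ?exprn_gt0//.
by case: (w) => t s; exact: sqr_1Dcabs.
Qed.

(** The function [G] below is bounded near [z], but takes the value zero at [z] by convention and
    need not be continuous there, so no contour may pass through [z]. Its integral over the real
    line equals the one just below height [y], the one just above is zero, and both integrands have
    the same limit except at [t = x]; dominated convergence then gives zero for the real line. There
    [y G] is the Poisson kernel times [F t - F z]. *)
Lemma poisson_formula F (B : R) (z : R[i]) :
  (forall w, 0 <= complex.Im w -> cdiff F w) ->
  (forall w, 0 <= complex.Im w -> cabs (F w) <= B) -> 0 < complex.Im z ->
  Cintegral leb setT (fun t : R =>
    (poisson_kernel (complex.Re z) (complex.Im z) t)%:C * F t%:C) = pi%:C * F z.
Proof.
move=> Fd FB z0; set x := complex.Re z; set y := complex.Im z.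
have [C HC] := singular_decay z0 (Fd _ (ltW z0)) FB.
pose G w := (F w - F z) / (w - z) / (w - conjc z).
have Gd w : 0 <= complex.Im w -> w != z -> cdiff G w.
  move=> w0 wz; apply: cdiffM; last first.
    apply: cdiffV; last by apply: cdiffB; [exact: cdiff_id|exact: cdiff_cst].
    rewrite subr_eq0; apply/eqP => wc; move: w0; rewrite wc.
    by case: (z) z0 => p q /= q0; rewrite leNgt oppr_lt0 q0.
  apply: cdiffM; first by apply: cdiffB; [exact: Fd|exact: cdiff_cst].
  apply: cdiffV; last by apply: cdiffB; [exact: cdiff_id|exact: cdiff_cst].
  by rewrite subr_eq0.
have GC t s : 0 <= s -> cabs (G (t +i* s)) <= C / (1 + t ^+ 2 + s ^+ 2).
  by move=> s0; exact: (HC (t +i* s)).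
have C0 := decay_ge0 GC.
have GC1 t s : 0 <= s -> cabs (G (t +i* s)) <= C / (1 + t ^+ 2).
  move=> ss; apply: le_trans (GC _ _ ss) _; rewrite ler_wpM2l//.
  rewrite lef_pV2 ?posrE ?oneDsqr_gt0// ?lerDl ?sqr_ge0//.
  by rewrite ltr_pwDl ?oneDsqr_gt0 ?sqr_ge0.
have Imz (w : R[i]) : complex.Im w != y -> w != z.
  by apply: contraNneq => ->.
pose I s := Cintegral leb setT (fun t => G (t +i* s)).
have I1 n : I 0 = I (y - y * harmonic n).
  have h1 : harmonic n <= 1 :> R by rewrite /harmonic invf_le1 ?ltr0n// ler1n.
  have h0 : 0 < harmonic n :> R by rewrite /harmonic invr_gt0 ltr0n.
  apply: (@contour_shift _ _ C) => //.
  - by rewrite subr_ge0 ler_piMr// ltW.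
  - move=> w /andP[w0 wy]; apply: Gd => //; apply: Imz.
    by rewrite lt_eqF// (le_lt_trans wy)// ltrBlDr ltrDl mulr_gt0.
  - by move=> t s /andP[s0 _]; exact: GC1.
have I2 n : I (y + y * harmonic n) = 0.
  have h0 : 0 < harmonic n :> R by rewrite /harmonic invr_gt0 ltr0n.
  have yh : y < y + y * harmonic n by rewrite ltrDl mulr_gt0.
  apply: (@halfplane_integral0 _ C).
  - by rewrite ltW// (lt_trans z0).
  - move=> w wy; apply: Gd; first by rewrite (le_trans _ wy)// ltW// (lt_trans z0).
    by apply: Imz; rewrite gt_eqF// (lt_le_trans yh).
  - move=> t s ss; apply: GC; rewrite (le_trans _ ss)// ltW// (lt_trans z0)//.
have Gi s : 0 <= s -> s != y -> cintegrable leb setT (fun t => G (t +i* s)).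
  move=> s0 sy; apply: (@cintegrable_horizontal_decay _ _ C) => t; last exact: GC1.
  by apply: cdiff_ccont; apply: Gd => //; exact: Imz.
have hn0 n : 0 < harmonic n :> R by rewrite /harmonic invr_gt0 ltr0n.
have hn1 n : harmonic n <= 1 :> R by rewrite /harmonic invf_le1 ?ltr0n// ler1n.
have sn0 n : 0 <= y - y * harmonic n by rewrite subr_ge0 ler_piMr// ltW.
have sny n : y - y * harmonic n != y.
  by rewrite lt_eqF// ltrBlDr ltrDl mulr_gt0.
have un0 n : 0 <= y + y * harmonic n by rewrite ltW// addr_gt0// mulr_gt0.
have uny n : y + y * harmonic n != y.
  by rewrite gt_eqF// ltrDl mulr_gt0.
have I0 : I 0 = 0.
  apply: (@ctends_unique _ (fun n => Cintegral leb setT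
    (fun t => G (t +i* (y - y * harmonic n)) - G (t +i* (y + y * harmonic n))))).
    rewrite (_ : (fun n => _) = fun=> I 0); first exact: ctends_cst.
    apply/funext => n; rewrite CintegralB//; [|exact: Gi..].
    by rewrite -/(I (y - _)) -/(I (y + _)) -I1 I2 subr0.
  have -> : 0 = Cintegral leb setT (fun=> 0 : R[i]).
    by rewrite /Cintegral Rintegral_cst//= mul0r.
  have [||||||_] := @Cintegral_dominated_cvg _ _ _ leb setT
    (fun n t => G (t +i* (y - y * harmonic n)) - G (t +i* (y + y * harmonic n)))
    (fun=> 0) (fun t => 2 * C / (1 + t ^+ 2)) => //.
  - move=> n; have [[/integrableP[/measurable_EFinP a1 _] /integrableP[/measurable_EFinP a2 _]]
      [/integrableP[/measurable_EFinP b1 _] /integrableP[/measurable_EFinP b2 _]]] :=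
      (Gi _ (sn0 n) (sny n), Gi _ (un0 n) (uny n)).
    split.
      by apply: eq_measurable_fun (measurable_funB a1 b1) => t _ /=; rewrite Re_sub.
    by apply: eq_measurable_fun (measurable_funB a2 b2) => t _ /=; rewrite Im_sub.
  - by split; exact: (@measurable_cst _ _ _ _ setT (0 : R)).
  (* The line at height [y] meets the singularity only at abscissa [x], a null set. *)
  - exists [set x]; split; [exact: measurable_set1 | exact: lebesgue_measure_set1|].
    move=> t /=; apply: contra_notP => /eqP tx _.
    have Gt : ccont G (t +i* y).
      apply: cdiff_ccont; apply: Gd; first exact: ltW.
      by apply: contraNneq tx => /(congr1 (@complex.Re R)) /= ->.
    have y1 : y - y * harmonic n @[n --> \oo] --> y.
      rewrite -[X in _ --> X]subr0 -[X in _ --> _ - X](mulr0 y).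
      by apply: cvgB; [exact: cvg_cst | apply: cvgMr; exact: cvg_harmonic].
    have y2 : y + y * harmonic n @[n --> \oo] --> y.
      rewrite -[X in _ --> X]addr0 -[X in _ --> _ + X](mulr0 y).
      by apply: cvgD; [exact: cvg_cst | apply: cvgMr; exact: cvg_harmonic].
    rewrite -(subrr (G (t +i* y))); apply: ctendsB.
      apply: (@ccont_ctends _ G (fun n => t +i* (y - y * harmonic n)) _ Gt).
      by split; [exact: cvg_cst|].
    apply: (@ccont_ctends _ G (fun n => t +i* (y + y * harmonic n)) _ Gt).
    by split; [exact: cvg_cst|].
  - exact: integrable_inv_oneDsqr.
  - move=> n t _; apply: le_trans (cabsD _ _) _; rewrite cabsN.
    by rewrite -mulrA mulr2n mulrDl mul1r lerD// GC1.
have pkE (t : R) : y%:C * G (t +i* 0) = (poisson_kernel x y t)%:C * (F t%:C - F z).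
  have zE : z = x +i* y by rewrite /x /y; case: (z).
  rewrite /G [RHS]mulrC mulrA mulrA mulrAC -!mulrA mulrCA; congr (_ * _).
  have -> : (poisson_kernel x y t)%:C = y%:C / ((t - x) ^+ 2 + y ^+ 2)%:C.
    by rewrite /poisson_kernel rmorphM fmorphV.
  rewrite -invfM; congr (_ / _); rewrite zE; apply: complex_ext;
    rewrite ?(Re_mul, Im_mul, Re_sub, Im_sub) /=; ring.
have Fm : @cmeasurable _ (measurableTypeR R) _ setT (fun t => F (t +i* 0)).
  by apply: cmeasurable_horizontal => t; apply: cdiff_ccont; exact: Fd.
have pkm : @cmeasurable _ (measurableTypeR R) _ setT (fun t => (poisson_kernel x y t)%:C).
  split; first exact: measurable_poisson_kernel.
  exact: (@measurable_cst _ _ _ _ setT (0 : R)).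
have ipk (k : R) : leb.-integrable setT (EFin \o (fun t => poisson_kernel x y t * k)).
  have := @integrable_poisson_kernel _ x y z0.
  move=> /(@integrableZl _ _ _ _ _ measurableT k).
  by apply: eq_integrable => //= t _; rewrite mulrC.
have pkI (H : R[i] -> R[i]) (K : R) : @cmeasurable _ (measurableTypeR R) _ setT (fun t => H (t +i* 0)) ->
    (forall t, cabs (H (t +i* 0)) <= K) ->
    cintegrable leb setT (fun t : R => (poisson_kernel x y t)%:C * H t%:C).
  move=> mH HK; apply: (@cintegrable_dominated _ _ _ leb _ _ _ _ _ (ipk K)) => //.
    exact: cmeasurableM.
  move=> t _; rewrite cabsM cabs_real ger0_norm; last by rewrite ltW// poisson_kernel_gt0.
  by rewrite ler_wpM2l ?HK// ltW// poisson_kernel_gt0.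
have cst_m (k : R[i]) : @cmeasurable _ (measurableTypeR R) _ setT (fun t => k).
  by split; exact: measurable_cst.
have : Cintegral leb setT (fun t : R => (poisson_kernel x y t)%:C * (F t%:C - F z)) = 0.
  rewrite -(mulr0 y%:C) -I0 -CintegralZ//; last exact: Gi (lexx _) (negbT (lt_eqF z0)).
  by apply: eq_Cintegral => t _; rewrite pkE.
under eq_fun do rewrite mulrBr.
rewrite CintegralB//; last 2 first.
- by apply: (pkI F B) => // t; exact: FB.
- by apply: (pkI (fun=> F z) (cabs (F z))).
move/eqP; rewrite subr_eq0 => /eqP ->.
under eq_fun do rewrite mulrC.
rewrite CintegralZ//; last first.
  have := pkI (fun=> 1) 1 (cst_m 1); under eq_fun do rewrite mulr1.
  by apply => t; rewrite cabs1.
rewrite mulrC; congr (_ * _); apply: complex_ext => /=.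
  by rewrite /Rintegral integral_poisson_kernel.
by rewrite Rintegral_cst// mul0r.
Qed.

End halfplane.

(** * Recovering a bounded holomorphic function from its imaginary part on the real line *)

Section cauchy_kernel.
Context {R : realType}.
Notation leb := (@lebesgue_measure R).
Implicit Types F : R[i] -> R[i].

Definition cauchy_kernel (a b : R[i]) (t : R) : R[i] :=
  (t%:C - a)^-1 - (t%:C - b)^-1.

Lemma real_sub_neq0 (a : R[i]) (t : R) : complex.Im a != 0 -> t%:C - a != 0.
Proof. by rewrite subr_eq0; apply: contraNneq => <-. Qed.

Lemma cauchy_kernelE (a b : R[i]) t : complex.Im a != 0 -> complex.Im b != 0 ->
  cauchy_kernel a b t = (a - b) * ((t%:C - a) * (t%:C - b))^-1.
Proof.
move=> a0 b0; rewrite /cauchy_kernel.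
have := real_sub_neq0 t a0; have := real_sub_neq0 t b0.
by move: (t%:C) => w ? ?; field; apply/andP; split.
Qed.

Lemma cabs_real_sub_conj (c : R[i]) (t : R) :
  cabs (t%:C - conjc c) = cabs (t%:C - c).
Proof.
by case: c => p q /=; congr Num.sqrt; congr (_ + _); rewrite !sub0r opprK sqrrN.
Qed.

Lemma conj_cauchy_kernel (a b : R[i]) (t : R) :
  conjc (cauchy_kernel a b t) = cauchy_kernel (conjc a) (conjc b) t.
Proof.
have H (c : R[i]) : conjc (t%:C - c)^-1 = (t%:C - conjc c)^-1.
  rewrite conjc_inv; congr (_^-1); apply: complex_ext; case: c => p q //=.
  by rewrite !sub0r.
by rewrite /cauchy_kernel -!H; case: (_^-1) (_^-1) => p q [p' q'] /=;
   apply: complex_ext => //=; rewrite opprD.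
Qed.

Lemma cauchy_kernelN (a b : R[i]) (t : R) :
  cauchy_kernel a b t = - cauchy_kernel b a t.
Proof. by rewrite /cauchy_kernel opprB. Qed.

Lemma cauchy_kernel_decay (a b : R[i]) : complex.Im a != 0 -> complex.Im b != 0 ->
  exists2 C, 0 <= C & forall t, cabs (cauchy_kernel a b t) <= C / (1 + t ^+ 2).
Proof.
move=> a0 b0.
(* Conjugating a pole does not change its distance to real points, so both poles may be assumed to
   lie in the lower half-plane. *)
have low (c : R[i]) : complex.Im c != 0 -> exists2 c' : R[i], complex.Im c' < 0 &
    forall t : R, cabs (t%:C - c) = cabs (t%:C - c').
  move=> c0; have [cn|cp|c00] := ltgtP (complex.Im c) 0.
  - by exists c.
  - exists (conjc c); first by case: (c) cp => p q /=; rewrite oppr_lt0.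
    by move=> t; rewrite cabs_real_sub_conj.
  - by rewrite c00 eqxx in c0.
have [a' a'0 aa'] := low a a0; have [b' b'0 bb'] := low b b0.
pose K := (1 + (1 + cabs a') / (- complex.Im a')) * (1 + (1 + cabs b') / (- complex.Im b')).
exists (cabs (a - b) * K).
  rewrite mulr_ge0 ?cabs_ge0// mulr_ge0// addr_ge0// divr_ge0 ?addr_ge0 ?cabs_ge0//;
  by rewrite oppr_ge0 ltW.
move=> t; rewrite cauchy_kernelE// !(cabsM, cabsV) aa' bb' -mulrA ler_wpM2l ?cabs_ge0//.
by have := @decay_prod _ a' b' t%:C a'0 b'0 (lexx _); rewrite /= expr0n addr0.
Qed.

Lemma cmeasurable_cauchy_kernel (a b : R[i]) : complex.Im a != 0 ->
  complex.Im b != 0 ->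
  @cmeasurable _ (measurableTypeR R) _ setT (cauchy_kernel a b).
Proof.
move=> a0 b0.
apply: (@cmeasurable_horizontal _ (fun w => (w - a)^-1 - (w - b)^-1) 0) => t.
apply: cdiff_ccont; apply: cdiffB; apply: cdiffV; try exact: real_sub_neq0;
  by apply: cdiffB; [exact: cdiff_id|exact: cdiff_cst].
Qed.

Lemma cintegrable_bounded_cauchy_kernel (f : R -> R[i]) (B : R) (a b : R[i]) :
  complex.Im a != 0 -> complex.Im b != 0 ->
  @cmeasurable _ (measurableTypeR R) _ setT f -> (forall t, cabs (f t) <= B) ->
  cintegrable leb setT (fun t => f t * cauchy_kernel a b t).
Proof.
move=> a0 b0 mf fB; have [C C0 HC] := cauchy_kernel_decay a0 b0.
apply: (@cintegrable_dominated _ (measurableTypeR R) _ leb _ _ _ _ _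
  (integrable_inv_oneDsqr (B * C))) => //.
  by apply: cmeasurableM => //; exact: cmeasurable_cauchy_kernel.
by move=> t _; rewrite cabsM -mulrA ler_pM ?cabs_ge0.
Qed.

(** The kernel splits at the intermediate pole [conjc z]: the pair [z], [conjc z] is [2 i] times the
    Poisson kernel, and the pair [conjc z], [conjc w] has both poles below and contributes zero. *)
Lemma cauchy_formula F (B : R) (z w : R[i]) :
  (forall w, 0 <= complex.Im w -> cdiff F w) ->
  (forall w, 0 <= complex.Im w -> cabs (F w) <= B) ->
  0 < complex.Im z -> 0 < complex.Im w ->
  Cintegral leb setT (fun t : R => F t%:C * cauchy_kernel z (conjc w) t) =
  (0 +i* (2 * pi)) * F z.
Proof.
move=> Fd FB z0 w0.
have conjIm (u : R[i]) : complex.Im (conjc u) = - complex.Im u by case: u.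
have Nz : complex.Im (conjc z) < 0 by rewrite conjIm oppr_lt0.
have Nw : complex.Im (conjc w) < 0 by rewrite conjIm oppr_lt0.
have mF : @cmeasurable _ (measurableTypeR R) _ setT (fun t : R => F t%:C).
  by apply: (@cmeasurable_horizontal _ F 0) => t; apply: cdiff_ccont; exact: Fd.
have FB0 t : cabs (F t%:C) <= B by exact: FB.
transitivity (Cintegral leb setT (fun t : R => F t%:C * cauchy_kernel z (conjc z) t +
    F t%:C * cauchy_kernel (conjc z) (conjc w) t)).
  by apply: eq_Cintegral => t _; rewrite /cauchy_kernel -mulrDr; congr (_ * _); ring.
rewrite CintegralD//; last 2 first.
- by apply: (@cintegrable_bounded_cauchy_kernel _ B); rewrite ?(gt_eqF z0) ?(lt_eqF Nz).
- by apply: (@cintegrable_bounded_cauchy_kernel _ B); rewrite ?(lt_eqF Nw) ?(lt_eqF Nz).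
rewrite [X in _ + X](_ : _ = 0) ?addr0; last exact: (cauchy_lower Fd FB Nz Nw).
have -> : (0 +i* (2 * pi)) * F z = (0 +i* 2) * (pi%:C * F z) :> R[i]
  by apply: complex_ext; rewrite !(Re_mul, Im_mul) /=; ring.
rewrite -(poisson_formula Fd FB z0) -CintegralZ//.
  apply: eq_Cintegral => t _; rewrite cauchy_kernelE ?(gt_eqF z0) ?(lt_eqF Nz)//.
  rewrite [RHS]mulrA [LHS]mulrC; congr (_ * _).
  have -> : (t%:C - z) * (t%:C - conjc z) = ((t - complex.Re z) ^+ 2 + complex.Im z ^+ 2)%:C.
    by case: (z) => p q /=; apply: complex_ext;
    rewrite ?(Re_mul, Im_mul, Re_sub, Im_sub) /=; ring.
  rewrite /poisson_kernel rmorphM fmorphV [RHS]mulrA; congr (_ / _).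
  by case: (z) => p q; apply: complex_ext;
    rewrite ?(Re_mul, Im_mul, Re_sub, Im_sub) /=; ring.
apply: (@cintegrable_dominated _ _ _ leb _ _
    (fun t => poisson_kernel (complex.Re z) (complex.Im z) t * B)) => //.
- apply: cmeasurableM => //; split; first exact: measurable_poisson_kernel.
  exact: (@measurable_cst _ _ _ _ setT (0 : R)).
- have := @integrable_poisson_kernel _ (complex.Re z) _ z0.
  move=> /(@integrableZl _ _ _ _ _ measurableT B).
  by apply: eq_integrable => //= t _; rewrite mulrC.
move=> t _; rewrite cabsM cabs_real ger0_norm; last by rewrite ltW// poisson_kernel_gt0.
by rewrite ler_wpM2l// ltW// poisson_kernel_gt0.
Qed.

Lemma Cintegral_conj d (T : measurableType d) (mu : {measure set T -> \bar R})
    D (f : T -> R[i]) : measurable D -> cintegrable mu D f ->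
  Cintegral mu D (fun x => conjc (f x)) = conjc (Cintegral mu D f).
Proof.
move=> mD [_ fi]; apply: complex_ext => /=.
  by apply: eq_Rintegral => x _; case: (f x).
rewrite -mulN1r -RintegralZl//.
by apply: eq_Rintegral => x _; case: (f x) => p q /=; rewrite mulN1r.
Qed.

(** Write [2 i Im F = F - conjc F]. Conjugation turns the kernel for [w], [conjc z] into minus the
    kernel for [z], [conjc w], so the second term is the conjugate of Cauchy's formula with [z] and
    [w] exchanged. *)
Lemma schwarz_formula_bounded F (B : R) (z w : R[i]) :
  (forall w, 0 <= complex.Im w -> cdiff F w) ->
  (forall w, 0 <= complex.Im w -> cabs (F w) <= B) ->
  0 < complex.Im z -> 0 < complex.Im w ->
  Cintegral leb setT (fun t : R =>
    (complex.Im (F t%:C))%:C * cauchy_kernel z (conjc w) t) =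
  pi%:C * (F z - conjc (F w)).
Proof.
move=> Fd FB z0 w0.
have conjIm (u : R[i]) : complex.Im (conjc u) = - complex.Im u by case: u.
have Nz : complex.Im (conjc z) < 0 by rewrite conjIm oppr_lt0.
have Nw : complex.Im (conjc w) < 0 by rewrite conjIm oppr_lt0.
have mF : @cmeasurable _ (measurableTypeR R) _ setT (fun t : R => F t%:C).
  by apply: (@cmeasurable_horizontal _ F 0) => t; apply: cdiff_ccont; exact: Fd.
have FB0 t : cabs (F t%:C) <= B by exact: FB.
have E1 := cauchy_formula Fd FB z0 w0.
have E2 := cauchy_formula Fd FB w0 z0.
have i1 : cintegrable leb setT (fun t : R => F t%:C * cauchy_kernel z (conjc w) t).
  by apply: (@cintegrable_bounded_cauchy_kernel _ B); rewrite ?(gt_eqF z0) ?(lt_eqF Nw).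
have i2 : cintegrable leb setT (fun t : R => F t%:C * cauchy_kernel w (conjc z) t).
  by apply: (@cintegrable_bounded_cauchy_kernel _ B); rewrite ?(gt_eqF w0) ?(lt_eqF Nz).
have i3 : cintegrable leb setT (fun t : R => conjc (F t%:C * cauchy_kernel w (conjc z) t)).
  have [i21 i22] := i2; split.
    by apply: eq_integrable i21 => // t _ /=; case: (_ * _).
  by apply: eq_integrable (integrableN i22) => // t _ /=; case: (_ * _).
have two_i0 : (0 +i* 2 : R[i]) != 0.
  by rewrite eq_complex /= pnatr_eq0 andbF.
apply: (mulfI two_i0); rewrite -CintegralZ//.
  transitivity (Cintegral leb setT (fun t : R => F t%:C * cauchy_kernel z (conjc w) t +
      conjc (F t%:C * cauchy_kernel w (conjc z) t))).
    apply: eq_Cintegral => t _.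
    have -> : conjc (F t%:C * cauchy_kernel w (conjc z) t) =
      - (conjc (F t%:C) * cauchy_kernel z (conjc w) t).
      by rewrite rmorphM /= conj_cauchy_kernel conjcK cauchy_kernelN mulrN.
    rewrite -mulrBl mulrA; congr (_ * _).
    by case: (F _) => p q; apply: complex_ext;
      rewrite ?(Re_mul, Im_mul, Re_sub, Im_sub) /=; ring.
  rewrite CintegralD// Cintegral_conj// E1 E2.
  case: (F w) (F z) => p q [p' q'].
  by apply: complex_ext; rewrite ?(Re_add, Im_add, Re_mul, Im_mul) /=; ring.
apply: (@cintegrable_bounded_cauchy_kernel (fun t => (complex.Im (F t%:C))%:C) B);
    rewrite ?(gt_eqF z0) ?(lt_eqF Nw)//.
  split; first exact: mF.2.
  exact: (@measurable_cst _ _ _ _ setT (0 : R)).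
by move=> t; rewrite cabs_real (le_trans (Im_le_cabs _)).
Qed.

End cauchy_kernel.

(** * Functions with bounded imaginary part *)

Section truncation.
Context {R : realType}.
Notation leb := (@lebesgue_measure R).

Lemma ctends_harmonic (K : R) (u : nat -> R[i]) l :
  (forall n, cabs (u n - l) <= K * harmonic n) -> ctends u l.
Proof.
move=> uK; have /ctendsP H := ctends0_harmonic uK; apply/ctendsP => e /H.
by apply: filterS => n; rewrite subr0.
Qed.

(* [w / (1 + d w^2)] is bounded on a horizontal strip, its imaginary part is
   bounded uniformly in [d], and it tends to [w] as [d] tends to 0: it reduces
   functions with bounded imaginary part to bounded ones. *)
Definition truncation (d : R) (w : R[i]) : R[i] := w / (1 + d%:C * w ^+ 2).

Variables (K d : R) (w : R[i]).
Hypotheses (d0 : 0 < d) (d2 : d <= 2^-1) (dK : d * K ^+ 2 <= 2^-1).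
Hypotheses (w0 : 0 <= complex.Im w) (wK : complex.Im w <= K).

Let a := complex.Re w.
Let b := complex.Im w.
Let q := 1 + d%:C * w ^+ 2.

Let ReqE : complex.Re q = 1 + d * (a ^+ 2 - b ^+ 2).
Proof. by rewrite /q /a /b; case: (w) => s t; rewrite Re_add Re_mul expr2 Re_mul /=; ring. Qed.

Let ImqE : complex.Im q = 2 * d * (a * b).
Proof. by rewrite /q /a /b; case: (w) => s t; rewrite Im_add Im_mul expr2 Im_mul Re_mul /=; ring. Qed.

Let db2 : d * b ^+ 2 <= 2^-1.
Proof.
apply: le_trans dK; apply: ler_wpM2l; first exact: ltW.
by rewrite ler_pXn2r ?nnegrE//; exact: le_trans wK.
Qed.

(** Here [d b ^ 2 <= 1 / 2] keeps the denominator [q] of the truncation away from zero; all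
    estimates on the truncation rest on this bound. *)
Let Req_ge : 2^-1 + d * a ^+ 2 <= complex.Re q.
Proof. rewrite ReqE; have := db2; lra. Qed.

Let da2 : 0 <= d * a ^+ 2.
Proof. exact: mulr_ge0 (ltW d0) (sqr_ge0 _). Qed.

Let q_ge : 2^-1 + d * a ^+ 2 <= cabs q.
Proof. by apply: le_trans Req_ge _; exact: le_trans (ler_norm _) (Re_le_cabs _). Qed.

Let h0 : 0 < 2^-1 + d * a ^+ 2.
Proof. by have := da2; lra. Qed.

Lemma truncation_den_neq0 : q != 0.
Proof. by rewrite -cabs_gt0; exact: lt_le_trans h0 q_ge. Qed.

(** With [c = 1 / 2 + d a ^ 2], the numerator is at most [3 K c] and the denominator at least
    [c ^ 2]; since [c >= 1 / 2], the quotient is at most [6 K], uniformly in [d]. *)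
Lemma Im_truncation_le : `|complex.Im (truncation d w)| <= 6 * K.
Proof.
have q2 : complex.Re q ^+ 2 + complex.Im q ^+ 2 = cabs q ^+ 2 by rewrite cabs_sqr.
have -> : complex.Im (truncation d w) =
    (b - d * (a ^+ 2 + b ^+ 2) * b) / cabs q ^+ 2.
  rewrite /truncation -/q Im_mul Re_inv Im_inv q2 -/a -/b ReqE ImqE.
  have qn0 : cabs q != 0 by rewrite cabs_eq0 truncation_den_neq0.
  by field.
have b0 : 0 <= b by []. have K0 : 0 <= K by exact: le_trans wK.
rewrite normrM [X in _ * X]ger0_norm ?invr_ge0 ?exprn_ge0 ?cabs_ge0//.
have H1 : `|b - d * (a ^+ 2 + b ^+ 2) * b| <= K * (3 * (2^-1 + d * a ^+ 2)).
  have -> : b - d * (a ^+ 2 + b ^+ 2) * b = b * (1 - d * (a ^+ 2 + b ^+ 2)) by ring.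
  rewrite normrM (ger0_norm b0) ler_pM//.
  have := mulr_ge0 (ltW d0) (sqr_ge0 b).
  have := db2; have := da2; rewrite ler_norml => *; apply/andP; split; lra.
have H2 : (cabs q ^+ 2)^-1 <= ((2^-1 + d * a ^+ 2) ^+ 2)^-1.
  rewrite lef_pV2 ?posrE ?exprn_gt0//; last exact: lt_le_trans h0 q_ge.
  by rewrite ler_pXn2r ?nnegrE ?cabs_ge0// ltW.
apply: le_trans (ler_pM _ _ H1 H2) _; rewrite ?normr_ge0 ?invr_ge0 ?exprn_ge0 ?cabs_ge0//.
rewrite mulrC (mulrC K) mulrA ler_wpM2r//.
have -> : ((2^-1 + d * a ^+ 2) ^+ 2)^-1 * (3 * (2^-1 + d * a ^+ 2)) = 3 / (2^-1 + d * a ^+ 2).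
  by move: h0; move: (2^-1 + _) => c c0; field; rewrite gt_eqF.
rewrite ler_pdivrMr//; have := da2; lra.
Qed.

(** This bound blows up as [d] tends to zero, which does no harm: it only serves to apply the
    bounded Schwarz formula for each fixed [d]. *)
Lemma cabs_truncation_le : cabs (truncation d w) <= 2 * K + d^-1.
Proof.
rewrite /truncation -/q cabsM cabsV ler_pdivrMr; last by rewrite cabs_gt0 truncation_den_neq0.
have K0 : 0 <= K by exact: le_trans wK.
have d1 : 0 < d^-1 by rewrite invr_gt0.
apply: le_trans (ler_wpM2l _ q_ge); last by rewrite addr_ge0 ?mulr_ge0// ltW.
apply: le_trans (cabs_le_ReIm _) _; rewrite (ger0_norm w0) mulrDl addrC lerD//.
  apply: le_trans wK _; rewrite -mulrA [X in _ <= 2 * X]mulrC mulrA.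
  by rewrite ler_peMl//; have := da2; lra.
rewrite ler_pdivlMl//.
have : `|complex.Re w| <= 2^-1 * (1 + a ^+ 2).
  have : 0 <= (1 - `|a|) ^+ 2 by exact: sqr_ge0.
  rewrite sqrrB expr1n mul1r real_normK ?num_real// -/a; lra.
move=> /(ler_wpM2l (ltW d0)) /le_trans; apply.
have := da2; have := d2; lra.
Qed.

Lemma truncation_cvg : cabs (truncation d w - w) <= 2 * cabs w ^+ 3 * d.
Proof.
have -> : truncation d w - w = - (d%:C * w ^+ 3) / q.
  rewrite /truncation -/q.
  have := truncation_den_neq0; rewrite /q => ?; field.
  by [].
rewrite cabsM cabsN cabsM cabs_real gtr0_norm// cabsV.
have -> : cabs (w ^+ 3) = cabs w ^+ 3 by rewrite !exprS !cabsM expr0 cabs1.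
rewrite ler_pdivrMr; last by rewrite cabs_gt0 truncation_den_neq0.
have w30 : 0 <= d * cabs w ^+ 3 by exact: mulr_ge0 (ltW d0) (exprn_ge0 _ (cabs_ge0 _)).
have -> : 2 * cabs w ^+ 3 * d * cabs q = (2 * cabs q) * (d * cabs w ^+ 3) by ring.
rewrite ler_peMl//; have := q_ge; have := da2; lra.
Qed.

End truncation.

Section schwarz.
Context {R : realType}.
Notation leb := (@lebesgue_measure R).

Lemma cdiff_truncation (f : R[i] -> R[i]) (K d : R) z : 0 < d -> d <= 2^-1 ->
  d * K ^+ 2 <= 2^-1 -> 0 <= complex.Im (f z) -> complex.Im (f z) <= K ->
  cdiff f z -> cdiff (fun w => truncation d (f w)) z.
Proof.
move=> d0 d2 dK f0 fK fz.
have -> : (fun w => truncation d (f w)) = fun w => f w * (1 + d%:C * (f w * f w))^-1.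
  by apply/funext => w; rewrite /truncation expr2.
apply: (@cdiffM _ f (fun w => (1 + d%:C * (f w * f w))^-1)); first exact: fz.
apply: (@cdiffV _ (fun w => 1 + d%:C * (f w * f w))).
  by rewrite -expr2; exact: (@truncation_den_neq0 _ K).
apply: (@cdiffD _ (fun=> 1) (fun w => d%:C * (f w * f w))); first exact: cdiff_cst.
apply: (@cdiffM _ (fun=> d%:C) (fun w => f w * f w)); first exact: cdiff_cst.
exact: (@cdiffM _ f f _ fz fz).
Qed.

(** The truncations of [f] satisfy the bounded formula and converge pointwise to [f]. Under the
    integral only their imaginary parts occur, and these are dominated by [6 K]. *)
Lemma schwarz_formula (f : R[i] -> R[i]) (K : R) (z w : R[i]) :
  (forall w, 0 <= complex.Im w -> cdiff f w) ->
  (forall w, 0 <= complex.Im w -> 0 <= complex.Im (f w) <= K) ->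
  0 < complex.Im z -> 0 < complex.Im w ->
  Cintegral leb setT (fun t : R =>
    (complex.Im (f t%:C))%:C * cauchy_kernel z (conjc w) t) =
  pi%:C * (f z - conjc (f w)).
Proof.
move=> fd fK z0 w0.
(* The factor makes both [d n] and [d n * K ^ 2] at most [1 / 2], as the truncation requires. *)
pose d n : R := 2^-1 / (1 + K ^+ 2) * harmonic n.
have h0 n : 0 < harmonic n :> R by rewrite /harmonic invr_gt0 ltr0n.
have h1 n : harmonic n <= 1 :> R by rewrite /harmonic invf_le1 ?ltr0n// ler1n.
have c0 : 0 < 2^-1 / (1 + K ^+ 2) :> R by rewrite divr_gt0// oneDsqr_gt0.
have d0 n : 0 < d n by rewrite mulr_gt0.
have dc n : d n <= 2^-1 / (1 + K ^+ 2) by rewrite ler_piMr// ltW.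
have d2 n : d n <= 2^-1.
  by apply: le_trans (dc n) _; rewrite ler_pdivrMr ?oneDsqr_gt0// ler_peMr// lerDl sqr_ge0.
have dK n : d n * K ^+ 2 <= 2^-1.
  apply: le_trans (ler_wpM2r (sqr_ge0 K) (dc n)) _.
  rewrite mulrAC ler_pdivrMr ?oneDsqr_gt0// ler_wpM2l// lerDr//.
have conjIm (u : R[i]) : complex.Im (conjc u) = - complex.Im u by case: u.
have Nw : complex.Im (conjc w) < 0 by rewrite conjIm oppr_lt0.
have Fd n u : 0 <= complex.Im u -> cdiff (fun w => truncation (d n) (f w)) u.
  move=> u0; have /andP[? ?] := fK _ u0.
  exact: (@cdiff_truncation f K _ _ (d0 n) (d2 n) (dK n) _ _ (fd _ u0)).
have FB n u : 0 <= complex.Im u -> cabs (truncation (d n) (f u)) <= 2 * K + (d n)^-1.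
  by move=> u0; have /andP[? ?] := fK _ u0; apply: cabs_truncation_le.
have FI n u : 0 <= complex.Im u -> `|complex.Im (truncation (d n) (f u))| <= 6 * K.
  by move=> u0; have /andP[? ?] := fK _ u0; apply: Im_truncation_le.
have Fc u : 0 <= complex.Im u -> ctends (fun n => truncation (d n) (f u)) (f u).
  move=> u0; have /andP[? ?] := fK _ u0.
  apply: (@ctends_harmonic _ (2 * cabs (f u) ^+ 3 * (2^-1 / (1 + K ^+ 2)))) => n.
  by apply: le_trans (@truncation_cvg _ K _ _ _ _ _ _) _ => //; rewrite mulrA.
have [C C0 HC] := @cauchy_kernel_decay _ z (conjc w) (negbT (gt_eqF z0)) (negbT (lt_eqF Nw)).
have mk := @cmeasurable_cauchy_kernel _ z (conjc w) (negbT (gt_eqF z0)) (negbT (lt_eqF Nw)).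
have mI (F : R[i] -> R[i]) : (forall u, 0 <= complex.Im u -> cdiff F u) ->
    @cmeasurable _ (measurableTypeR R) _ setT (fun t : R => (complex.Im (F t%:C))%:C).
  move=> Fd'; split; last exact: (@measurable_cst _ _ _ _ setT (0 : R)).
  by have [_] := @cmeasurable_horizontal _ F 0 (fun t => cdiff_ccont (Fd' (t +i* 0) (lexx _))).
have [||||||_ H] := @Cintegral_dominated_cvg _ _ _ leb setT
  (fun n (t : R) => (complex.Im (truncation (d n) (f t%:C)))%:C * cauchy_kernel z (conjc w) t)
  (fun t : R => (complex.Im (f t%:C))%:C * cauchy_kernel z (conjc w) t)
  (fun t : R => 6 * K * C / (1 + t ^+ 2)) => //.
- by move=> n; apply: cmeasurableM => //; exact: (mI (fun w => truncation (d n) (f w)) (Fd n)).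
- by apply: cmeasurableM => //; exact: (mI f fd).
- apply: aeW => t _; have [_ H] := Fc t%:C (lexx _).
  split.
    under eq_fun do rewrite Re_mul /= mul0r subr0.
    by rewrite Re_mul /= mul0r subr0; apply: cvgMl.
  under eq_fun do rewrite Im_mul /= mul0r addr0.
  by rewrite Im_mul /= mul0r addr0; apply: cvgMl.
- exact: integrable_inv_oneDsqr.
- by move=> n t _; rewrite cabsM cabs_real -mulrA ler_pM ?cabs_ge0// FI.
apply: ctends_unique H _.
under eq_fun => n do rewrite (schwarz_formula_bounded (Fd n) (FB n) z0 w0).
have [a1 a2] := Fc z (ltW z0); have [b1 b2] := Fc w (ltW w0).
split.
  under eq_fun do rewrite Re_mul /= mul0r subr0 Re_sub.
  rewrite Re_mul /= mul0r subr0 Re_sub; apply: cvgMr; apply: cvgB => //.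
  have conjRe (u : R[i]) : complex.Re (conjc u) = complex.Re u by case: u.
  by under eq_fun do rewrite conjRe; rewrite conjRe.
under eq_fun do rewrite Im_mul /= mul0r addr0 Im_sub conjIm.
rewrite Im_mul /= mul0r addr0 Im_sub conjIm; apply: cvgMr; apply: cvgB => //.
exact: cvgN.
Qed.

End schwarz.

(** * Almost everywhere convergence along a sequence of heights *)

Section complex_exponential.
Context {R : realType}.
Implicit Types z w : R[i].

Lemma expCD z w : expC (z + w) = expC z * expC w.
Proof.
apply: complex_ext; rewrite ?Re_mul ?Im_mul /= Re_add Im_add expRD ?cosD ?sinD; ring.
Qed.

Lemma cabs_expC z : cabs (expC z) = expR (complex.Re z).
Proof.
by rewrite /= !exprMn -mulrDr cos2Dsin2 mulr1 sqrtr_sqr ger0_norm//.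
Qed.

Lemma is_derive_linear_approx (f : R -> R) (x l : R) : is_derive x 1 f l ->
  forall e : R, 0 < e -> exists2 d : R, 0 < d & forall h, `|h| < d ->
    `|f (x + h) - f x - l * h| <= e * `|h|.
Proof.
move=> [/cvg_ex[m Hm] fl] e e0.
have ml : m = l by rewrite -fl; apply/esym/cvg_lim; [|exact: Hm].
move: Hm; rewrite ml => /cvgrPdist_le /(_ _ e0) /nbhs_ballP[d /= d0 dP].
exists d => // h hd; have [->|h0] := eqVneq h 0.
  by rewrite addr0 subrr mulr0 subrr normr0 mulr0.
have := dP h; rewrite -ball_normE /= sub0r normrN => /(_ hd h0).
rewrite [_ *: 1]mulr1 (addrC h x) => H.
rewrite -(ler_pM2r (_ : 0 < `|h|)) ?normr_gt0// -normrM in H.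
apply: le_trans H; rewrite -normrN opprB mulrBl /GRing.scale /= mulrAC mulVf// mul1r.
exact: lexx.
Qed.

Lemma cdiff_expC0 : cdiff (@expC R) 0.
Proof.
have E0 : expC 0 = 1 :> R[i].
  by apply: complex_ext; rewrite /= expR0 ?cos0 ?sin0 mul1r.
apply/cdiffP; exists 1 => e e0.
(* The errors below add up to [9 e' c]: [3 + 1] from the real part and [3 + 2] from the imaginary
   part. *)
have [e' [e'0 e'1 e'8]] : exists e' : R, [/\ 0 < e', e' <= 1 & e' <= e / 16].
  by exists (Num.min 1 (e / 16)); rewrite lt_min ltr01 divr_gt0// !ge_min !lexx orbT.
have [d1 d10 H1] := @is_derive_linear_approx expR 0 1
  (is_derive_eq (is_derive_expR 0) (expR0 R)) _ e'0.
have [d2 d20 H2] := @is_derive_linear_approx cos 0 0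
  (is_derive_eq (is_derive_cos 0) (etrans (congr1 -%R (sin0 R)) (oppr0 _))) _ e'0.
have [d3 d30 H3] := @is_derive_linear_approx sin 0 1
  (is_derive_eq (is_derive_sin 0) (cos0 R)) _ e'0.
exists (Num.min e' (Num.min d1 (Num.min d2 d3))).
  by rewrite !lt_min e'0 d10 d20 d30.
move=> w; rewrite subr0 mul1r E0 !lt_min => /and4P[we w1 w2 w3].
case: w we w1 w2 w3 => x y we w1 w2 w3.
have xw : `|x| <= cabs (x +i* y) := Re_le_cabs (x +i* y).
have yw : `|y| <= cabs (x +i* y) := Im_le_cabs (x +i* y).
set E := expC _ - _ - _.
move: (cabs (x +i* y)) we w1 w2 w3 xw yw => c we w1 w2 w3 xw yw.
have := H1 x (le_lt_trans xw w1); have := H2 y (le_lt_trans yw w2).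
have := H3 y (le_lt_trans yw w3).
rewrite !add0r expR0 cos0 sin0 mul0r !mul1r !subr0 => K3 K2 K1.
have c0 : 0 <= c by exact: le_trans (normr_ge0 _) xw.
have X1 : `|expR x - 1| <= 2 * c.
  rewrite -(subrK x (expR x - 1)); apply: le_trans (ler_normD _ _) _.
  rewrite mulr2n mulrDl mul1r lerD//; apply: le_trans K1 _.
  by rewrite -[leRHS]mul1r ler_pM// ltW.
have X2 : `|expR x| <= 3.
  rewrite -(subrK 1 (expR x)); apply: le_trans (ler_normD _ _) _.
  rewrite normr1; lra.
apply: le_trans (cabs_le_ReIm _) _; rewrite /E !Re_sub !Im_sub /= subr0.
have -> : expR x * cos y - 1 - x = expR x * (cos y - 1) + (expR x - 1 - x) by ring.
have -> : expR x * sin y - y = expR x * (sin y - y) + (expR x - 1) * y by ring.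
have ec : e' * c <= e / 16 * c by rewrite ler_wpM2r.
have y1 : `|cos y - 1| <= e' * c by apply: le_trans K2 _; rewrite ler_wpM2l// ltW.
have y2 : `|sin y - y| <= e' * c by apply: le_trans K3 _; rewrite ler_wpM2l// ltW.
have y3 : `|expR x - 1 - x| <= e' * c by apply: le_trans K1 _; rewrite ler_wpM2l// ltW.
have z1 : `|expR x * (cos y - 1)| <= 3 * (e' * c) by rewrite normrM ler_pM.
have z2 : `|expR x * (sin y - y)| <= 3 * (e' * c) by rewrite normrM ler_pM.
have z3 : `|(expR x - 1) * y| <= 2 * c * e'.
  rewrite normrM ler_pM//; apply: le_trans yw _; exact: ltW.
have := ler_normD (expR x * (cos y - 1)) (expR x - 1 - x).
have := ler_normD (expR x * (sin y - y)) ((expR x - 1) * y).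
move: ec z1 z2 z3 y3 (mulr_ge0 (ltW e0) c0); lra.
Qed.

Lemma cdiff_expC z : cdiff (@expC R) z.
Proof.
have -> : @expC R = fun w => expC z * expC (w - z).
  by apply/funext => w; rewrite -expCD addrC subrK.
apply: (@cdiffM _ (fun=> expC z) (fun w => expC (w - z))).
  exact: cdiff_cst.
apply: (@cdiff_comp _ (fun w => w - z) (@expC R)).
  by apply: cdiffB; [exact: cdiff_id|exact: cdiff_cst].
by rewrite subrr; exact: cdiff_expC0.
Qed.

End complex_exponential.

Section real_sequences.
Context {R : realType}.

(** If [N b > N a], midpoint convexity makes the increments of [N] along [a + k (b - a)]
    nondecreasing in [k], so [N] grows at least linearly there and exceeds [M]. *)
Lemma midconvex_bounded_nonincreasing (N : R -> R) (M : R) :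
  (forall x y, 0 < x -> 0 < y -> 2 * N ((x + y) / 2) <= N x + N y) ->
  (forall x, 0 < x -> N x <= M) ->
  forall a b, 0 < a -> a <= b -> N b <= N a.
Proof.
move=> Nmid NM a b a0 ab; rewrite leNgt; apply/negP => Nab.
have d0 : 0 <= b - a by rewrite subr_ge0.
pose c k := N (a + k%:R * (b - a)).
have pos k : 0 < a + k%:R * (b - a) by rewrite ltr_pwDl// mulr_ge0.
have step k : c k.+1 - c k <= c k.+2 - c k.+1.
  have := Nmid _ _ (pos k) (pos k.+2).
  have -> : (a + k%:R * (b - a) + (a + k.+2%:R * (b - a))) / 2 = a + k.+1%:R * (b - a).
    by rewrite -[in LHS]addn2 -[in RHS]addn1 !natrD; field.
  by rewrite -/(c k) -/(c k.+1) -/(c k.+2); lra.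
have incr k : N b - N a <= c k.+1 - c k.
  elim: k => [|k IH]; last exact: le_trans IH (step k).
  by rewrite /c mul1r mul0r addr0 (addrC a) subrK.
have lin k : N a + k%:R * (N b - N a) <= c k.
  elim: k => [|k IH]; first by rewrite /c !mul0r !addr0.
  rewrite -addn1 natrD mulrDl mul1r addrA addn1.
  have := incr k; lra.
have h0 : 0 < N b - N a by rewrite subr_gt0.
have := lin (Num.truncn ((M - N a) / (N b - N a))).+1.
apply/negP; rewrite -ltNge; apply: le_lt_trans (NM _ (pos _)) _.
by rewrite -ltrBlDl -ltr_pdivrMr// truncnS_gt.
Qed.

Lemma cvg_of_summable_increments (u v : nat -> R) (M : R) :
  (forall n, `|u n.+1 - u n| <= v n) -> (forall n, \sum_(0 <= k < n) v k <= M) ->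
  cvgn u.
Proof.
move=> uv vM.
have uE : u = (fun n => series (telescope u) n + u 0%N).
  by apply/funext => n; rewrite (congr1 (@^~ n) (telescopeK u)) /= subrK.
rewrite uE; apply: is_cvgD; last exact: is_cvg_cst.
apply: normed_cvg; apply: nondecreasing_is_cvgn.
  by apply: nondecreasing_series => n _ _; exact: normr_ge0.
exists M => _ [n _ <-]; apply: le_trans (vM n).
by rewrite /series /=; apply: ler_sum => k _; exact: uv.
Qed.

End real_sequences.

(** * Square integrals along horizontal lines *)

Section square_integrals.
Context {R : realType}.
Notation leb := (@lebesgue_measure R).
Variable h : R[i] -> R[i].
Hypothesis hd : forall z, 0 < complex.Im z -> cdiff h z.
Hypothesis h1 : forall z, 0 < complex.Im z -> cabs (h z) <= 1.

(* For [y' < y], shifting the line of integration shows that the integral of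
   [H (t + iy) * conj (H (t + iy'))] depends only on [y + y'], so that
   [|H_y - H_y'|^2 = N y + N y' - 2 N ((y + y') / 2)] for the squared L^2 norms
   [N]; hence [N] is midpoint convex and, being bounded, nonincreasing. *)
Let H z := h z / (z + (0 +i* 1)).

Let den_neq0 (z : R[i]) : 0 < complex.Im z -> z + (0 +i* 1) != 0.
Proof.
move=> z0; apply/eqP => /(congr1 (@complex.Im R)); rewrite Im_add /= => /eqP.
by rewrite gt_eqF// addr_gt0.
Qed.

Let Hd z : 0 < complex.Im z -> cdiff H z.
Proof.
move=> z0; apply: (@cdiffM _ h (fun z => (z + (0 +i* 1))^-1)); first exact: hd.
apply: (@cdiffV _ (fun z => z + (0 +i* 1))); first exact: den_neq0.
by apply: cdiffD; [exact: cdiff_id|exact: cdiff_cst].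
Qed.

Let sq z : R := complex.Re z ^+ 2 + complex.Im z ^+ 2.

Let H_le z : 0 < complex.Im z -> sq (H z) <= (1 + complex.Re z ^+ 2)^-1.
Proof.
move=> z0; rewrite /sq -cabs_sqr cabsM cabsV exprMn exprVn.
rewrite -[leRHS]mul1r ler_pM ?sqr_ge0 ?invr_ge0 ?sqr_ge0//.
  by rewrite exprn_ile1 ?cabs_ge0// h1.
rewrite lef_pV2 ?posrE ?oneDsqr_gt0 ?exprn_gt0 ?cabs_gt0 ?den_neq0//.
rewrite cabs_sqr Re_add Im_add /= addr0 addrC lerD2l sqrrD expr1n mulr1.
by rewrite lerDr addr_ge0 ?sqr_ge0// mulrn_wge0// ltW.
Qed.

Let H_cabs_le z : 0 < complex.Im z -> cabs (H z) ^+ 2 <= (1 + complex.Re z ^+ 2)^-1.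
Proof. by move=> z0; rewrite cabs_sqr; exact: H_le. Qed.

Let mH (y : R) : 0 < y -> @cmeasurable _ (measurableTypeR R) _ setT (fun t => H (t +i* y)).
Proof.
by move=> y0; apply: cmeasurable_horizontal => t; apply: cdiff_ccont; exact: Hd.
Qed.

Let N y := \int[leb]_t sq (H (t +i* y)).

Let cross (y y' t : R) : R := complex.Re (H (t +i* y) * conjc (H (t +i* y'))).

Let prod_le (y y' t : R) : 0 < y -> 0 < y' ->
  cabs (H (t +i* y) * conjc (H (t +i* y'))) <= 1 / (1 + t ^+ 2).
Proof.
move=> y0 y'0; rewrite cabsM cabs_conj mul1r.
have := @H_cabs_le (t +i* y) y0; have := @H_cabs_le (t +i* y') y'0 => /=.
move: (cabs _) (cabs _) => c c' H1 H2.
have := sqr_ge0 (c - c'); rewrite sqrrB; lra.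
Qed.

Let msq y : 0 < y -> measurable_fun setT (fun t : measurableTypeR R => sq (H (t +i* y))).
Proof.
by move=> /mH[m1 m2]; apply: measurable_funD; exact: measurable_funX.
Qed.

Let isq y : 0 < y -> leb.-integrable setT (EFin \o (fun t => sq (H (t +i* y)))).
Proof.
move=> y0; apply: (integrable_dominated _ _ (integrable_inv_oneDsqr 1)) => //.
  exact: msq.
move=> t _; rewrite ger0_norm ?addr_ge0 ?sqr_ge0// mul1r.
exact: (@H_le (t +i* y)).
Qed.

Let mcross y y' : 0 < y -> 0 < y' ->
  @cmeasurable _ (measurableTypeR R) _ setT (fun t => H (t +i* y) * conjc (H (t +i* y'))).
Proof.
move=> y0 y'0; apply: cmeasurableM; first exact: mH.
have [m1 m2] := mH y'0; split.
  by apply: eq_measurable_fun m1 => t _ /=; case: (H _).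
by apply: eq_measurable_fun (measurable_funN m2) => t _ /=; case: (H _).
Qed.

Let icross y y' : 0 < y -> 0 < y' -> leb.-integrable setT (EFin \o cross y y').
Proof.
move=> y0 y'0; apply: (integrable_dominated _ _ (integrable_inv_oneDsqr 1)) => //.
  exact: (mcross y0 y'0).1.
move=> t _; apply: le_trans (Re_le_cabs _) _; exact: prod_le.
Qed.

Let crossE y y' : 0 < y' -> y' <= y ->
  \int[leb]_t cross y y' t = N ((y + y') / 2).
Proof.
move=> y'0 yy'; have y0 : 0 < y by exact: lt_le_trans yy'.
set m := (y + y') / 2; set s := (y - y') / 2.
have s0 : 0 <= s by rewrite divr_ge0// subr_ge0.
have sm : s < m by rewrite /s /m; lra.
have m0 : 0 < m by exact: le_lt_trans sm.
(* Holomorphic for [|Im z| < m], hence on the strip from 0 to [s < m]. At height [s] the two factors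
   sit at heights [m + s = y] and [m - s = y']; at height 0 the product is the squared modulus at
   height [m]. *)
pose G z := H (z + (0 +i* m)) * conjc (H (conjc z + (0 +i* m))).
have := @contour_shift _ G 1 0 s s0.
have -> : (fun t => G (t +i* s)) = fun t => H (t +i* y) * conjc (H (t +i* y')).
  apply/funext => t; rewrite /G; congr (H _ * conjc (H _));
  by apply: complex_ext; rewrite ?(Re_add, Im_add) /= ?addr0// /s /m; field.
have -> : (fun t => G (t +i* 0)) = fun t => (sq (H (t +i* m)))%:C.
  apply/funext => t; rewrite /G.
  have -> : (t +i* 0) + (0 +i* m) = t +i* m :> R[i] by apply: complex_ext; rewrite /= ?addr0 ?add0r.
  have -> : conjc (t +i* 0) + (0 +i* m) = t +i* m :> R[i].
    by apply: complex_ext; rewrite /= ?addr0 ?oppr0 ?add0r.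
  rewrite /sq; case: (H _) => p q; apply: complex_ext; rewrite ?(Re_mul, Im_mul) /=; ring.
move=> /(_ _ _)/(congr1 (@complex.Re R)) /= E; rewrite /N -E//.
  move=> z /andP[z0 zs]; apply: (@cdiffM _ (fun z => H (z + (0 +i* m)))
     (fun z => conjc (H (conjc z + (0 +i* m))))).
    apply: (@cdiff_comp _ (fun z => z + (0 +i* m)) H).
      by apply: cdiffD; [exact: cdiff_id|exact: cdiff_cst].
    by apply: Hd; rewrite Im_add /= ltr_wpDl.
  apply: (@cdiff_conj _ (fun z => H (z + (0 +i* m)))).
  apply: (@cdiff_comp _ (fun z => z + (0 +i* m)) H).
    by apply: cdiffD; [exact: cdiff_id|exact: cdiff_cst].
  apply: Hd; rewrite Im_add /=; case: (z) z0 zs => p q /= q0 qs; lra.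
move=> t q /andP[q0 qs]; rewrite /G.
have -> : (t +i* q) + (0 +i* m) = t +i* (q + m) :> R[i] by apply: complex_ext; rewrite /= ?addr0.
have -> : conjc (t +i* q) + (0 +i* m) = t +i* (m - q) :> R[i].
  by apply: complex_ext; rewrite /= ?addr0// addrC.
by apply: prod_le; lra.
Qed.

Let dist2E (u v : R[i]) : sq (u - v) = sq u + sq v - 2 * complex.Re (u * conjc v).
Proof. by rewrite /sq; case: u v => a b [c d]; rewrite Re_sub Im_sub Re_mul /=; ring. Qed.

Let D y y' := \int[leb]_t sq (H (t +i* y) - H (t +i* y')).

Let DE y y' : 0 < y' -> y' <= y -> D y y' = N y + N y' - 2 * N ((y + y') / 2).
Proof.
move=> y'0 yy'; have y0 : 0 < y by exact: lt_le_trans yy'.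
rewrite -crossE// -RintegralZl//; last exact: icross.
rewrite /N -RintegralD//; [|exact: isq..].
rewrite -RintegralB//.
- by apply: eq_Rintegral => t _; rewrite dist2E.
- have := integrableD measurableT (isq y0) (isq y'0).
  by apply: eq_integrable.
- have := integrableZl measurableT 2 (icross y0 y'0).
  by apply: eq_integrable.
Qed.

Let DC y y' : D y y' = D y' y.
Proof. by apply: eq_Rintegral => t _; rewrite -[in LHS]opprB /sq Re_opp Im_opp !sqrrN. Qed.

Let D_ge0 y y' : 0 <= D y y'.
Proof. by apply: Rintegral_ge0 => t _; rewrite addr_ge0 ?sqr_ge0. Qed.

Let DE' y y' : 0 < y -> 0 < y' -> D y y' = N y + N y' - 2 * N ((y + y') / 2).
Proof.
move=> y0 y'0; have [yy'|/ltW yy'] := leP y' y; first exact: DE.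
by rewrite DC DE// (addrC (N y')) (addrC y').
Qed.

Let N_le y : 0 < y -> N y <= pi.
Proof.
move=> y0; have := @integral_inv_oneDsqr R => E.
have -> : pi = \int[leb]_t (1 / (1 + t ^+ 2)) :> R.
  by rewrite /Rintegral; under eq_integral do rewrite mul1r; rewrite E.
apply: le_Rintegral => //; first exact: isq.
  exact: integrable_inv_oneDsqr.
by move=> t _; rewrite mul1r; exact: (@H_le (t +i* y)).
Qed.

Let N_noninc a b : 0 < a -> a <= b -> N b <= N a.
Proof.
apply: (@midconvex_bounded_nonincreasing _ N pi) => [x y x0 y0|]; last exact: N_le.
by rewrite -subr_ge0 -DE'.
Qed.

(** As [N] is bounded and nonincreasing, its supremum [S] is approached at small heights. If [N] is
    within [4^-n] of [S] at two heights, it is so at their midpoint, and the distance formula gives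
    at most [2 S - 2 (S - 4^-n)]. *)
Lemma fast_cauchy_sequence : exists e : nat -> R,
  (forall n, 0 < e n <= harmonic n) /\
  forall n, D (e n.+1) (e n) <= 2 * 4^-1 ^+ n.
Proof.
pose S := sup [set N y | y in [set y | 0 < y]].
have hs : has_sup [set N y | y in [set y | 0 < y]].
  split; first by exists (N 1), 1 => /=.
  by exists pi => _ [y /= y0 <-]; exact: N_le.
have SN y : 0 < y -> N y <= S by move=> y0; apply: ub_le_sup; [exact: hs.2|exists y].
have ex n : exists e : R, (0 < e <= harmonic n) /\ S - 4^-1 ^+ n < N e.
  have p0 : 0 < 4^-1 ^+ n :> R by rewrite exprn_gt0// invr_gt0.
  have [_ [y /= y0 <-] Hy] := sup_adherent p0 hs.
  have h0 : 0 < harmonic n :> R by rewrite /harmonic invr_gt0 ltr0n.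
  (* Lowering the height to at most [harmonic n] can only increase [N]. *)
  exists (Num.min y (harmonic n)); split; first by rewrite lt_min y0 h0 ge_min lexx orbT.
  apply: lt_le_trans Hy _; apply: N_noninc; first by rewrite lt_min y0 h0.
  by rewrite ge_min lexx.
have [e He] := choice ex.
exists e; split; first by move=> n; have [] := He n.
move=> n; have [/andP[a0 _] a1] := He n; have [/andP[b0 _] b1] := He n.+1.
rewrite DE'//.
have m0 : 0 < (e n.+1 + e n) / 2 by lra.
have Sm : S - 4^-1 ^+ n <= N ((e n.+1 + e n) / 2).
  have [ab|/ltW ba] := leP (e n) (e n.+1).
    apply: le_trans (_ : N (e n.+1) <= _).
      apply: le_trans (ltW b1); rewrite lerD2l lerN2 exprS ler_piMl ?exprn_ge0 ?invr_ge0//.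
      by rewrite invf_le1// ler1n.
    by apply: N_noninc => //; lra.
  apply: le_trans (ltW a1) _; apply: N_noninc => //; lra.
have := SN _ a0; have := SN _ b0; lra.
Qed.

Lemma half_power_sum n : \sum_(0 <= k < n) 2 * 2^-1 ^+ k <= 4 :> R.
Proof.
suff -> : \sum_(0 <= k < n) 2 * 2^-1 ^+ k = 4 - 4 * 2^-1 ^+ n :> R.
  by rewrite gerBl mulr_ge0// exprn_ge0// invr_ge0.
elim: n => [|n IH]; first by rewrite big_geq// expr0 mulr1 subrr.
by rewrite big_nat_recr//= IH exprS; field.
Qed.

Lemma ctendsM (u v : nat -> R[i]) l m : ctends u l -> ctends v m ->
  ctends (fun n => u n * v n) (l * m).
Proof.
move=> [u1 u2] [v1 v2]; split.
  by under eq_fun do rewrite Re_mul; rewrite Re_mul; apply: cvgB; exact: cvgM.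
by under eq_fun do rewrite Im_mul; rewrite Im_mul; apply: cvgD; exact: cvgM.
Qed.

(** The squared successive differences of [H], weighted by [2 ^ n], have integrals at most
    [2 * 2^-n], so their sum is integrable and almost everywhere finite. Where it is finite the
    differences themselves are summable; multiplying by [z + i] passes from [H] back to [h]. *)
Lemma ae_cvg_along_sequence : exists e : nat -> R,
  (forall n, 0 < e n <= harmonic n) /\
  {ae leb, forall t, exists l, ctends (fun n => h (t +i* e n)) l}.
Proof.
have [e [e0 eD]] := fast_cauchy_sequence; exists e; split => //.
have ep n : 0 < e n by have /andP[] := e0 n.
pose g n (t : measurableTypeR R) : R := 2 ^+ n * sq (H (t +i* e n.+1) - H (t +i* e n)).
have mg n : measurable_fun setT (g n).
  apply: measurable_funM; first exact: measurable_cst.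
  have [a1 a2] := mH (ep n.+1); have [b1 b2] := mH (ep n).
  apply: measurable_funD; apply: measurable_funX.
    by apply: eq_measurable_fun (measurable_funB a1 b1) => t _ /=; rewrite Re_sub.
  by apply: eq_measurable_fun (measurable_funB a2 b2) => t _ /=; rewrite Im_sub.
have g0 n t : 0 <= g n t.
  by rewrite mulr_ge0 ?exprn_ge0// addr_ge0 ?sqr_ge0.
have iD n : leb.-integrable setT (EFin \o (fun t => sq (H (t +i* e n.+1) - H (t +i* e n)))).
  have i1 := integrableD measurableT (isq (ep n.+1)) (isq (ep n)).
  have i2 := integrableZl measurableT 2 (icross (ep n.+1) (ep n)).
  apply: eq_integrable (integrableB measurableT i1 i2) => // t _ /=.
  by rewrite dist2E.
have ig n : (\int[leb]_t (g n t)%:E <= (2 * 2^-1 ^+ n)%:E)%E.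
  rewrite (_ : \int[leb]_t (g n t)%:E = (2 ^+ n * D (e n.+1) (e n))%:E)%E.
    rewrite lee_fin; apply: le_trans (ler_wpM2l (exprn_ge0 _ _) (eD n)) _ => //.
    rewrite mulrCA ler_wpM2l// -exprMn le_eqVlt; apply/orP; left; apply/eqP.
    by congr (_ ^+ _); field.
  rewrite EFinM /D /Rintegral fineK; last exact: integrable_fin_num (iD n).
  by rewrite -integralZl//; exact: iD.
pose F t := (\sum_(n <oo) (g n t)%:E)%E.
have mF : measurable_fun setT F.
  apply: ge0_emeasurable_sum => n; last by move=> _; apply/measurable_EFinP; exact: mg.
  by move=> t _ _; rewrite lee_fin.
have iF : leb.-integrable setT F.
  apply/integrableP; split => //.
  have -> : (\int[leb]_x `|F x| = \int[leb]_x F x)%E.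
    apply: eq_integral => t _; rewrite gee0_abs//.
    by apply: nneseries_ge0 => n _ _; rewrite lee_fin.
  rewrite /F integral_nneseries//; last 2 first.
  - by move=> n; apply/measurable_EFinP; exact: mg.
  - by move=> n t _; rewrite lee_fin.
  apply: le_lt_trans (_ : _ <= 4%:E)%E _; last exact: ltry.
  apply: lime_le.
    by apply: is_cvg_nneseries => n _ _; apply: integral_ge0 => t _; rewrite lee_fin.
  apply: nearW => n; apply: le_trans (_ : (\sum_(0 <= k < n) (2 * 2^-1 ^+ k)%:E <= _)%E).
    by apply: lee_sum => k _; exact: ig.
  by rewrite sumEFin lee_fin half_power_sum.
have aeF : Filter (nbhs (almost_everywhere leb)) := ae_filter_ringOfSetsType leb.
apply: filterS (integrable_ae measurableT iF) => t /(_ I) Ft.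
have partial n : \sum_(0 <= k < n) g k t <= fine (F t).
  rewrite -lee_fin fineK// -sumEFin.
  by apply: nneseries_lim_ge => k _ _; rewrite lee_fin.
(* Either [|x| <= 2^-n], or [2 ^ n * |x| > 1] and then [|x| <= 2 ^ n * |x| ^ 2]. The factors
   [2^-1 * 2] match the summand of [half_power_sum]. *)
have amgm n (x : R) : `|x| ^+ 2 <= sq (H (t +i* e n.+1) - H (t +i* e n)) ->
    `|x| <= 2^-1 * (2 * 2^-1 ^+ n) + g n t.
  move=> xs; rewrite mulrA mulVf// mul1r.
  have p0 : 0 < 2 ^+ n :> R by rewrite exprn_gt0.
  have [xn|/ltW xn] := leP `|x| (2^-1 ^+ n).
    by apply: le_trans xn _; rewrite lerDl.
  apply: le_trans (_ : 2 ^+ n * `|x| ^+ 2 <= _).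
    rewrite expr2 mulrA ler_peMl//.
    by rewrite -ler_pdivrMl// mulr1 -exprVn.
  apply: le_trans (_ : g n t <= _); first by rewrite ler_wpM2l// ltW.
  by rewrite lerDr exprn_ge0// invr_ge0.
have bound n : \sum_(0 <= k < n) (2^-1 * (2 * 2^-1 ^+ k) + g k t) <= 2^-1 * 4 + fine (F t).
  rewrite big_split /= -mulr_sumr lerD// ler_wpM2l ?invr_ge0//; exact: half_power_sum.
have cR : cvgn (fun n => complex.Re (H (t +i* e n))).
  apply: (cvg_of_summable_increments _ bound) => n; apply: amgm.
  by rewrite -Re_sub real_normK ?num_real// lerDl sqr_ge0.
have cI : cvgn (fun n => complex.Im (H (t +i* e n))).
  apply: (cvg_of_summable_increments _ bound) => n; apply: amgm.
  by rewrite -Im_sub real_normK ?num_real// lerDr sqr_ge0.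
have e_to0 : e n @[n --> \oo] --> (0 : R).
  apply: (squeeze_cvgr _ (@cvg_cst _ (0 : R) _ _ _) (@cvg_harmonic R)).
  by apply: nearW => n; have /andP[/ltW -> ->] := e0 n.
exists (((limn (fun n => complex.Re (H (t +i* e n)))) +i*
        (limn (fun n => complex.Im (H (t +i* e n))))) * (t +i* (0 + 1))).
have -> : (fun n => h (t +i* e n)) = fun n => H (t +i* e n) * (t +i* (e n + 1)).
  apply/funext => n; rewrite /H.
  have -> : t +i* (e n + 1) = (t +i* e n) + (0 +i* 1).
    by apply: complex_ext; rewrite /= ?addr0.
  by rewrite divfK// den_neq0//= ep.
apply: ctendsM; first by split.
by split; [exact: cvg_cst | apply: cvgD => //; exact: cvg_cst].
Qed.

End square_integrals.

Section boundary_sequence.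
Context {R : realType}.
Notation leb := (@lebesgue_measure R).

(** For [h = e^(if)] the lower bound [e^(-K)] on [|h|] persists in the limit, so the logarithm is
    continuous there and [Im f = - ln (|h| ^ 2) / 2] converges. *)
Lemma Im_ae_cvg_along_sequence (f : R[i] -> R[i]) (K : R) :
  (forall z, 0 < complex.Im z -> cdiff f z) ->
  (forall z, 0 < complex.Im z -> 0 <= complex.Im (f z) <= K) ->
  exists e : nat -> R, (forall n, 0 < e n <= harmonic n) /\
  {ae leb, forall t, cvgn (fun n => complex.Im (f (t +i* e n)))}.
Proof.
move=> fd fK; pose h z := expC ((0 +i* 1) * f z).
have hE z : cabs (h z) = expR (- complex.Im (f z)).
  by rewrite cabs_expC Re_mul /= mul0r sub0r mul1r.
have [|| e [e0 He]] := @ae_cvg_along_sequence _ h.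
- move=> z z0; apply: (@cdiff_comp _ (fun z => (0 +i* 1) * f z) (@expC R)).
    by apply: (@cdiffM _ (fun=> 0 +i* 1) f); [exact: cdiff_cst | exact: fd].
  exact: cdiff_expC.
- move=> z z0; rewrite hE -expR0 ler_expR oppr_le0.
  by have /andP[] := fK z z0.
have aeF : Filter (nbhs (almost_everywhere leb)) := ae_filter_ringOfSetsType leb.
exists e; split => //; apply: filterS He => t [l [l1 l2]].
have ep n : 0 < e n by have /andP[] := e0 n.
have cn : cabs (h (t +i* e n)) ^+ 2 @[n --> \oo] --> cabs l ^+ 2.
  under eq_fun do rewrite cabs_sqr.
  by rewrite cabs_sqr; apply: cvgD; apply: cvgM.
have lK : expR (- K) ^+ 2 <= cabs l ^+ 2.
  apply: (closed_cvg (fun x => expR (- K) ^+ 2 <= x)) cn; first exact: closed_ge.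
  apply: nearW => n; rewrite ler_pXn2r ?nnegrE ?expR_ge0 ?cabs_ge0// hE ler_expR lerN2.
  by have /andP[] := fK (t +i* e n) (ep n).
have l0 : 0 < cabs l ^+ 2 by apply: lt_le_trans lK; rewrite exprn_gt0// expR_gt0.
have H : ln (cabs (h (t +i* e n)) ^+ 2) @[n --> \oo] --> ln (cabs l ^+ 2).
  by apply: (cvg_comp _ _ cn); exact: continuous_ln.
apply/cvg_ex; exists (- 2^-1 * ln (cabs l ^+ 2)).
have -> : (fun n => complex.Im (f (t +i* e n))) =
   fun n => - 2^-1 * ln (cabs (h (t +i* e n)) ^+ 2).
  apply/funext => n; by rewrite hE -expRM_natl expRK; field.
by apply: cvgMr.
Qed.

End boundary_sequence.

(** * Fatou's theorem and the boundary representation *)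

Section fatou.
Context {R : realType}.
Notation leb := (@lebesgue_measure R).
Variables (u : R -> R) (K : R).
Hypothesis mu : measurable_fun setT (u : measurableTypeR R -> R).
Hypothesis u0 : forall t, 0 <= u t.
Hypothesis uK : forall t, u t <= K.

Let K0 : 0 <= K. Proof. exact: le_trans (u0 0) (uK 0). Qed.

Let dist_le (s t : R) : `|u s - u t| <= K.
Proof.
rewrite ler_norml; have := u0 s; have := u0 t; have := uK s; have := uK t; lra.
Qed.

Lemma locally_integrable_bounded : locally_integrable setT u.
Proof.
split => //; first exact: openT.
move=> A _ cA; have mA : measurable (A : set (measurableTypeR R)) by exact: compact_measurable.
apply: (@le_lt_trans _ _ (\int[leb]_(x in A) (cst K%:E x))%E).
  apply: ge0_le_integral => //.
  - by apply/measurable_EFinP; apply: measurableT_comp => //; exact: measurable_funS mu.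
  - by move=> x _; rewrite lee_fin ger0_norm.
rewrite integral_cst//; apply: lte_mul_pinfty => //.
exact: compact_finite_measure.
Qed.

(* Bounds the Poisson kernel by its maximum near [x] and by a kernel of larger
   height elsewhere; at a Lebesgue point this gives Fatou's theorem without
   decomposing the kernel into dyadic shells. *)
Lemma poisson_kernel_split (x y M t : R) : 0 < y -> 0 < M ->
  poisson_kernel x y t <=
  y^-1 * (if t \in (ball x (M * y) : set R) then 1 else 0) + 2 / M * poisson_kernel x (M * y) t.
Proof.
move=> y0 M0; have My0 : 0 < M * y by rewrite mulr_gt0.
have p0 := @poisson_kernel_gt0 _ x (M * y) t My0.
have d0 : 0 < (t - x) ^+ 2 + y ^+ 2 by rewrite ltr_wpDl ?sqr_ge0// exprn_gt0.
have D0 : 0 < (t - x) ^+ 2 + (M * y) ^+ 2 by rewrite ltr_wpDl ?sqr_ge0// exprn_gt0.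
case: ifPn => [_|].
  rewrite mulr1; apply: le_trans (_ : y^-1 <= _).
    rewrite /poisson_kernel ler_pdivrMr// mulrDr -{1}[y]mulr1.
    have -> : y^-1 * y ^+ 2 = y by rewrite expr2 mulKf// gt_eqF.
    by rewrite mulr1 lerDr mulr_ge0 ?sqr_ge0// invr_ge0 ltW.
  by rewrite lerDl mulr_ge0 ?divr_ge0// ltW.
move/negP; rewrite inE /= -ball_normE /= => /negP; rewrite -leNgt => tx.
rewrite mulr0 add0r /poisson_kernel mulrA.
have -> : 2 / M * (M * y) = 2 * y by field; rewrite gt_eqF.
rewrite ler_pdivrMr// mulrAC ler_pdivlMr//.
have : (M * y) ^+ 2 <= (t - x) ^+ 2.
  rewrite -(real_normK (num_real (t - x))) distrC ler_pXn2r ?nnegrE//; exact: ltW.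
move=> /(ler_wpM2l (ltW y0)).
have : 0 <= y * y ^+ 2 by rewrite mulr_ge0 ?sqr_ge0// ltW.
lra.
Qed.

Let integrable_bounded_ball (v : R -> R) (x r : R) : measurable_fun setT (v : measurableTypeR R -> R) ->
  (forall t, `|v t| <= K) ->
  leb.-integrable (ball x r : set R) (EFin \o v).
Proof.
move=> mv vK; apply: (@integrable_dominated _ _ _ leb _ _ (cst K)) => //.
- exact: measurable_ball.
- exact: measurable_funS mv.
apply/integrableP; split; first exact/measurable_EFinP.
under eq_integral do rewrite /= ger0_norm//.
rewrite integral_cst; last exact: measurable_ball.
apply: lte_mul_pinfty => //.
have [r0|r0] := leP 0 r.
  by apply: le_lt_trans (_ : (_ <= (r *+ 2)%:E)%E) (ltry _); rewrite -(lebesgue_measure_ball x r0).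
have -> : (ball x r : set R) = set0 by apply/(ball0 _ _).2; exact: ltW.
by rewrite measure0 ltry.
Qed.

Lemma integrable_poisson_mul (x y : R) : 0 < y ->
  leb.-integrable setT (EFin \o (fun t => u t * poisson_kernel x y t)).
Proof.
move=> y0; have p0 t : 0 <= poisson_kernel x y t by rewrite ltW// poisson_kernel_gt0.
have := integrableZl measurableT K (@integrable_poisson_kernel _ x _ y0).
move=> /(integrable_dominated _ _); apply => //.
  by apply: measurable_funM => //; exact: measurable_poisson_kernel.
by move=> t _; rewrite normrM (ger0_norm (p0 _)) ger0_norm// ler_wpM2r.
Qed.

(** The kernel splits into a part on the ball of radius [M y], which sees only the local oscillation
    of [u], and a tail of mass at most [2 pi / M], as the kernel of height [M y] also has mass
    [pi]. *)
Lemma poisson_approx (x y M : R) : 0 < y -> 0 < M ->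
  `|\int[leb]_t (u t * poisson_kernel x y t) - pi * u x| <=
  y^-1 * (\int[leb]_(t in (ball x (M * y) : set R)) `|u t - u x|) + 2 / M * K * pi.
Proof.
move=> y0 M0; have My0 : 0 < M * y by rewrite mulr_gt0.
have mp r : 0 < r -> measurable_fun setT (poisson_kernel x r : measurableTypeR R -> R).
  by move=> r0; exact: measurable_poisson_kernel.
have ip r : 0 < r -> leb.-integrable setT (EFin \o poisson_kernel x r).
  by move=> r0; exact: integrable_poisson_kernel.
have ipk r k : 0 < r -> leb.-integrable setT (EFin \o (fun t => k * poisson_kernel x r t)).
  by move=> r0; exact: (integrableZl measurableT k (ip r r0)).
have ppi r : 0 < r -> \int[leb]_t poisson_kernel x r t = pi.
  by move=> r0; rewrite /Rintegral integral_poisson_kernel.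
have p0 r t : 0 < r -> 0 <= poisson_kernel x r t.
  by move=> r0; rewrite ltW// poisson_kernel_gt0.
have iup := integrable_poisson_mul x y0.
have md : measurable_fun setT (fun t : measurableTypeR R => u t - u x).
  exact: measurable_funB.
have mn : measurable_fun setT (fun t : measurableTypeR R => `|u t - u x|).
  exact: measurableT_comp.
have -> : \int[leb]_t (u t * poisson_kernel x y t) - pi * u x =
    \int[leb]_t ((u t - u x) * poisson_kernel x y t).
  rewrite -(ppi y y0) mulrC -RintegralZl//; last exact: ip.
  rewrite -RintegralB//; last exact: ipk.
  by apply: eq_Rintegral => t _; rewrite mulrBl.
have idp : leb.-integrable setT (EFin \o (fun t => (u t - u x) * poisson_kernel x y t)).
  apply: (integrable_dominated _ _ (ipk y K y0)) => //.
    by apply: measurable_funM => //; exact: mp.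
  by move=> t _; rewrite normrM (ger0_norm (p0 _ _ y0)) ler_wpM2r// p0.
pose b t := `|u t - u x| * (if t \in (ball x (M * y) : set R) then 1 else 0).
have ib : leb.-integrable setT (EFin \o b).
  have mB : measurable (ball x (M * y) : set (measurableTypeR R)) by exact: measurable_ball.
  have iB : leb.-integrable (ball x (M * y) : set R) (EFin \o (fun t => `|u t - u x|)).
    by apply: integrable_bounded_ball => // t; rewrite normr_id.
  have := (integrable_mkcond _ mB).1 iB; apply: eq_integrable => // t _.
  by rewrite /b /= patchE; case: ifP; rewrite ?mulr1 ?mulr0.
have bE : \int[leb]_t b t = \int[leb]_(t in (ball x (M * y) : set R)) `|u t - u x|.
  rewrite [RHS]Rintegral_mkcond; apply: eq_Rintegral => t _.
  by rewrite /b patchE; case: ifP; rewrite ?mulr1 ?mulr0.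
apply: le_trans (le_normr_Rintegral measurableT idp) _.
apply: le_trans (_ : \int[leb]_t (y^-1 * b t + 2 / M * K * poisson_kernel x (M * y) t) <= _).
  apply: le_Rintegral => //.
  - exact: (integrable_norm idp).
  - have := integrableD measurableT (integrableZl measurableT y^-1 ib) (ipk _ (2 / M * K) My0).
    by apply: eq_integrable.
  move=> t _; rewrite normrM (ger0_norm (p0 _ _ y0)).
  apply: le_trans (ler_wpM2l _ (poisson_kernel_split x t y0 M0)) _ => //.
  rewrite mulrDr lerD//; first by rewrite mulrCA.
  rewrite [leRHS]mulrAC mulrC ler_wpM2l// mulr_ge0 ?p0// divr_ge0// ltW//.
rewrite RintegralD//.
- rewrite RintegralZl//.
  rewrite RintegralZl//; last exact: ip.
  by rewrite bE ppi.
- exact: (integrableZl measurableT y^-1 ib).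
- exact: ipk.
Qed.

Lemma fatou_lebesgue_pt (x : R) : lebesgue_pt u x ->
  \int[leb]_t (u t * poisson_kernel x y t) @[y --> 0^'+] --> pi * u x.
Proof.
move=> ux; apply/cvgrPdist_le => e e0.
(* Chosen so that the tail term is at most [e / 2]; the summand 1 keeps [M] positive when
   [K = 0]. *)
pose M := 4 * K * pi / e + 1.
have M0 : 0 < M by rewrite ltr_wpDl// divr_ge0 ?mulr_ge0 ?pi_ge0// ltW.
have MK : 2 / M * K * pi <= e / 2.
  have -> : 2 / M * K * pi = 2 * K * pi / M by ring.
  rewrite ler_pdivrMr//.
  have -> : e / 2 * M = 2 * K * pi + e / 2 by rewrite /M; field; rewrite gt_eqF.
  by rewrite lerDl divr_ge0// ltW.
(* The ball has length [2 M y], so [y^-1] times the integral over it is [2 M] times the average,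
   which is then at most [2 M d = e / 2]. *)
pose d := e / (4 * M).
have d0 : 0 < d by rewrite divr_gt0// mulr_gt0.
have [r /= r0 rP] : exists2 r : R, 0 < r & forall s, 0 < s < r -> (davg u x s < d%:E)%E.
  have /nbhs_ballP[r /= r0 rP] : nbhs (0 : R) (fun s => 0 < s -> (davg u x s < d%:E)%E).
    apply: (ux [set z | (z < d%:E)%E]); apply: open_nbhs_nbhs; split => /=.
      exact: open_ereal_lt_ereal.
    by rewrite lte_fin.
  exists r => // s /andP[s0 sr]; apply: rP => //.
  by rewrite -ball_normE /= sub0r normrN gtr0_norm.
near=> y.
have y0 : 0 < y by [].
have My : 0 < M * y < r.
  by rewrite mulr_gt0//= mulrC -ltr_pdivlMr//; near: y; apply: nbhs_right_lt; rewrite divr_gt0.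
rewrite distrC; apply: le_trans (poisson_approx x y0 M0) _.
rewrite (splitr e) lerD//.
have := rP _ My; rewrite /davg /iavg lebesgue_measure_ball; last by case/andP: My => /ltW.
have My0 : 0 < M * y by case/andP: My.
have iB : leb.-integrable (ball x (M * y) : set R) (EFin \o (fun t => `|u t - u x|)).
  by apply: integrable_bounded_ball => // [|t]; rewrite ?normr_id//;
    apply: measurableT_comp => //; exact: measurable_funB.
have -> : (\int[leb]_(y0 in ball x (M * y)) `|((center (u x) \o u) y0)%:E| =
    (\int[leb]_(t in (ball x (M * y) : set R)) `|u t - u x|)%:E)%E.
  by rewrite /Rintegral fineK//; apply: integrable_fin_num iB; exact: measurable_ball.
rewrite inver mulrn_eq0/= gt_eqF// -EFinM lte_fin => H.
move: H; set I := \int[leb]_(t in _) _ => H.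
have -> : y^-1 * I = 2 * (M * ((M * y *+ 2)^-1 * I)).
  by rewrite -mulr_natl; field; rewrite !gt_eqF.
have -> : e / 2 = 2 * (M * d) by rewrite /d; field; rewrite gt_eqF.
by rewrite ler_wpM2l// ler_wpM2l// ltW.
Unshelve. all: by end_near. Qed.

Lemma fatou_theorem : {ae leb, forall x,
  \int[leb]_t (u t * poisson_kernel x y t) @[y --> 0^'+] --> pi * u x}.
Proof.
have aeF : Filter (nbhs (almost_everywhere leb)) := ae_filter_ringOfSetsType leb.
apply: filterS (lebesgue_differentiation locally_integrable_bounded) => x.
exact: fatou_lebesgue_pt.
Qed.

End fatou.

(** * Representation by almost everywhere boundary values of the imaginary part *)

Section bounded_herglotz.
Context {R : realType}.
Notation leb := (@lebesgue_measure R).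
Variables (f : R[i] -> R[i]) (K : R).
Hypothesis fd : forall z, 0 < complex.Im z -> cdiff f z.
Hypothesis fK : forall z, 0 < complex.Im z -> 0 <= complex.Im (f z) <= K.

Lemma boundary_function : exists (e : nat -> R) (u : R -> R),
  [/\ forall n, 0 < e n <= harmonic n,
      measurable_fun setT (u : measurableTypeR R -> R),
      forall t, 0 <= u t <= K &
      {ae leb, forall t, complex.Im (f (t +i* e n)) @[n --> \oo] --> u t}].
Proof.
have K0 : 0 <= K by have /andP[] := @fK (0 +i* 1) ltr01; exact: le_trans.
have [e [e0 He]] := Im_ae_cvg_along_sequence fd fK.
have ep n : 0 < e n by have /andP[] := e0 n.
pose v n (t : measurableTypeR R) := complex.Im (f (t +i* e n)).
have vK n t : 0 <= v n t <= K by exact: (@fK (t +i* e n) (ep n)).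
pose w (t : measurableTypeR R) := limn_sup (v ^~ t).
have mw : measurable_fun setT w.
  apply: measurable_fun_limn_sup.
  - by move=> t _; exists K => _ [n _ <-]; have /andP[] := vK n t.
  - by move=> t _; exists 0 => _ [n _ <-]; have /andP[] := vK n t.
  - move=> n.
    by have [] := @cmeasurable_horizontal _ f (e n) (fun t => cdiff_ccont (@fd (t +i* e n) (ep n))).
(* Clipping the superior limit gives a measurable function within the bounds at every point; it
   equals the limit wherever that exists. *)
pose u t := Num.min K (Num.max 0 (w t)).
exists e, u; split => //.
- apply: measurable_minr; first exact: measurable_cst.
  by apply: measurable_maxr => //; exact: measurable_cst.
- by move=> t; rewrite /u ge_min lexx andbT le_min K0 le_max lexx.
have aeF : Filter (nbhs (almost_everywhere leb)) := ae_filter_ringOfSetsType leb.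
apply: filterS He => t ct.
suff -> : u t = limn (v ^~ t) by [].
have vl : w t = limn (v ^~ t) by apply: cvg_limn_supE.
rewrite /u vl.
have l0 : 0 <= limn (v ^~ t).
  by apply: limr_ge => //; apply: nearW => n; have /andP[] := vK n t.
have lK : limn (v ^~ t) <= K.
  by apply: limr_le => //; apply: nearW => n; have /andP[] := vK n t.
by rewrite (max_idPr l0) (min_idPr lK).
Qed.

Variables (e : nat -> R) (u : R -> R).
Hypothesis e0 : forall n, 0 < e n <= harmonic n.
Hypothesis mu : measurable_fun setT (u : measurableTypeR R -> R).
Hypothesis uK : forall t, 0 <= u t <= K.
Hypothesis ue : {ae leb, forall t, complex.Im (f (t +i* e n)) @[n --> \oo] --> u t}.

Let ep n : 0 < e n. Proof. by have /andP[] := e0 n. Qed.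

Let conjIm (z : R[i]) : complex.Im (conjc z) = - complex.Im z. Proof. by case: z. Qed.
Let conjRe (z : R[i]) : complex.Re (conjc z) = complex.Re z. Proof. by case: z. Qed.

Let e_to0 : e n @[n --> \oo] --> (0 : R).
Proof.
apply: (squeeze_cvgr _ (@cvg_cst _ (0 : R) _ _ _) (@cvg_harmonic R)).
by apply: nearW => n; have /andP[/ltW -> ->] := e0 n.
Qed.

Let shift_cvg z : 0 < complex.Im z -> ctends (fun n => f (z + (0 +i* e n))) (f z).
Proof.
move=> z0; apply: (@ccont_ctends _ f (fun n => z + (0 +i* e n))).
  by apply: cdiff_ccont; exact: fd.
split; first by under eq_fun do rewrite Re_add /= addr0; exact: cvg_cst.
under eq_fun do rewrite Im_add /=.
by have := cvgD (@cvg_cst _ (complex.Im z) _ _ _) e_to0; rewrite addr0; apply.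
Qed.

(** The translate [f (. + i e n)] is holomorphic up to the real line, so [schwarz_formula] applies
    to it; [K] times the quadratic decay of the kernel dominates as [e n] tends to zero. *)
Lemma schwarz_formula_boundary (z w : R[i]) :
  0 < complex.Im z -> 0 < complex.Im w ->
  cintegrable leb setT (fun t => (u t)%:C * cauchy_kernel z (conjc w) t) /\
  Cintegral leb setT (fun t => (u t)%:C * cauchy_kernel z (conjc w) t) =
  pi%:C * (f z - conjc (f w)).
Proof.
move=> z0 w0.
have K0 : 0 <= K by have /andP[] := uK 0; exact: le_trans.
have Nw : complex.Im (conjc w) < 0 by rewrite conjIm oppr_lt0.
have [C C0 HC] := @cauchy_kernel_decay _ z (conjc w) (negbT (gt_eqF z0)) (negbT (lt_eqF Nw)).
have mk := @cmeasurable_cauchy_kernel _ z (conjc w) (negbT (gt_eqF z0)) (negbT (lt_eqF Nw)).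
have m0 : measurable_fun setT (fun=> 0 : R) := @measurable_cst _ _ (measurableTypeR R) _ setT (0 : R).
have mv n : measurable_fun setT (fun t : measurableTypeR R => complex.Im (f (t +i* e n))).
  by have [] := @cmeasurable_horizontal _ f (e n) (fun t => cdiff_ccont (@fd (t +i* e n) (ep n))).
have vK n (t : R) : `|complex.Im (f (t +i* e n))| <= K.
  by have /andP[a b] := @fK (t +i* e n) (ep n); rewrite ger0_norm.
have [||||||iu H] := @Cintegral_dominated_cvg _ _ _ leb setT
  (fun n (t : R) => (complex.Im (f (t +i* e n)))%:C * cauchy_kernel z (conjc w) t)
  (fun t : R => (u t)%:C * cauchy_kernel z (conjc w) t)
  (fun t : R => K * C / (1 + t ^+ 2)).
- exact: measurableT.
- by move=> n; apply: cmeasurableM => //; split; [exact: mv | exact: m0].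
- by apply: cmeasurableM; [split; [exact: mu | exact: m0] | exact: mk].
- have aeF : Filter (nbhs (almost_everywhere leb)) := ae_filter_ringOfSetsType leb.
  apply: filterS ue => t ut _; split.
    under eq_fun do rewrite Re_mul /= mul0r subr0.
    by rewrite Re_mul /= mul0r subr0; apply: cvgMl.
  under eq_fun do rewrite Im_mul /= mul0r addr0.
  by rewrite Im_mul /= mul0r addr0; apply: cvgMl.
- exact: integrable_inv_oneDsqr.
- by move=> n t _; rewrite cabsM cabs_real -mulrA ler_pM ?cabs_ge0.
split => //; apply: ctends_unique H _.
have E n : Cintegral leb setT (fun t : R =>
    (complex.Im (f (t +i* e n)))%:C * cauchy_kernel z (conjc w) t) =
    pi%:C * (f (z + (0 +i* e n)) - conjc (f (w + (0 +i* e n)))).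
  have -> : (fun t => (complex.Im (f (t +i* e n)))%:C * cauchy_kernel z (conjc w) t) =
     (fun t : R => (complex.Im (f (t%:C + (0 +i* e n))))%:C * cauchy_kernel z (conjc w) t).
    apply/funext => t; congr ((complex.Im (f _))%:C * _).
    by apply: complex_ext; rewrite /= ?addr0 ?add0r.
  apply: (@schwarz_formula _ (fun z => f (z + (0 +i* e n))) K) => //.
    move=> x x0; apply: (@cdiff_comp _ (fun z => z + (0 +i* e n)) f).
      by apply: cdiffD; [exact: cdiff_id | exact: cdiff_cst].
    by apply: fd; rewrite Im_add /= ltr_wpDl.
  by move=> x x0; apply: fK; rewrite Im_add /= ltr_wpDl.
under eq_fun do rewrite E.
have [a1 a2] := shift_cvg z0; have [b1 b2] := shift_cvg w0.
split.
  under eq_fun do rewrite Re_mul /= mul0r subr0 Re_sub conjRe.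
  by rewrite Re_mul /= mul0r subr0 Re_sub conjRe; apply: cvgMr; exact: cvgB.
under eq_fun do rewrite Im_mul /= mul0r addr0 Im_sub conjIm.
rewrite Im_mul /= mul0r addr0 Im_sub conjIm; apply: cvgMr; apply: cvgB => //.
exact: cvgN.
Qed.

Lemma cauchy_kernel_conj (z : R[i]) t : 0 < complex.Im z ->
  cauchy_kernel z (conjc z) t =
  (0 +i* 2) * (poisson_kernel (complex.Re z) (complex.Im z) t)%:C.
Proof.
move=> z0; have Nz : complex.Im (conjc z) < 0 by rewrite conjIm oppr_lt0.
rewrite cauchy_kernelE ?(gt_eqF z0) ?(lt_eqF Nz)//.
have -> : (t%:C - z) * (t%:C - conjc z) = ((t - complex.Re z) ^+ 2 + complex.Im z ^+ 2)%:C.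
  by case: (z) => p q /=; apply: complex_ext;
  rewrite ?(Re_mul, Im_mul, Re_sub, Im_sub) /=; ring.
rewrite /poisson_kernel rmorphM fmorphV [RHS]mulrA; congr (_ / _).
by case: (z) => p q; apply: complex_ext;
  rewrite ?(Re_mul, Im_mul, Re_sub, Im_sub) /=; ring.
Qed.

(** The case [w = z] of the Schwarz formula, where the kernel is [2 i] times the Poisson kernel and
    the right side is [2 i pi Im f]. *)
Lemma poisson_boundary (x y : R) : 0 < y ->
  \int[leb]_t (u t * poisson_kernel x y t) = pi * complex.Im (f (x +i* y)).
Proof.
move=> y0; have [iu /(congr1 (@complex.Im R))] := @schwarz_formula_boundary (x +i* y) (x +i* y) y0 y0.
have -> : (fun t => (u t)%:C * cauchy_kernel (x +i* y) (conjc (x +i* y)) t) =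
    fun t => 0 +i* (2 * (u t * poisson_kernel x y t)).
  apply/funext => t; rewrite cauchy_kernel_conj//.
  by apply: complex_ext; rewrite ?(Re_mul, Im_mul) /=; ring.
rewrite Im_mul Im_sub conjIm /= mul0r addr0 => E.
have u0 t : 0 <= u t by have /andP[] := uK t.
have uK' t : u t <= K by have /andP[] := uK t.
apply: (@mulfI _ 2) => //; rewrite -RintegralZl//; last exact: integrable_poisson_mul.
rewrite E; ring.
Qed.

Lemma Im_boundary_ae : {ae leb, forall x,
  pi^-1 * complex.Im (f (x +i* y)) @[y --> 0^'+] --> pi^-1 * u x}.
Proof.
have aeF : Filter (nbhs (almost_everywhere leb)) := ae_filter_ringOfSetsType leb.
have u0 t : 0 <= u t by have /andP[] := uK t.
have uK' t : u t <= K by have /andP[] := uK t.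
apply: filterS (fatou_theorem mu u0 uK') => x H.
have pi0 : pi != 0 :> R by rewrite gt_eqF// pi_gt0.
apply: cvgMr; rewrite -[u x](mulKf pi0).
apply: cvg_trans (@cvgMr _ _ _ _ _ pi^-1 _ H); apply: near_eq_cvg.
near=> y; have y0 : 0 < y by [].
by rewrite poisson_boundary// mulKf.
Unshelve. all: by end_near. Qed.

(** The case [w = i]. Since [1 / (t + i) = (t - i) / (1 + t ^ 2)], subtracting [i] times the Poisson
    kernel at [i] turns the Cauchy kernel into the Herglotz kernel, and turns [f z - conjc (f i)]
    into [f z - Re (f i)]. *)
Lemma herglotz_representation_boundary (z : R[i]) : 0 < complex.Im z ->
  cintegrable leb setT (fun t => (pi^-1 * u t)%:C * herglotz_kernel z t) /\
  f z = (complex.Re (f (0 +i* 1)))%:C +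
    Cintegral leb setT (fun t => (pi^-1 * u t)%:C * herglotz_kernel z t).
Proof.
move=> z0; have i0 : 0 < complex.Im (0 +i* 1 : R[i]) by exact: ltr01.
have [iu E] := schwarz_formula_boundary z0 i0.
have ip0 : leb.-integrable setT (EFin \o (fun t => u t * poisson_kernel 0 1 t)).
  apply: (integrable_dominated _ _ (integrable_inv_oneDsqr K)) => //.
    by apply: measurable_funM => //; exact: measurable_poisson_kernel.
  move=> t _; have /andP[a b] := uK t.
  rewrite /poisson_kernel subr0 expr1n mul1r addrC ger0_norm; last first.
    by rewrite mulr_ge0// invr_ge0 ltW// oneDsqr_gt0.
  by rewrite ler_wpM2r// invr_ge0 ltW// oneDsqr_gt0.
have cip : cintegrable leb setT (fun t => (u t * poisson_kernel 0 1 t)%:C).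
  by split => //; exact: integrable0.
have pi0 : pi != 0 :> R by rewrite gt_eqF// pi_gt0.
have kE t : (pi^-1 * u t)%:C * herglotz_kernel z t =
  (pi^-1)%:C * ((u t)%:C * cauchy_kernel z (conjc (0 +i* 1)) t -
    (0 +i* 1) * (u t * poisson_kernel 0 1 t)%:C).
  rewrite rmorphM /= -mulrA; congr (_ * _).
  have -> : (u t * poisson_kernel 0 1 t)%:C = (u t)%:C * (poisson_kernel 0 1 t)%:C by rewrite rmorphM.
  rewrite mulrCA -mulrBr; congr (_ * _).
  rewrite /herglotz_kernel /cauchy_kernel -addrA; congr (_ + _).
  have := oneDsqr_gt0 t => h.
  by apply: complex_ext; rewrite ?(Re_opp, Im_opp, Re_sub, Im_sub, Re_mul, Im_mul) /poisson_kernel /=;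
    field; rewrite ?gt_eqF//; lra.
have i1 : cintegrable leb setT (fun t => (0 +i* 1) * (u t * poisson_kernel 0 1 t)%:C).
  exact: cintegrableZ.
have i2 := cintegrableB measurableT iu i1.
have -> : (fun t => (pi^-1 * u t)%:C * herglotz_kernel z t) =
    fun t => (pi^-1)%:C * ((u t)%:C * cauchy_kernel z (conjc (0 +i* 1)) t -
    (0 +i* 1) * (u t * poisson_kernel 0 1 t)%:C).
  by apply/funext => t; rewrite kE.
split; first exact: cintegrableZ.
rewrite CintegralZ// CintegralB// E CintegralZ//.
have -> : Cintegral leb setT (fun t => (u t * poisson_kernel 0 1 t)%:C) = (pi * complex.Im (f (0 +i* 1)))%:C.
  by rewrite -poisson_boundary//; apply: complex_ext => //=; rewrite Rintegral_cst// mul0r.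
move: pi0; move: (@pi R) => c c0.
by move: (f (0 +i* 1)) (f z) => [p q] [p' q']; apply: complex_ext;
  rewrite ?(Re_add, Im_add, Re_mul, Im_mul, Re_sub, Im_sub) /=; field.
Qed.

End bounded_herglotz.

(** * The one-parameter group *)

Section real_derivatives.
Context {R : realType}.
Implicit Types f g : R -> R.

Definition der f (x l : R) := is_derive x (1 : R) f l.

Lemma der_eq f x l l' : der f x l -> l = l' -> der f x l'.
Proof. by move=> ? <-. Qed.

Lemma der_cst (k x : R) : der (fun=> k) x 0.
Proof. exact: is_derive_cst. Qed.

Lemma der_id (x : R) : der id x 1.
Proof. exact: is_derive_id. Qed.

Lemma derD f g x a b : der f x a -> der g x b -> der (fun t => f t + g t) x (a + b).
Proof. exact: is_deriveD. Qed.

Lemma derN f x a : der f x a -> der (fun t => - f t) x (- a).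
Proof. exact: is_deriveN. Qed.

Lemma derB f g x a b : der f x a -> der g x b -> der (fun t => f t - g t) x (a - b).
Proof. exact: is_deriveB. Qed.

Lemma derM f g x a b : der f x a -> der g x b ->
  der (fun t => f t * g t) x (a * g x + f x * b).
Proof.
move=> fa gb; have H := is_deriveM fa gb; apply: (der_eq H).
by rewrite /GRing.scale /= addrC (mulrC (g x)).
Qed.

Lemma derZ f k x a : der f x a -> der (fun t => k * f t) x (k * a).
Proof.
by move=> fa; apply: (der_eq (derM (der_cst k x) fa)); rewrite mul0r add0r.
Qed.

Lemma der_comp f g x a b : der f (g x) a -> der g x b -> der (fun t => f (g t)) x (a * b).
Proof. by move=> fa gb; exact: (is_derive1_comp fa gb). Qed.

Lemma der_continuous f x a : der f x a -> {for x, continuous f}.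
Proof. by move=> [fx _]; exact/differentiable_continuous/derivable1_diffP. Qed.

Lemma der0_cst f : (forall x, der f x 0) -> forall x y, f x = f y.
Proof. by move=> f0 x y; exact: is_derive_0_is_cst. Qed.

Lemma continuous_primitive (phi : R -> R) : continuous phi ->
  exists Phi : R -> R, [/\ Phi 0 = 0, forall t, der Phi t (phi t) &
    forall s t, s <= t ->
      \int[@lebesgue_measure R]_(r in `[s, t]) phi r = Phi t - Phi s].
Proof.
move=> pc; pose leb := @lebesgue_measure R.
have ip a b : leb.-integrable `[a, b] (EFin \o phi).
  apply: continuous_compact_integrable; first exact: segment_compact.
  exact: continuous_subspaceT.
(* The oriented integral from 0 to [t]: for each sign of [t] one of the two intervals is empty. *)
pose Phi t := \int[leb]_(s in `[0, t]) phi s - \int[leb]_(s in `[t, 0]) phi s.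
pose F T s := \int[leb]_(r in `[(- T)%R, s]) phi r.
(* To the right of [- T], [Phi] differs by a constant from an integral with fixed left end, to which
   the fundamental theorem of calculus applies. *)
have PhiE T s : 0 < T -> - T < s -> Phi s = F T s - F T 0.
  move=> T0 Ts; rewrite /Phi /F.
  have [s0|/ltW s0] := leP 0 s.
    rewrite (@Rintegral_itv_cat _ _ (- T) 0 s)//; last by rewrite oppr_le0 ltW.
    move: s0; rewrite le_eqVlt => /predU1P[<-|s0].
      by rewrite !set_itv1 !Rintegral_set1; ring.
    rewrite [X in _ - X](_ : _ = 0); first by ring.
    by rewrite set_itv_ge ?Rintegral_set0// bnd_simp -ltNge.
  rewrite (@Rintegral_itv_cat _ _ (- T) s 0)//; last exact: ltW.
  move: s0; rewrite le_eqVlt => /predU1P[->|s0].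
    by rewrite !set_itv1 !Rintegral_set1; ring.
  rewrite [X in X - _ = _](_ : _ = 0); first by ring.
  by rewrite set_itv_ge ?Rintegral_set0// bnd_simp -ltNge.
exists Phi; split.
- by rewrite /Phi subrr.
- move=> t; pose T : R := `|t| + 1.
  have T0 : 0 < T by rewrite ltr_wpDl.
  have /andP[Tt tT] : - T < t < T by rewrite -ltr_norml /T ltrDl.
  have [dF F'] := @continuous_FTC1_closed _ phi (- T) t T tT (ip _ _) Tt (pc t).
  have dF' : der (F T) t (phi t).
    split; first exact: dF.
    by rewrite -derive1E; exact: F'.
  have dG : der (fun s => F T s - F T 0) t (phi t).
    by apply: (der_eq (derB dF' (der_cst _ _))); rewrite subr0.
  apply: near_eq_is_derive dG.
  near=> s; rewrite (PhiE T)//.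
  by near: s; exact: lt_nbhsr.
- move=> s t st; pose T : R := `|s| + 1.
  have T0 : 0 < T by rewrite ltr_wpDl.
  have /andP[Ts _] : - T < s < T by rewrite -ltr_norml /T ltrDl.
  rewrite (PhiE T t)// ?(lt_le_trans Ts)// (PhiE T s)// /F.
  rewrite (@Rintegral_itv_cat _ _ (- T) s t)//; last exact: ltW.
  by rewrite -/leb; ring.
Unshelve. all: by end_near. Qed.

End real_derivatives.

(** * Closed form of the exponential of a traceless matrix *)

Section matrix_exponential.
Context {R : realType}.
Variables (alpha beta gamma : R).
Let X := mx22 beta alpha gamma (- beta).
Let kappa := beta ^+ 2 + alpha * gamma.

(** Cayley-Hamilton for a traceless matrix, with [kappa = - det X]; all powers of [X] therefore lie
    in the span of the identity and [X]. *)
Lemma mx22_sqr : X * X = kappa%:M.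
Proof.
apply/matrixP => i j; rewrite mxE !big_ord_recl big_ord0 !mxE.
by case: i => -[|[|]]// ?; case: j => -[|[|]]// ?; rewrite /= /kappa; ring.
Qed.

(** Even powers are scalar and odd ones are multiples of [X]; the parity indicators keep both in one
    formula, so that the exponential series splits into two real series. *)
Lemma mx22_pow k t : (t *: X) ^+ k =
  ((~~ odd k)%:R * (t ^+ k * kappa ^+ k./2))%:M + ((odd k)%:R * (t ^+ k * kappa ^+ k./2)) *: X.
Proof.
elim: k => [|k IH].
  by rewrite !expr0 /= mul1r mulr1 mul0r scale0r addr0.
have H a b : (t *: X) * (a%:M + b *: X) = (t * b * kappa)%:M + (t * a) *: X.
  rewrite mulrDr -scalerAl -scalerAl -scalerAr mx22_sqr !scale_scalar_mx.
  rewrite -[X * _%:M]/(X *m _) mul_mx_scalar scalerA addrC.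
  by rewrite mulrA.
rewrite exprS IH H /= uphalf_half; case: (odd k) => /=.
  by congr (_%:M + _ *: _); rewrite !exprS; ring.
by congr (_%:M + _ *: _); rewrite !exprS; ring.
Qed.

Lemma expmx_series (C S t : R) :
  series (fun k => (~~ odd k)%:R * (t ^+ k * kappa ^+ k./2) / k`!%:R) @ \oo --> C ->
  series (fun k => (odd k)%:R * (t ^+ k * kappa ^+ k./2) / k`!%:R) @ \oo --> S ->
  expmx (t *: X) = C%:M + S *: X.
Proof.
move=> cC cS; rewrite /expmx; apply/cvg_lim; first exact: norm_hausdorff.
have -> : series (fun k => (k`!%:R)^-1 *: (t *: X) ^+ k) =
  fun n => (series (fun k => (~~ odd k)%:R * (t ^+ k * kappa ^+ k./2) / k`!%:R) n) *: 1%:M +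
    (series (fun k => (odd k)%:R * (t ^+ k * kappa ^+ k./2) / k`!%:R) n) *: X.
  apply/funext => n; rewrite /series /= !scaler_suml -big_split /=.
  apply: eq_bigr => k _; rewrite mx22_pow scalerDr scalerA.
  by rewrite !scale_scalar_mx mulr1 ![_^-1 * _]mulrC.
rewrite -[C%:M]scalemx1.
by apply: cvgD; apply: cvgZr_tmp.
Qed.

Lemma series_even (C : R) (t : R) (u : R ^nat) :
  (forall k, u k.*2 = t ^+ k.*2 * kappa ^+ k / (k.*2)`!%:R) ->
  (forall k, u k.*2.+1 = 0) ->
  series u @ \oo --> C ->
  series (fun k => (~~ odd k)%:R * (t ^+ k * kappa ^+ k./2) / k`!%:R) @ \oo --> C.
Proof.
move=> u0 u1; rewrite (_ : u = (fun k => (~~ odd k)%:R * (t ^+ k * kappa ^+ k./2) / k`!%:R))//.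
apply/funext => k; have := odd_double_half k; case: (odd k) => <-.
  by rewrite add1n u1 /= !mul0r.
by rewrite add0n u0 mul1r doubleK.
Qed.

Lemma series_odd (C : R) (t : R) (u : R ^nat) :
  (forall k, u k.*2.+1 = t ^+ k.*2.+1 * kappa ^+ k / (k.*2.+1)`!%:R) ->
  (forall k, u k.*2 = 0) ->
  series u @ \oo --> C ->
  series (fun k => (odd k)%:R * (t ^+ k * kappa ^+ k./2) / k`!%:R) @ \oo --> C.
Proof.
move=> u0 u1; rewrite (_ : u = (fun k => (odd k)%:R * (t ^+ k * kappa ^+ k./2) / k`!%:R))//.
apply/funext => k; have := odd_double_half k; case: (odd k) => <-.
  by rewrite add1n u0 mul1r /= uphalf_double.
by rewrite add0n u1 /= !mul0r.
Qed.

Lemma seriesDZ (u v : R ^nat) (a b x y : R) :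
  series u @ \oo --> x -> series v @ \oo --> y ->
  series (fun k => a * u k + b * v k) @ \oo --> a * x + b * y.
Proof.
move=> ux vy.
rewrite (_ : series _ = fun n => a * series u n + b * series v n).
  by apply: cvgD; apply: cvgMl_tmp.
by apply/funext => n; rewrite /series /= !mulr_sumr -big_split.
Qed.

Lemma cvg_exp_series (x : R) : series (exp_coeff x) @ \oo --> expR x.
Proof. by rewrite /expR; exact: is_cvg_series_exp_coeff. Qed.

Lemma cvg_cos_series (x : R) : series (cos_coeff x) @ \oo --> cos x.
Proof. by rewrite cos.unlock; exact: is_cvg_series_cos_coeff. Qed.

Lemma cvg_sin_series (x : R) : series (sin_coeff x) @ \oo --> sin x.
Proof. by rewrite sin.unlock; exact: is_cvg_series_sin_coeff. Qed.

Lemma der_expR_lin (a t : R) : der (fun s => expR (a * s)) t (a * expR (a * t)).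
Proof.
apply: (der_eq (der_comp (is_derive_expR (a * t)) (derZ a (der_id t)))).
by ring.
Qed.

Lemma der_cos_lin (a t : R) : der (fun s => cos (a * s)) t (- a * sin (a * t)).
Proof.
apply: (der_eq (der_comp (is_derive_cos (a * t)) (derZ a (der_id t)))).
by ring.
Qed.

Lemma der_sin_lin (a t : R) : der (fun s => sin (a * s)) t (a * cos (a * t)).
Proof.
apply: (der_eq (der_comp (is_derive_sin (a * t)) (derZ a (der_id t)))).
by ring.
Qed.

(* [C] and [S] are the functions [cosh (w t)] and [sinh (w t) / w] with
   [w ^ 2 = kappa], whatever the sign of [kappa]. *)
Definition exp_pair (C S : R -> R) := [/\ C 0 = 1, S 0 = 0,
  forall t, der C t (kappa * S t), forall t, der S t (C t) &
  forall t, expmx (t *: X) = (C t)%:M + S t *: X].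

Lemma exp_pair_lt0 : kappa < 0 -> exists C S, exp_pair C S.
Proof.
move=> k0; pose w := Num.sqrt (- kappa).
have w0 : w != 0 by rewrite sqrtr_eq0 -ltNge oppr_gt0.
have w2 : kappa = - (w * w) by rewrite -expr2 sqr_sqrtr ?opprK// oppr_ge0 ltW.
exists (fun t => cos (w * t)), (fun t => w^-1 * sin (w * t)); split.
- by rewrite mulr0 cos0.
- by rewrite mulr0 sin0 mulr0.
- by move=> t; apply: (der_eq (der_cos_lin w t)); rewrite w2; field.
- by move=> t; apply: (der_eq (derZ w^-1 (der_sin_lin w t))); field.
- move=> t; apply: expmx_series.
    apply: (@series_even _ t (cos_coeff (w * t))) => [k|k|]; last exact: cvg_cos_series.
      rewrite cos_coeffE /= odd_double mul1r doubleK w2.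
      rewrite exprMn (exprNn (w * w)) -(expr2 w) -exprM mul2n.
      by ring.
    by rewrite cos_coeff_odd.
  have := seriesDZ (a := w^-1) (b := 0) (@cvg_sin_series (w * t)) (@cvg_sin_series (w * t)).
  rewrite mul0r addr0; apply: series_odd => k; rewrite mul0r addr0.
    rewrite sin_coeffE /= odd_double mul1r doubleK w2.
    rewrite exprMn (exprNn (w * w)) -(expr2 w) -exprM mul2n (exprS w).
    have := w0; move: (_ `!%:R^-1) => f w0'; by field.
  by rewrite sin_coeff_even mulr0.
Qed.

(** Hyperbolic case: in the half sum and half difference of the exponentials of [w t] and [- w t],
    the coefficients of one parity cancel. *)
Lemma exp_pair_gt0 : 0 < kappa -> exists C S, exp_pair C S.
Proof.
move=> k0; pose w := Num.sqrt kappa.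
have w0 : w != 0 by rewrite sqrtr_eq0 -ltNge.
have w2 : kappa = w * w by rewrite -expr2 sqr_sqrtr// ltW.
exists (fun t => 2^-1 * expR (w * t) + 2^-1 * expR (- w * t)),
  (fun t => (2 * w)^-1 * expR (w * t) + (- (2 * w)^-1) * expR (- w * t)); split.
- by rewrite !mulr0 expR0; field.
- by rewrite !mulr0 expR0; field.
- move=> t; apply: (der_eq (derD (derZ 2^-1 (der_expR_lin w t))
    (derZ 2^-1 (der_expR_lin (- w) t)))).
  by rewrite w2; field.
- move=> t; apply: (der_eq (derD (derZ (2 * w)^-1 (der_expR_lin w t))
    (derZ (- (2 * w)^-1) (der_expR_lin (- w) t)))).
  by field.
- move=> t.
  have eN k : (- (w * t)) ^+ k.*2 = (w * t) ^+ k.*2.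
    by rewrite -mul2n exprM sqrrN -exprM.
  apply: expmx_series.
    have := seriesDZ (a := 2^-1) (b := 2^-1)
      (@cvg_exp_series (w * t)) (@cvg_exp_series (- w * t)).
    apply: series_even => k.
      rewrite /exp_coeff /= mulNr eN.
      rewrite exprMn w2 -(expr2 w) -exprM mul2n.
      move: (_ `!%:R^-1) => f; by field.
    rewrite /exp_coeff /= !(exprS (- w * t)) (exprS (w * t)) !mulNr eN.
    by ring.
  have := seriesDZ (a := (2 * w)^-1) (b := - (2 * w)^-1)
    (@cvg_exp_series (w * t)) (@cvg_exp_series (- w * t)).
  apply: series_odd => k.
    rewrite /exp_coeff /= !(exprS (- w * t)) (exprS (w * t)) !mulNr eN.
    rewrite exprMn w2 -(expr2 w) -exprM mul2n (exprS t).
    have := w0; move: (_ `!%:R^-1) => f w0'; by field.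
  rewrite /exp_coeff /= (mulNr w t) eN.
  by ring.
Qed.

(** Parabolic case: [X ^ 2 = 0], so the series stops after its linear term. *)
Lemma exp_pair_eq0 : kappa = 0 -> exists C S, exp_pair C S.
Proof.
move=> k0; exists (fun=> 1), id; split => //.
- by move=> t; apply: (der_eq (der_cst _ _)); rewrite k0 mul0r.
- by move=> t; exact: der_id.
- move=> t; apply: expmx_series.
    apply: (series_even (u := fun k => (k == 0)%:R)) => [[|k]|k|].
    + by rewrite !expr0 fact0 mulr1 divr1.
    + by rewrite k0 (exprS 0) mul0r mulr0 mul0r.
    + by [].
    apply: cvg_near_cst; near=> n.
    have -> : n = n.-1.+1 by rewrite prednK//; near: n; exact: nbhs_infty_gt.
    rewrite /series /= big_nat_recl//= big1 ?addr0//.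
  apply: (series_odd (u := fun k => if k == 1 then t else 0)) => [[|k]|k|].
  + by rewrite !expr1 expr0 (_ : 1`!%:R = 1)// mulr1 divr1.
  + by rewrite k0 (exprS 0) mul0r mulr0 mul0r.
  + by case: k.
  apply: cvg_near_cst; near=> n.
  have -> : n = n.-2.+2.
    by rewrite -subn2 -addn2 subnK//; near: n; exact: nbhs_infty_ge.
  by rewrite /series /= !big_nat_recl//= big1 ?addr0 ?add0r.
Unshelve. all: by end_near. Qed.

Lemma expmx_traceless : exists C S, exp_pair C S.
Proof.
by have [/exp_pair_lt0|/exp_pair_gt0|/exp_pair_eq0] := ltgtP kappa 0.
Qed.

End matrix_exponential.

(** * Continuous logarithms of paths *)

Section path_logarithm.
Context {R : realType}.

(** For the path [p = x + iy], the functions [l] and [th] are primitives of the real and imaginary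
    parts of [p' / p], so [p e^(-(l + i th))] has zero derivative and keeps its initial value 1. *)
Lemma exists_path_logarithm (x y x' y' : R -> R) :
  (forall t, der x t (x' t)) -> (forall t, der y t (y' t)) ->
  continuous x' -> continuous y' -> x 0 = 1 -> y 0 = 0 ->
  (forall t, x t * x t + y t * y t != 0) ->
  exists l th : R -> R, [/\ forall t, {for t, continuous l} /\ {for t, continuous th},
    l 0 = 0 /\ th 0 = 0,
    forall s t, s <= t -> \int[@lebesgue_measure R]_(r in `[s, t])
      ((x r * y' r - y r * x' r) / (x r * x r + y r * y r)) = th t - th s &
    forall t, expC (l t +i* th t) = x t +i* y t].
Proof.
move=> dx dy cx' cy' x0 y0 r0.
have cx : continuous x by move=> t; exact: (der_continuous (dx t)).
have cy : continuous y by move=> t; exact: (der_continuous (dy t)).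
pose l' t := (x t * x' t + y t * y' t) / (x t * x t + y t * y t).
pose th' t := (x t * y' t - y t * x' t) / (x t * x t + y t * y t).
have cr t : (fun s => (x s * x s + y s * y s)^-1) s @[s --> t] --> (x t * x t + y t * y t)^-1.
  by apply: cvgV => //; apply: cvgD; apply: cvgM; (exact: cx || exact: cy).
have cl' : continuous l'.
  move=> t; apply: cvgM; last exact: cr.
  by apply: cvgD; apply: cvgM; [exact: cx|exact: cx'|exact: cy|exact: cy'].
have cth' : continuous th'.
  move=> t; apply: cvgM; last exact: cr.
  by apply: cvgB; apply: cvgM; [exact: cx|exact: cy'|exact: cy|exact: cx'].
have [l [l0 dl _]] := continuous_primitive cl'.
have [th [th0 dth Ith]] := continuous_primitive cth'.
exists l, th; split => //.
  by move=> t; split; [exact: (der_continuous (dl t))|exact: (der_continuous (dth t))].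
have dE t : der (fun t => expR (- l t)) t (expR (- l t) * - l' t).
  exact: (der_comp (is_derive_expR _) (derN (dl t))).
have dc t : der (fun t => cos (th t)) t (- sin (th t) * th' t).
  exact: (der_comp (is_derive_cos _) (dth t)).
have ds t : der (fun t => sin (th t)) t (cos (th t) * th' t).
  exact: (der_comp (is_derive_sin _) (dth t)).
(* [A] and [B] are the real and imaginary parts of [p e^(-(l + i th))]. *)
pose A t := expR (- l t) * (x t * cos (th t) + y t * sin (th t)).
pose B t := expR (- l t) * (y t * cos (th t) - x t * sin (th t)).
have dA t : der A t 0.
  apply: (der_eq (derM (dE t) (derD (derM (dx t) (dc t)) (derM (dy t) (ds t))))).
  rewrite /l' /th'; have := r0 t.
  move: (x t) (y t) (x' t) (y' t) (expR _) (cos _) (sin _) => a b a' b' e c s ab.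
  by field.
have dB t : der B t 0.
  apply: (der_eq (derM (dE t) (derB (derM (dy t) (dc t)) (derM (dx t) (ds t))))).
  rewrite /l' /th'; have := r0 t.
  move: (x t) (y t) (x' t) (y' t) (expR _) (cos _) (sin _) => a b a' b' e c s ab.
  by field.
move=> t.
have : A t = 1.
  rewrite (der0_cst dA t 0) /A l0 th0 x0 y0 oppr0 expR0 cos0 sin0; by ring.
have : B t = 0.
  rewrite (der0_cst dB t 0) /B l0 th0 x0 y0 oppr0 expR0 cos0 sin0; by ring.
have El : expR (l t) * expR (- l t) = 1 by rewrite -expRD subrr expR0.
have cs := cos2Dsin2 (th t).
rewrite /A /B /expC /= => Bt At; congr (_ +i* _).
- transitivity (expR (l t) * cos (th t) * A t - expR (l t) * sin (th t) * B t).
    by rewrite /A /B At Bt; ring.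
  transitivity (expR (l t) * expR (- l t) * (cos (th t) ^+ 2 + sin (th t) ^+ 2) * x t).
    by rewrite /A /B; ring.
  by rewrite El cs; ring.
- transitivity (expR (l t) * sin (th t) * A t + expR (l t) * cos (th t) * B t).
    by rewrite /A /B At Bt; ring.
  transitivity (expR (l t) * expR (- l t) * (cos (th t) ^+ 2 + sin (th t) ^+ 2) * y t).
    by rewrite /A /B; ring.
  by rewrite El cs; ring.
Qed.

Lemma complex_continuous_at (f : R -> R[i]) t :
  {for t, continuous (f : R -> R[i]^o)} <->
  {for t, continuous (fun s => complex.Re (f s))} /\
  {for t, continuous (fun s => complex.Im (f s))}.
Proof.
split=> [/cvgrPdist_le ft|[/cvgrPdist_le rt /cvgrPdist_le it]].
  by split; apply/cvgrPdist_le => e e0; have e0C : 0 < e%:C by [rewrite ltcR];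
    near=> s; have : `|f t - f s| <= e%:C by [near: s; exact: ft];
    rewrite cabsE lecR; apply: le_trans; rewrite -?Re_sub -?Im_sub;
    [exact: Re_le_cabs|exact: Im_le_cabs].
apply/cvgrPdist_le => e e0.
have e0R : e = (complex.Re e)%:C.
  by move: e0; case: (e) => a b; rewrite ltcE /= => /andP[/eqP -> _].
have e0' : 0 < complex.Re e by move: e0; rewrite e0R ltcR.
rewrite e0R; near=> s; rewrite cabsE lecR.
apply: le_trans (cabs_le_ReIm _) _; rewrite (splitr (complex.Re e)) lerD//.
  by rewrite Re_sub; near: s; apply: rt; rewrite divr_gt0.
by rewrite Im_sub; near: s; apply: it; rewrite divr_gt0.
Unshelve. all: by end_near. Qed.

(** If [d] left 0, then up to sign it would take, by the intermediate value theorem, a value in []0,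
    pi[], where the sine is positive; [v] is such a value. *)
Lemma continuous_sin0 (d : R -> R) : continuous d -> d 0 = 0 ->
  (forall t, sin (d t) = 0) -> forall t, d t = 0.
Proof.
move=> dc d0 sd t; apply/eqP; apply/negPn/negP => dt0.
wlog dt : d dc d0 sd dt0 / 0 < d t.
  move=> H; have [|dt] := ltP 0 (d t); first exact: H.
  apply: (H (fun t => - d t)).
  - by move=> s; apply: cvgN; exact: dc.
  - by rewrite d0 oppr0.
  - by move=> s; rewrite sinN sd oppr0.
  - by rewrite oppr_eq0.
  - by rewrite oppr_gt0 lt_neqAle dt0.
pose v := Num.min (d t) (pi / 2).
have pi0 : 0 < (pi : R) := pi_gt0 R.
have v0 : 0 < v by rewrite lt_min dt divr_gt0.
have vpi : v < pi by rewrite gt_min ltr_pdivrMr// ltr_pMr// ltr1n orbT.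
have [c _ dcv] : exists2 c, c \in `[Num.min 0 t, Num.max 0 t] & d c = v.
  apply: IVT; first by rewrite ge_min !le_max lexx.
    by apply: continuous_subspaceT.
  have vd : v <= d t by rewrite ge_min lexx.
  by have [t0|t0] := leP 0 t; rewrite ?d0 ge_min le_max (ltW v0) vd ?orbT.
by have := @sin_gt0_pi R v; rewrite v0 vpi => /(_ isT); rewrite -dcv sd ltxx.
Qed.

(** The modulus determines the real part. The imaginary parts agree modulo [2 pi], so the sine of
    their continuous difference vanishes, and the difference starts at 0. *)
Lemma is_path_log_unique (p L L' : R -> R[i]) :
  is_path_log p L -> is_path_log p L' -> L = L'.
Proof.
move=> [cL L0 pL] [cL' L'0 pL'].
have E t : expC (L t) = expC (L' t) by rewrite pL pL'.
have rr t : complex.Re (L t) = complex.Re (L' t).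
  apply: expR_inj; have := congr1 (fun z => cabs z) (E t).
  by rewrite !cabs_expC.
have ss t : sin (complex.Im (L t) - complex.Im (L' t)) = 0.
  have := E t; rewrite /expC rr => -[].
  have e0 : expR (complex.Re (L' t)) != 0 by rewrite gt_eqF// expR_gt0.
  by move=> /(mulfI e0) c /(mulfI e0) s; rewrite sinB c s mulrC subrr.
apply/funext => t; apply: complex_ext => //; apply/eqP.
rewrite -subr_eq0; apply/eqP; apply: (continuous_sin0 _ _ ss).
  move=> s; apply: cvgB.
    by have /complex_continuous_at[] := cL s.
  by have /complex_continuous_at[] := cL' s.
by rewrite L0 L'0 subrr.
Qed.

Lemma path_logE (p : R -> R[i]) (l th : R -> R) :
  (forall t, {for t, continuous l} /\ {for t, continuous th}) ->
  l 0 = 0 /\ th 0 = 0 -> (forall t, expC (l t +i* th t) = p t) ->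
  path_log p = fun t => l t +i* th t.
Proof.
move=> c [l0 th0] e.
have H : is_path_log p (fun t => l t +i* th t).
  split=> //; last by rewrite l0 th0.
  by move=> t; apply/complex_continuous_at; exact: c.
by apply: xget_unique => // L /is_path_log_unique; apply.
Qed.

End path_logarithm.

(** * The flow on the half-plane *)

Section continuous_paths.
Context {R : realType}.
Implicit Types (p q : R -> R[i]) (t : R).

Definition rcont p t := {for t, continuous (fun s => complex.Re (p s))} /\
  {for t, continuous (fun s => complex.Im (p s))}.

Lemma rcont_real (f : R -> R) t : {for t, continuous f} -> rcont (fun s => (f s)%:C) t.
Proof. by move=> ft; split=> //; exact: cvg_cst. Qed.

Lemma rcont_cst (k : R[i]) t : rcont (fun=> k) t.
Proof. by split; exact: cvg_cst. Qed.

Lemma rcont_ext p q t : (forall s, p s = q s) -> rcont p t -> rcont q t.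
Proof. by move=> /funext ->. Qed.

Lemma cont_ext (u v : R -> R) t : (forall s, u s = v s) ->
  {for t, continuous u} -> {for t, continuous v}.
Proof. by move=> /funext ->. Qed.

Lemma rcontD p q t : rcont p t -> rcont q t -> rcont (fun s => p s + q s) t.
Proof.
move=> [p1 p2] [q1 q2]; split.
  by apply: cont_ext (fun s => esym (Re_add _ _)) _; exact: cvgD.
by apply: cont_ext (fun s => esym (Im_add _ _)) _; exact: cvgD.
Qed.

Lemma rcontM p q t : rcont p t -> rcont q t -> rcont (fun s => p s * q s) t.
Proof.
move=> [p1 p2] [q1 q2]; split.
  by apply: cont_ext (fun s => esym (Re_mul _ _)) _; apply: cvgB; exact: cvgM.
by apply: cont_ext (fun s => esym (Im_mul _ _)) _; apply: cvgD; exact: cvgM.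
Qed.

Lemma rcontV p t : p t != 0 -> rcont p t -> rcont (fun s => (p s)^-1) t.
Proof.
move=> p0 [p1 p2].
have n0 : complex.Re (p t) ^+ 2 + complex.Im (p t) ^+ 2 != 0.
  by rewrite -cabs_sqr expf_eq0 /= cabs_eq0.
have q : (complex.Re (p s) ^+ 2 + complex.Im (p s) ^+ 2)^-1 @[s --> t] -->
    (complex.Re (p t) ^+ 2 + complex.Im (p t) ^+ 2)^-1.
  by apply: cvgV => //; apply: cvgD; apply: cvgM.
split.
  by apply: cont_ext (fun s => esym (Re_inv _)) _; exact: cvgM.
apply: cont_ext (fun s => esym (Im_inv _)) _.
by apply: cvgM => //; exact: cvgN.
Qed.

Lemma inv_cube_le (m x y : R) : 0 < m -> m <= x -> m / 2 <= y ->
  (x * x * y)^-1 <= (m * m * (m / 2))^-1.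
Proof.
move=> m0 mx my; have m20 : 0 < m / 2 by rewrite divr_gt0.
have x0 := lt_le_trans m0 mx; have y0 := lt_le_trans m20 my.
have mm : m * m <= x * x by rewrite ler_pM// ltW.
have mmm : m * m * (m / 2) <= x * x * y.
  by rewrite ler_pM// ?mulr_ge0 ?(ltW m0) ?(ltW m20).
by rewrite lef_pV2// posrE !mulr_gt0.
Qed.

End continuous_paths.

Section flow.
Context {R : realType}.
Variables (alpha beta gamma : R) (gamma0 : gamma != 0) (C S : R -> R).
Let X := mx22 beta alpha gamma (- beta).
Let kappa := beta ^+ 2 + alpha * gamma.
Hypothesis CS : exp_pair alpha beta gamma C S.
Let leb := @lebesgue_measure R.

Let C0 : C 0 = 1. Proof. by have [] := CS. Qed.
Let S0 : S 0 = 0. Proof. by have [] := CS. Qed.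
Let dC t : der C t (kappa * S t). Proof. by have [] := CS. Qed.
Let dS t : der S t (C t). Proof. by have [] := CS. Qed.
Let expX t : expmx (t *: X) = (C t)%:M + S t *: X. Proof. by have [] := CS. Qed.
Let cC : continuous C. Proof. by move=> t; exact: (der_continuous (dC t)). Qed.
Let cS : continuous S. Proof. by move=> t; exact: (der_continuous (dS t)). Qed.

(** This is the determinant of [e^(tX)]; the equations for [C] and [S] make its derivative
    cancel. *)
Lemma exp_pair_det t : C t * C t - kappa * (S t * S t) = 1.
Proof.
pose D t := C t * C t - kappa * (S t * S t).
have dD s : der D s 0.
  apply: (der_eq (derB (derM (dC s) (dC s)) (derZ kappa (derM (dS s) (dS s))))).
  by ring.
by rewrite -/(D t) (der0_cst dD t 0) /D C0 S0; ring.
Qed.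

(** The combinations [U] and [V] are constant in [r], equal to [- S s] and [C s]. They form a linear
    system for [S (t - s)] and [C (t - s)] of determinant 1, by [exp_pair_det]. *)
Lemma exp_pair_sub s t : S (t - s) = S t * C s - C t * S s.
Proof.
have dCs r : der (fun r => C (r - s)) r (kappa * S (r - s)).
  apply: (der_eq (der_comp (f := C) (g := fun r => r - s) (dC (r - s))
    (derB (der_id r) (der_cst s r)))).
  by rewrite subr0 mulr1.
have dSs r : der (fun r => S (r - s)) r (C (r - s)).
  apply: (der_eq (der_comp (f := S) (g := fun r => r - s) (dS (r - s))
    (derB (der_id r) (der_cst s r)))).
  by rewrite subr0 mulr1.
pose U r := S (r - s) * C r - C (r - s) * S r.
have dU r : der U r 0.
  apply: (der_eq (derB (derM (dSs r) (dC r)) (derM (dCs r) (dS r)))); by ring.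
have Ut : U t = - S s.
  by rewrite (der0_cst dU t s) /U subrr C0 S0; ring.
pose V r := C (r - s) * C r - kappa * (S (r - s) * S r).
have dV r : der V r 0.
  apply: (der_eq (derB (derM (dCs r) (dC r)) (derZ kappa (derM (dSs r) (dS r))))).
  by ring.
have Vt : V t = C s.
  by rewrite (der0_cst dV t s) /V subrr C0 S0; ring.
rewrite -[LHS]mulr1 -(exp_pair_det t) -Vt -[in RHS](opprK (S s)) -Ut /U /V.
by ring.
Qed.

Let a t := C t + beta * S t.
Let b t := alpha * S t.
Let c t := gamma * S t.
Let d t := C t - beta * S t.

Lemma expmx_entries t : [/\ expmx (t *: X) 0 0 = a t, expmx (t *: X) 0 1 = b t,
  expmx (t *: X) 1 0 = c t & expmx (t *: X) 1 1 = d t].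
Proof. by rewrite expX; split; rewrite !mxE /= /a /b /c /d; ring. Qed.

Let det t : a t * d t - b t * c t = 1.
Proof. by rewrite -(exp_pair_det t) /a /b /c /d /kappa; ring. Qed.

Let p t (w : R[i]) := moebius_den (expmx (t *: X)) w.
Let g t (w : R[i]) := moebius (expmx (t *: X)) w.

Lemma flow_denE t w : p t w = (c t)%:C * w + (d t)%:C.
Proof. by rewrite /p /moebius_den; have [_ _ -> ->] := expmx_entries t. Qed.

Lemma flowE t w : g t w = ((a t)%:C * w + (b t)%:C) / p t w.
Proof. by rewrite /g /moebius; have [-> -> _ _] := expmx_entries t. Qed.

Lemma Re_flow_den t w : complex.Re (p t w) = c t * complex.Re w + d t.
Proof. by rewrite flow_denE Re_add Re_mul /= mul0r subr0. Qed.

Lemma Im_flow_den t w : complex.Im (p t w) = c t * complex.Im w.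
Proof. by rewrite flow_denE Im_add Im_mul /= mul0r !addr0. Qed.

(** A zero would force [c t = 0] by its imaginary part and then [d t = 0] by its real part, against
    determinant 1. *)
Lemma flow_den_neq0 t w : 0 < complex.Im w -> p t w != 0.
Proof.
move=> w0; apply/negP => /eqP p0.
have := Im_flow_den t w; rewrite p0 => /esym/eqP.
rewrite mulf_eq0 (gt_eqF w0) orbF => /eqP ct.
have := Re_flow_den t w; rewrite p0 ct mul0r add0r /= => dt.
by have := det t; rewrite ct -dt !mulr0 subr0 => /esym/eqP; rewrite oner_eq0.
Qed.

Lemma Im_flow t w : 0 < complex.Im w -> complex.Im (g t w) =
  complex.Im w / (complex.Re (p t w) * complex.Re (p t w) +
                  complex.Im (p t w) * complex.Im (p t w)).
Proof.
move=> w0; have p0 := flow_den_neq0 t w0.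
have n0 : complex.Re (p t w) ^+ 2 + complex.Im (p t w) ^+ 2 != 0.
  by rewrite -cabs_sqr expf_eq0 /= cabs_eq0.
have rN : complex.Re ((a t)%:C * w + (b t)%:C) = a t * complex.Re w + b t.
  by rewrite Re_add Re_mul /= mul0r subr0.
have iN : complex.Im ((a t)%:C * w + (b t)%:C) = a t * complex.Im w.
  by rewrite Im_add Im_mul /= mul0r !addr0.
rewrite flowE Im_mul Re_inv Im_inv rN iN -[X in _ = X / _]mul1r -(det t) -!expr2.
by move: n0; rewrite Re_flow_den Im_flow_den => n0; field.
Qed.

Lemma flow_den_continuous w t : rcont (fun r => p r w) t.
Proof.
apply: (rcont_ext (p := fun t => (c t)%:C * w + (d t)%:C)) => [s|].
  by rewrite flow_denE.
apply: rcontD; first (apply: rcontM; last exact: rcont_cst);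
  apply: rcont_real; rewrite /c /d.
  by apply: cvgM; [exact: cvg_cst|exact: cS].
by apply: cvgB; [exact: cC|apply: cvgM; [exact: cvg_cst|exact: cS]].
Qed.

Lemma flow_continuous w t : 0 < complex.Im w -> rcont (fun r => g r w) t.
Proof.
move=> w0.
apply: (rcont_ext (p := fun t => ((a t)%:C * w + (b t)%:C) * (p t w)^-1)) => [s|].
  by rewrite flowE.
apply: rcontM; last first.
  by apply: rcontV; [exact: flow_den_neq0|exact: flow_den_continuous].
apply: rcontD; first (apply: rcontM; last exact: rcont_cst);
  apply: rcont_real; rewrite /a /b.
  by apply: cvgD; [exact: cC|apply: cvgM; [exact: cvg_cst|exact: cS]].
by apply: cvgM; [exact: cvg_cst|exact: cS].
Qed.

Lemma logden_flow w : 0 < complex.Im w -> exists l th : R -> R,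
  [/\ forall t, logden X w t = l t +i* th t, th 0 = 0,
      continuous th,
      forall t, expC (l t +i* th t) = p t w &
      forall s t, s <= t ->
        complex.Im (Cintegral leb `[s, t] (fun r => g r w)) = (th t - th s) / gamma].
Proof.
move=> w0.
pose x t := c t * complex.Re w + d t.
pose y t := c t * complex.Im w.
pose x' t := gamma * C t * complex.Re w + (kappa * S t - beta * C t).
pose y' t := gamma * C t * complex.Im w.
have dc t : der c t (gamma * C t) by exact: derZ.
have dx t : der x t (x' t).
  apply: (der_eq (derD (derM (dc t) (der_cst (complex.Re w) t))
    (derB (dC t) (derZ beta (dS t))))).
  by rewrite /x'; ring.
have dy t : der y t (y' t).
  apply: (der_eq (derM (dc t) (der_cst (complex.Im w) t))).
  by rewrite /y'; ring.
have cx' : continuous x'.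
  move=> t; apply: cvgD; first apply: cvgM; try exact: cvg_cst.
    by apply: cvgM; [exact: cvg_cst|exact: cC].
  by apply: cvgB; apply: cvgM; try exact: cvg_cst; [exact: cS|exact: cC].
have cy' : continuous y'.
  move=> t; apply: cvgM; last exact: cvg_cst.
  by apply: cvgM; [exact: cvg_cst|exact: cC].
have pE t : p t w = x t +i* y t.
  by apply: complex_ext; rewrite ?Re_flow_den ?Im_flow_den.
have r0 t : x t * x t + y t * y t != 0.
  have := flow_den_neq0 t w0; rewrite -cabs_eq0 => p0.
  have : cabs (p t w) ^+ 2 != 0 by rewrite expf_eq0.
  by rewrite cabs_sqr pE /= !expr2.
have [||l [th [cl l0 Ith Elth]]] := exists_path_logarithm dx dy cx' cy' _ _ r0.
- by rewrite /x /c /d C0 S0; ring.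
- by rewrite /y /c S0; ring.
exists l, th; split.
- move=> t; rewrite /logden (path_logE cl l0)// => s.
  by rewrite Elth -/(p s w) pE.
- by have [] := l0.
- by move=> t; have [] := cl t.
- by move=> t; rewrite Elth pE.
- move=> s t st; have [|_ ig] := @continuous_cintegrable _ (fun r => g r w) s t.
    by move=> r _; exact: flow_continuous.
  rewrite -Ith//; apply: (mulfI gamma0); rewrite [RHS]mulrC divfK//.
  rewrite /Cintegral [complex.Im _]/= -RintegralZl//.
  apply: eq_Rintegral => r _; rewrite Im_flow// pE /=.
  (* The numerator of the derivative of the argument is constant in time, by [exp_pair_det]. *)
  have -> : x r * y' r - y r * x' r = gamma * complex.Im w.
    rewrite -[RHS]mulr1 -(exp_pair_det r) /x /y /x' /y' /c /d; ring.
  by rewrite mulrA.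
Qed.

(** [S] vanishes at 0 and its derivative [C] is positive near 0. This fixes the time step [eta] from
    the group alone, without reference to [w]. *)
Lemma exp_pair_pos : exists2 eta : R, 0 < eta & forall r, 0 < r <= eta -> 0 < S r.
Proof.
have : \forall r \near 0, 0 < C r.
  have := @cC (0 : R); rewrite /continuous_at C0 => /cvgr_gt; apply; exact: ltr01.
move=> /nbhs_ballP[e /= e0 eP]; exists (e / 2); first by rewrite divr_gt0.
move=> r /andP[r0 re].
have [|z] := @MVT R S C 0 r r0 (fun z _ => dS z); first by apply: continuous_subspaceT; exact: cS.
rewrite in_itv/= => /andP[z0 zr]; rewrite S0 !subr0 => ->.
rewrite mulr_gt0// eP// /ball /= sub0r normrN gtr0_norm//.
apply: lt_le_trans zr (le_trans re _).
by rewrite ler_pdivrMr// ler_peMr// ?ler1n// ltW.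
Qed.

(* The sine of the difference of the arguments of [c_t w + d_t] and [c_s w + d_s]
   is a nonzero multiple of [S (t - s)], so the difference cannot reach [pi]
   before [S] vanishes; the bound is uniform in [w]. *)
Lemma logden_increment_small (eta : R) w s t : 0 < complex.Im w ->
  (forall r, 0 < r <= eta -> 0 < S r) -> s <= t <= s + eta ->
  `|complex.Im (logden X w t) - complex.Im (logden X w s)| <= pi.
Proof.
move=> w0 etaP /andP[st ts].
have [l [th [E _ cth Eth _]]] := logden_flow w0; rewrite !E /=.
have sn r : s < r <= t -> sin (th r - th s) != 0.
  move=> /andP[sr rt]; rewrite sinB.
  have /etaP Srs : 0 < r - s <= eta.
    by rewrite subr_gt0 sr lerBlDr addrC (le_trans rt).
  have := Im_flow_den r w; have := Im_flow_den s w.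
  have := Re_flow_den r w; have := Re_flow_den s w.
  rewrite -!Eth /expC /= => r1 r2 i1 i2.
  (* Both sides are the imaginary part of [p r w * conjc (p s w)], in polar and in Cartesian
     form. *)
  have : expR (l r) * expR (l s) * (sin (th r) * cos (th s) - cos (th r) * sin (th s)) =
      gamma * complex.Im w * S (r - s).
    transitivity ((expR (l r) * sin (th r)) * (expR (l s) * cos (th s)) -
       (expR (l r) * cos (th r)) * (expR (l s) * sin (th s))); first by ring.
    by rewrite r1 r2 i1 i2 exp_pair_sub /c /d; ring.
  move=> H; apply/negP => /eqP H0; move: H; rewrite H0 mulr0 => /esym/eqP.
  by rewrite !mulf_eq0 (negbTE gamma0) (gt_eqF w0) (gt_eqF Srs).
have cD : continuous (fun r => th r - th s).
  by move=> r; apply: cvgB; [exact: cth|exact: cvg_cst].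
have pi0 : 0 < (pi : R) := pi_gt0 R.
rewrite leNgt; apply/negP; rewrite ltr_normr => /orP[H|H].
  have [||r rst] := @IVT R (fun r => th r - th s) s t pi st.
  - exact: continuous_subspaceT.
  - by rewrite subrr ge_min le_max (ltW pi0) (ltW H) orbT.
  move: rst; rewrite in_itv/= le_eqVlt => /andP[/predU1P[<-|sr] rt] rpi.
    by move: pi0; rewrite -rpi subrr ltxx.
  by have := sn r; rewrite sr rt rpi sinpi eqxx => /(_ isT).
have [||r rst] := @IVT R (fun r => th r - th s) s t (- pi) st.
- exact: continuous_subspaceT.
- rewrite subrr ge_min le_max oppr_le0 (ltW pi0) andbC.
  by rewrite [th t - th s <= - pi]lerNr (ltW H) !orbT.
move: rst; rewrite in_itv/= le_eqVlt => /andP[/predU1P[<-|sr] rt] rpi.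
  by move: pi0; rewrite -oppr_lt0 -rpi subrr ltxx.
by have := sn r; rewrite sr rt rpi sinN sinpi oppr0 eqxx => /(_ isT).
Qed.

(** Steps of length [eta] cover the time interval and each costs at most [pi]; their number does not
    depend on [w]. *)
Lemma logden_increment_bounded s t : s <= t -> exists K : R, forall w,
  0 < complex.Im w ->
  `|complex.Im (logden X w t) - complex.Im (logden X w s)| <= K.
Proof.
move=> st; have [eta eta0 etaP] := exp_pair_pos.
have H n : forall r, s <= r <= s + eta *+ n -> forall w, 0 < complex.Im w ->
    `|complex.Im (logden X w r) - complex.Im (logden X w s)| <= pi *+ n.
  elim: n => [|n IH] r.
    rewrite mulr0n addr0 => rs w w0; have -> : r = s by apply/le_anti; rewrite andbC.
    by rewrite subrr normr0.
  move=> /andP[sr rn] w w0.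
  have [rn'|/ltW rn'] := leP r (s + eta *+ n).
    apply: (le_trans (IH r _ w w0)); first by rewrite sr.
    by rewrite mulrSr lerDl ltW// pi_gt0.
  have sn : s <= s + eta *+ n by rewrite lerDl mulrn_wge0// ltW.
  rewrite -(subrKA (complex.Im (logden X w (s + eta *+ n)))) mulrSr addrC.
  apply: le_trans (ler_normD _ _) _; rewrite lerD//; last first.
    by apply: (logden_increment_small (eta := eta)) => //; rewrite rn' -addrA -mulrSr.
  by apply: IH => //; rewrite sn lexx.
pose n := (Num.truncn ((t - s) / eta)).+1.
exists (pi *+ n) => w w0; apply: H => //.
rewrite st -lerBlDl -mulr_natl -ler_pdivrMr//= ltW// truncnS_gt//.
Qed.

(** The derivative of [g r] is [p^-2], and the exact remainder of its linear approximation is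
    [- c h^2 / (p^2 p')], with [p] and [p'] the denominators at [w] and [w']. On the compact time
    interval [|p|] has a positive minimum and [|c|] a maximum, so the remainder is of order [h^2]
    uniformly in time. *)
Lemma flow_integral_cdiff w s t : s <= t -> 0 < complex.Im w ->
  cdiff (fun w => Cintegral leb `[s, t] (fun r => g r w)) w.
Proof.
move=> st w0.
pose q r := complex.Re (p r w) ^+ 2 + complex.Im (p r w) ^+ 2.
have [r0 r0st qmin] : exists2 r0, r0 \in `[s, t]%R & forall r, r \in `[s, t]%R -> q r0 <= q r.
  apply: EVT_min => //; apply: continuous_subspaceT => r.
  have [p1 p2] := flow_den_continuous w r.
  by apply: cvgD; apply: cvgM.
have [r1 r1st cmax] : exists2 r1, r1 \in `[s, t]%R & forall r, r \in `[s, t]%R -> `|c r| <= `|c r1|.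
  apply: EVT_max => //; apply: continuous_subspaceT => r; apply: cvg_norm.
  by apply: cvgM; [exact: cvg_cst|exact: cS].
pose m := cabs (p r0 w).
have m0 : 0 < m by rewrite cabs_gt0 flow_den_neq0.
have mP r : r \in `[s, t]%R -> m <= cabs (p r w).
  move=> rst; rewrite -(@ler_pXn2r _ 2)// ?nnegrE ?cabs_ge0//.
  by rewrite !cabs_sqr; exact: qmin.
pose K := `|c r1| + 1.
have K0 : 0 < K by rewrite ltr_wpDl.
have KP r : r \in `[s, t]%R -> `|c r| <= K.
  by move=> /cmax H; rewrite (le_trans H)// lerDl.
have mst : measurable (`[s, t] : set (measurableTypeR R)) by exact: measurable_itv.
have ig w' : 0 < complex.Im w' -> cintegrable leb `[s, t] (fun r => g r w').
  by move=> w'0; apply: continuous_cintegrable => r _; exact: flow_continuous.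
have ip : cintegrable leb `[s, t] (fun r => (p r w)^-1 * (p r w)^-1).
  apply: continuous_cintegrable => r _.
  by apply: rcontM; apply: rcontV; try exact: flow_den_neq0; exact: flow_den_continuous.
apply/cdiffP; exists (Cintegral leb `[s, t] (fun r => (p r w)^-1 * (p r w)^-1)).
move=> e e0.
pose A := 2 * (K / (m * m * (m / 2))) * (t - s).
have A0 : 0 <= A by rewrite !mulr_ge0 ?invr_ge0 ?mulr_ge0 ?subr_ge0 ?(ltW m0) ?(ltW K0).
(* The first bound keeps [w'] in the half-plane, the second keeps [|p r w'|] above [m / 2], and the
   third makes the total error [A |h| ^ 2] at most [e |h|]. *)
exists (Num.min (complex.Im w) (Num.min (m / 2 / K) (e / (A + 1)))).
  by rewrite !lt_min w0 !divr_gt0// ltr_wpDl.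
move=> w'; rewrite !lt_min => /and3P[h1 h2 h3].
set h := w' - w in h1 h2 h3 *.
have w'0 : 0 < complex.Im w'.
  have := Im_le_cabs h; rewrite /h Im_sub => H.
  have := le_lt_trans H h1; rewrite ltr_norml => /andP[+ _].
  by rewrite ltrBrDr addNr.
have ph r : p r w' = p r w + (c r)%:C * h.
  by rewrite !flow_denE /h; ring.
have p'm r : r \in `[s, t]%R -> m / 2 <= cabs (p r w').
  move=> rst; rewrite ph.
  have H1 : cabs ((c r)%:C * h) <= m / 2.
    rewrite cabsM cabs_real; apply: le_trans (ler_wpM2r (cabs_ge0 _) (KP r rst)) _.
    by rewrite mulrC -ler_pdivlMr// ltW.
  have H2 := cabsD_ge (p r w) ((c r)%:C * h); apply: le_trans _ H2.
  have := mP r rst; lra.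
pose rem r := - (h * h) * ((c r)%:C * ((p r w)^-1 * (p r w)^-1 * (p r w')^-1)).
have E : Cintegral leb `[s, t] (fun r => g r w') - Cintegral leb `[s, t] (fun r => g r w) -
    Cintegral leb `[s, t] (fun r => (p r w)^-1 * (p r w)^-1) * h =
    Cintegral leb `[s, t] rem.
  rewrite -CintegralB//; try exact: ig.
  rewrite [X in _ - X]mulrC -CintegralZ// -CintegralB//.
  - apply: eq_Cintegral => r _; rewrite !flowE /rem.
    have H1 := flow_den_neq0 r w0; have H2 := flow_den_neq0 r w'0.
    have H3 : (a r)%:C * (d r)%:C - (b r)%:C * (c r)%:C = 1 :> R[i].
      by rewrite -!rmorphM -rmorphB det.
    rewrite /h; move: H1 H2; rewrite !flow_denE.
    move: H3; move: (a r)%:C (b r)%:C (c r)%:C (d r)%:C => a' b' c' d' H3 H1 H2.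
    have -> : (a' * w' + b') / (c' * w' + d') - (a' * w + b') / (c' * w + d') =
        (a' * d' - b' * c') * (w' - w) / ((c' * w + d') * (c' * w' + d')).
      by field; rewrite H1 H2.
    by rewrite H3; field; rewrite H1 H2.
  - by apply: cintegrableB => //; exact: ig.
  - exact: cintegrableZ.
rewrite E.
have iE : cintegrable leb `[s, t] rem.
  apply: continuous_cintegrable => r _.
  apply: rcontM; first exact: rcont_cst.
  apply: rcontM.
    by apply: rcont_real; apply: cvgM; [exact: cvg_cst|exact: cS].
  apply: rcontM; last by apply: rcontV; [exact: flow_den_neq0|exact: flow_den_continuous].
  by apply: rcontM; apply: rcontV; try exact: flow_den_neq0; exact: flow_den_continuous.
pose B := cabs h * cabs h * (K / (m * m * (m / 2))).
have iB : leb.-integrable `[s, t] (EFin \o (fun=> B)).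
  apply: continuous_compact_integrable; first exact: segment_compact.
  by apply: continuous_subspaceT => r; exact: cvg_cst.
have remB r : `[s, t]%classic r -> cabs (rem r) <= B.
  move=> rst; have {}rst : r \in `[s, t]%R by [].
  rewrite /rem /B !cabsM cabsN cabsM !cabsV cabs_real.
  rewrite ler_wpM2l ?mulr_ge0 ?cabs_ge0//.
  have pm := mP r rst; have p'm2 := p'm r rst.
  have p0 : 0 < cabs (p r w) by exact: lt_le_trans pm.
  have p'0 : 0 < cabs (p r w') by apply: lt_le_trans p'm2; exact: divr_gt0.
  rewrite ler_pM ?mulr_ge0 ?invr_ge0 ?cabs_ge0 ?KP// -!invfM.
  exact: inv_cube_le.
apply: (le_trans (cabs_Cintegral_le mst iE iB remB)).
have lst : fine (leb `[s, t]) = t - s.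
  by rewrite -{1}(subrKC s t) lebesgue_itvcc// subr_ge0.
rewrite Rintegral_cst// lst.
have -> : 2 * (B * (t - s)) = A * cabs h * cabs h by rewrite /B /A; ring.
rewrite ler_wpM2r ?cabs_ge0//.
have A1 : 0 < A + 1 by rewrite ltr_wpDl.
move: h3; rewrite ltr_pdivlMr// => /ltW; apply: le_trans.
by rewrite mulrC ler_wpM2l ?cabs_ge0// lerDl.
Qed.

End flow.

(** * Measures with a density *)

Section density_measure.
Context d (T : measurableType d) (R : realType) (mu : {measure set T -> \bar R}).
Variable xi : T -> R.
Hypothesis xi0 : forall x, 0 <= xi x.
Hypothesis mxi : measurable_fun setT xi.

Definition density (A : set T) : \bar R := (\int[mu]_(x in A) (xi x)%:E)%E.

Let mxiE D : measurable_fun D (EFin \o xi).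
Proof. by apply: measurable_funTS; exact/measurable_EFinP. Qed.

Let density0 : density set0 = 0%E.
Proof. by rewrite /density integral_set0. Qed.

Let density_ge0 A : (0 <= density A)%E.
Proof. by apply: integral_ge0 => x _; rewrite lee_fin. Qed.

Let density_sigma_additive : semi_sigma_additive density.
Proof.
move=> /= A mA tA mUA.
rewrite /density ge0_integral_bigcup//=; last first.
  by move=> x _; rewrite lee_fin.
apply: is_cvg_ereal_nneg_natsum_cond => n _ _.
by apply: integral_ge0 => /= x ?; rewrite lee_fin.
Qed.

HB.instance Definition _ := isMeasure.Build _ _ _
  density density0 density_ge0 density_sigma_additive.

Lemma ex_density : exists nu : {measure set T -> \bar R},
  forall A, nu A = (\int[mu]_(x in A) (xi x)%:E)%E.
Proof. by exists density. Qed.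

Variable nu : {measure set T -> \bar R}.
Hypothesis nuE : forall A, measurable A -> nu A = (\int[mu]_(x in A) (xi x)%:E)%E.

Lemma density_dominated : nu `<< mu.
Proof.
apply/null_content_dominatesP => A mA muA; rewrite nuE//.
exact: null_set_integral.
Qed.

Import HBNNSimple.

Lemma integral_density_nnsfun (h : {nnsfun T >-> R}) :
  (\int[nu]_x (h x)%:E = \int[mu]_x ((h x)%:E * (xi x)%:E))%E.
Proof.
transitivity (\sum_(y \in range h) y%:E * nu (h @^-1` [set y]))%E.
  by rewrite integralT_nnsfun sintegralE.
transitivity (\int[mu]_x (\sum_(y \in range h) (y * \1_(h @^-1` [set y]) x * xi x)%:E))%E; last first.
  apply: eq_integral => x _; rewrite -EFinM [in RHS](fimfunE h) fsumEFin//.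
  by rewrite -mulr_fsuml.
rewrite ge0_integral_fsum//; last 2 first.
- move=> y; apply/measurable_EFinP; apply: measurable_funM => //.
  by apply: measurable_funM => //; exact: measurable_indic.
- by move=> y x _; rewrite lee_fin mulr_ge0//; have := nnfun_muleindic_ge0 h y x;
  rewrite -EFinM lee_fin.
apply: eq_fsbigr => y; rewrite inE => -[t _ <-].
rewrite nuE// integral_mkcond -ge0_integralZl//.
- apply: eq_integral => x _; rewrite patchE -mulrA EFinM indicE; congr (_ * _)%E.
  by case: ifPn => _; rewrite ?mul1r ?mul0r.
- apply/(measurable_restrictT _ _).1 => //; exact: mxiE.
- by move=> x _; rewrite patchE; case: ifPn => // _; rewrite lee_fin.
- by rewrite lee_fin.
Qed.

Lemma ge0_integral_density (f : T -> R) : (forall x, 0 <= f x) ->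
  measurable_fun setT f ->
  (\int[nu]_x (f x)%:E = \int[mu]_x (f x * xi x)%:E)%E.
Proof.
move=> f0 mf; have mfE : measurable_fun setT (EFin \o f) by exact/measurable_EFinP.
pose h := nnsfun_approx measurableT mfE.
have hf x : (EFin \o h n) x @[n --> \oo] --> (f x)%:E.
  by apply: cvg_nnsfun_approx => // t _; rewrite lee_fin.
have hx0 n x : 0 <= h n x by [].
have mono : {homo (fun n x => (h n x)%:E) : n m / (n <= m)%N >-> forall x, n x <= m x}%E.
  by move=> n m nm x; rewrite lee_fin; exact/lefP/nd_nnsfun_approx.
transitivity (limn (fun n => \int[nu]_x (h n x)%:E))%E.
  rewrite -monotone_convergence//.
  - by apply: eq_integral => x _; apply/esym/cvg_lim => //; exact: hf.
  - by move=> n; exact/measurable_EFinP.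
  - by move=> n x _; rewrite lee_fin.
  - by move=> x _ n m nm; exact: mono.
transitivity (limn (fun n => \int[mu]_x ((h n x)%:E * (xi x)%:E)))%E.
  by under eq_fun do rewrite integral_density_nnsfun.
rewrite -monotone_convergence//.
- apply: eq_integral => x _; apply/cvg_lim => //; rewrite EFinM.
  by apply: cvgeZr => //; exact: hf.
- by move=> n; apply: emeasurable_funM; [exact/measurable_EFinP|exact: mxiE].
- by move=> n x _; rewrite mule_ge0 ?lee_fin.
- by move=> x _ n m nm; rewrite lee_wpmul2r ?lee_fin//; exact: mono.
Qed.

(** Multiplication by the nonnegative density commutes with taking positive and negative parts,
    which reduces the formula to nonnegative functions. *)
Lemma integral_density (f : T -> R) : measurable_fun setT f ->
  (\int[nu]_x (f x)%:E = \int[mu]_x (f x * xi x)%:E)%E.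
Proof.
move=> mf; rewrite integralE [RHS]integralE.
have posE (g : T -> R) x : ((EFin \o g)^\+ x = (Num.max (g x) 0)%:E)%E.
  by rewrite funepos.unlock /= EFin_max.
have negE (g : T -> R) x : ((EFin \o g)^\- x = (Num.max (- g x) 0)%:E)%E.
  by rewrite funeneg.unlock /= EFin_max.
congr (_ - _)%E.
- transitivity (\int[nu]_x (Num.max (f x) 0)%:E)%E.
    by apply: eq_integral => x _; exact: posE.
  rewrite ge0_integral_density.
  + apply: eq_integral => x _; rewrite (posE (fun x => f x * xi x)).
    by rewrite maxr_pMl// mul0r.
  + by move=> x; rewrite le_max lexx orbT.
  + exact: measurable_maxr.
- transitivity (\int[nu]_x (Num.max (- f x) 0)%:E)%E.
    by apply: eq_integral => x _; exact: negE.
  rewrite ge0_integral_density.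
  + apply: eq_integral => x _; rewrite (negE (fun x => f x * xi x)).
    by rewrite maxr_pMl// mul0r mulNr.
  + by move=> x; rewrite le_max lexx orbT.
  + by apply: measurable_maxr => //; exact: measurableT_comp.
Qed.

Lemma Cintegral_density (f : T -> R[i]) : cmeasurable setT f ->
  Cintegral nu setT f = Cintegral mu setT (fun x => (xi x)%:C * f x).
Proof.
move=> [mr mi]; apply: complex_ext => /=; rewrite /Rintegral integral_density//;
  congr fine; apply: eq_integral => x _.
  by rewrite Re_mul /= mul0r subr0 mulrC.
by rewrite Im_mul /= mul0r addr0 mulrC.
Qed.

Lemma Lfun_bounded (K : R) : (forall x, xi x <= K) -> xi \in Lfun mu +oo%E.
Proof.
move=> xiK; rewrite inE; apply/andP; split; rewrite inE /=.
  exact: mxi.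
rewrite /finLfun/= /finite_norm unlock /=; case: ifPn => // _.
apply: (@le_lt_trans _ _ K%:E); last by rewrite ltry.
apply/ess_sup_inf.ess_supP; apply: aeW => x /=.
by rewrite lee_fin ger0_norm.
Qed.

End density_measure.

(** * The integrated Herglotz function *)

Section integrated_flow.
Context {R : realType}.
Variables (alpha beta gamma : R) (gamma0 : gamma != 0).
Let X := mx22 beta alpha gamma (- beta).
Variables (M0 : R[i] -> R[i]) (hM0 : herglotz M0).
Let leb := @lebesgue_measure R.

Let M0_gt0 z : 0 < complex.Im z -> 0 < complex.Im (M0 z).
Proof. by move=> z0; have [] := hM0 z0. Qed.

Lemma Mint_cdiff s t z : s <= t -> 0 < complex.Im z -> cdiff (Mint X M0 s t) z.
Proof.
move=> st z0; have [C [S CS]] := expmx_traceless alpha beta gamma.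
have [dM _] := hM0 z0.
exact: (cdiff_comp (Cdiff dM) (flow_integral_cdiff CS st (M0_gt0 z0))).
Qed.

Lemma Im_Mint s t z : s <= t -> 0 < complex.Im z -> complex.Im (Mint X M0 s t z) =
  gamma^-1 * (complex.Im (logden X (M0 z) t) - complex.Im (logden X (M0 z) s)).
Proof.
move=> st z0; have [C [S CS]] := expmx_traceless alpha beta gamma.
have [l [th [E _ _ _ I]]] := logden_flow gamma0 CS (M0_gt0 z0).
by rewrite !E /= mulrC -I.
Qed.

Lemma Im_logden0 z : 0 < complex.Im z -> complex.Im (logden X (M0 z) 0) = 0.
Proof.
move=> z0; have [C [S CS]] := expmx_traceless alpha beta gamma.
by have [l [th [E th0 _ _ _]]] := logden_flow gamma0 CS (M0_gt0 z0); rewrite E.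
Qed.

(** By the mean value theorem for a primitive, the integral is [t - s] times a value of a positive
    continuous function. *)
Lemma Im_Mint_gt0 s t z : s < t -> 0 < complex.Im z -> 0 < complex.Im (Mint X M0 s t z).
Proof.
move=> st z0; have [C [S CS]] := expmx_traceless alpha beta gamma.
have w0 := M0_gt0 z0.
pose phi r := complex.Im (moebius (expmx (r *: X)) (M0 z)).
have phi0 r : 0 < phi r.
  have := Im_flow CS r w0; rewrite -/(phi r) => ->; apply: divr_gt0 => //.
  rewrite lt_def addr_ge0 -?expr2 ?sqr_ge0// andbT -cabs_sqr.
  by rewrite expf_eq0 /= cabs_eq0 (flow_den_neq0 CS).
have cphi : continuous phi by move=> r; have [] := flow_continuous CS r w0.
have [Phi [_ dPhi IPhi]] := continuous_primitive cphi.
rewrite /Mint /Cintegral /Mflow /=.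
have := IPhi _ _ (ltW st); rewrite -/leb => ->.
have [|c _ ->] := @MVT R Phi phi s t st (fun x _ => dPhi x).
  by apply: continuous_subspaceT => r; exact: der_continuous (dPhi r).
by rewrite mulr_gt0// subr_gt0.
Qed.

Lemma Im_Mint_bounded s t : s < t -> exists K : R, forall z, 0 < complex.Im z ->
  0 <= complex.Im (Mint X M0 s t z) <= K.
Proof.
move=> st; have [C [S CS]] := expmx_traceless alpha beta gamma.
have [K KP] := logden_increment_bounded gamma0 CS (ltW st).
exists (`|gamma^-1| * K) => z z0; rewrite (ltW (Im_Mint_gt0 st z0)) andTb.
rewrite (Im_Mint (ltW st) z0); apply: (le_trans (ler_norm _)).
by rewrite normrM ler_wpM2l// KP// M0_gt0.
Qed.

(** The half-plane results apply to [Mint X M0 s t], whose imaginary part is nonnegative and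
    bounded; the density [pi^-1 * u] matches the factor [pi^-1] in [xi_approx]. *)
Lemma xi_approx_increment_cvg s t : s < t -> exists (v : R -> R) (K : R), [/\
  measurable_fun setT (v : measurableTypeR R -> R), forall x, 0 <= v x <= K,
  {ae leb, forall x, gamma^-1 * (xi_approx X M0 t x e - xi_approx X M0 s x e)
    @[e --> 0^'+] --> v x} &
  forall z, 0 < complex.Im z ->
    cintegrable leb setT (fun x => (v x)%:C * herglotz_kernel z x) /\
    Mint X M0 s t z = (complex.Re (Mint X M0 s t (0 +i* 1)))%:C +
      Cintegral leb setT (fun x => (v x)%:C * herglotz_kernel z x)].
Proof.
move=> st; have [K KP] := Im_Mint_bounded st.
have fd z (z0 : 0 < complex.Im z) := Mint_cdiff (ltW st) z0.
have [e [u [e0 mu uK eu]]] := boundary_function fd KP.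
have pi0 : 0 < (pi : R) := pi_gt0 R.
exists (fun x => pi^-1 * u x), (pi^-1 * K); split.
- by apply: measurable_funM => //; exact: measurable_cst.
- move=> x; have /andP[u0 u1] := uK x.
  by rewrite mulr_ge0 ?invr_ge0 ?(ltW pi0)//= ler_wpM2l// invr_ge0 ltW.
- have aeF : Filter (nbhs (almost_everywhere leb)) := ae_filter_ringOfSetsType leb.
  have := Im_boundary_ae fd KP e0 mu uK eu; apply: filterS => x.
  apply: cvg_trans; apply: near_eq_cvg; near=> y.
  have y0 : 0 < y by near: y; exact: nbhs_right_gt.
  rewrite (Im_Mint (ltW st))// /xi_approx; ring.
- move=> z z0; exact: (herglotz_representation_boundary fd KP e0 mu uK eu z0).
Unshelve. all: by end_near. Qed.

(** The previous lemma only controls increments. Taking 0 as the other time isolates [xi_approx] at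
    [t], as the logarithm vanishes at time 0; for [t < 0] the increment runs from [t] to 0, whence
    the sign in [- gamma * v x]. *)
Lemma xi_approx_cvg t : {ae leb, forall x, cvg (xi_approx X M0 t x e @[e --> 0^'+])}.
Proof.
have aeF : Filter (nbhs (almost_everywhere leb)) := ae_filter_ringOfSetsType leb.
have xi00 x : \forall e \near 0^'+, xi_approx X M0 0 x e = 0.
  near=> y; have y0 : 0 < y by near: y; exact: nbhs_right_gt.
  by rewrite /xi_approx Im_logden0 ?mulr0.
have [t0|t0|->] := ltgtP t 0.
- have [v [K [_ _ + _]]] := xi_approx_increment_cvg t0; apply: filterS => x H.
  apply/cvg_ex; exists (- gamma * v x).
  apply: cvg_trans (@cvgMl_tmp _ _ _ _ _ (- gamma) _ H).
  apply: near_eq_cvg; near=> y.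
  have -> : xi_approx X M0 0 x y = 0 by near: y; exact: xi00.
  by field.
- have [v [K [_ _ + _]]] := xi_approx_increment_cvg t0; apply: filterS => x H.
  apply/cvg_ex; exists (gamma * v x).
  apply: cvg_trans (@cvgMl_tmp _ _ _ _ _ gamma _ H).
  apply: near_eq_cvg; near=> y.
  have -> : xi_approx X M0 0 x y = 0 by near: y; exact: xi00.
  by field.
- apply: aeW => x; apply/cvg_ex; exists 0.
  by apply: cvg_near_cst; exact: xi00.
Unshelve. all: by end_near. Qed.

Lemma herglotz_kernel_measurable (z : R[i]) : 0 < complex.Im z ->
  @cmeasurable _ (measurableTypeR R) _ setT (herglotz_kernel z).
Proof.
move=> z0; apply: continuous_cmeasurable => t.
apply: (rcont_ext (p := fun x => (x%:C + - z)^-1 + (- (x * (1 + x ^+ 2)^-1))%:C)) => [s|].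
  by rewrite /herglotz_kernel rmorphN.
apply: rcontD.
  apply: rcontV; last first.
    by apply: rcontD; [apply: rcont_real; exact: cvg_id|exact: rcont_cst].
  apply/negP => /eqP /(congr1 (@complex.Im R)); rewrite Im_add Im_opp /= add0r.
  by move/eqP; rewrite oppr_eq0 gt_eqF.
apply: rcont_real; apply: cvgN; apply: cvgM; first exact: cvg_id.
apply: cvgV; first by rewrite gt_eqF// oneDsqr_gt0.
by apply: cvgD; [exact: cvg_cst|exact: exprn_continuous].
Qed.

End integrated_flow.

Theorem theorem3p3 (R : realType) (alpha beta gamma : R) (gamma0 : gamma != 0)
    (X : 'M[R]_2) (defX : X = mx22 beta alpha gamma (- beta))
    (M0 : R[i] -> R[i]) (herglotzM0 : herglotz M0)
    (t1 t2 : R) (lt_t12 : t1 < t2) :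
  herglotz (Mint X M0 t1 t2) /\
  exists (B : R) (mu : {measure set (measurableTypeR R) -> \bar R})
         (xi12 : R -> R),
    [/\ (\int[mu]_x ((1 + x ^+ 2)^-1)%:E < +oo)%E,
        forall z : R[i], 0 < complex.Im z ->
          Mint X M0 t1 t2 z = B%:C + Cintegral mu setT (herglotz_kernel z),
        [/\ mu `<< lebesgue_measure,
            xi12 \in Lfun (@lebesgue_measure R) +oo%E &
            forall A : set R, measurable A ->
              mu A = (\int[lebesgue_measure]_(x in A) (xi12 x)%:E)%E],
        forall t : R, {ae lebesgue_measure, forall x : R,
          cvg (xi_approx X M0 t x e @[e --> 0^'+])} &
        {ae lebesgue_measure, forall x : R,
          xi12 x = gamma^-1 * (xi X M0 t2 x - xi X M0 t1 x)}].
Proof.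
rewrite {}defX; split.
  move=> z z0; split; last exact: Im_Mint_gt0.
  by have [] := Mint_cdiff alpha beta gamma herglotzM0 (ltW lt_t12) z0.
have [v [K [mv vK vcvg vrep]]] := xi_approx_increment_cvg alpha beta gamma0 herglotzM0 lt_t12.
have v0 x : 0 <= v x by have /andP[] := vK x.
have v1 x : v x <= K by have /andP[] := vK x.
have [nu nuE] := ex_density (@lebesgue_measure R) v0 mv.
have nuE' A : measurable A -> nu A = (\int[@lebesgue_measure R]_(x in A) (v x)%:E)%E.
  by move=> _; exact: nuE.
exists (complex.Re (Mint (mx22 beta alpha gamma (- beta)) M0 t1 t2 (0 +i* 1))), nu, v.
split.
- have p1 x : 0 <= (1 + x ^+ 2)^-1 :> R by rewrite invr_ge0 ltW// oneDsqr_gt0.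
  have mp : measurable_fun setT ((fun x => (1 + x ^+ 2)^-1) : measurableTypeR R -> R).
    exact: continuous_measurable_fun continuous_inv_oneDsqr.
  (* The density is at most [K], so [K / (1 + x ^ 2)] is an integrable majorant. *)
  have /integrableP[mi ioo] := integrable_inv_oneDsqr K.
  rewrite (integral_density (T := measurableTypeR R) v0 mv nuE')//.
  apply: le_lt_trans ioo; apply: ge0_le_integral => //.
  + by move=> x _; rewrite lee_fin mulr_ge0.
  + by apply/measurable_EFinP; exact: measurable_funM.
  + exact: measurableT_comp.
  + move=> x _; rewrite lee_fin; apply: le_trans (ler_norm _).
    by rewrite mulrC ler_wpM2r.
- move=> z z0; have [_ ->] := vrep z z0; congr (_ + _).
  rewrite (Cintegral_density (T := measurableTypeR R) v0 mv nuE')//.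
  exact: herglotz_kernel_measurable.
- split; first exact: (density_dominated (T := measurableTypeR R) mv nuE').
    exact: (Lfun_bounded (T := measurableTypeR R) _ v0 mv v1).
  by move=> A _; exact: nuE.
- by move=> t; exact: xi_approx_cvg.
- have aeF : Filter (nbhs (almost_everywhere (@lebesgue_measure R))) :=
    ae_filter_ringOfSetsType _.
  have h1 := xi_approx_cvg alpha beta gamma0 herglotzM0 t1.
  have h2 := xi_approx_cvg alpha beta gamma0 herglotzM0 t2.
  (* At almost every [x] the two limits exist separately, so the limit [v x] of the scaled increment
     is the scaled difference of the limits. *)
  apply: filterS3 vcvg h1 h2 => x vx c1 c2.
  apply: (cvg_unique _ vx); first exact: Rhausdorff.
  by apply: cvgMl_tmp; apply: cvgB.
Qed.
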